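(* Let $2-\epsilon\le p<2$ and $1/p+1/p'=1$. Let $\kappa$ be a positive constant, let $\nu\in W^{2,\infty}(\mathbb R)$, and let $\mathbf f\in\mathbf H^1(\Omega)$ satisfy $\|\mathbf f\|_{\mathbf L^2(\Omega)}\le\nu_-\min\{\mathfrak C,\tilde{\mathfrak C}\}$. Let $(\mathbf u,\mathsf p,T)\in\mathbf H_0(\mathrm{div},\Omega)\times L^2_0(\Omega)\times W^{1,p}_0(\Omega)$ be a solution of the continuous coupled problem and let $(\mathbf u_h,\mathsf p_h,T_h)\in\mathbf X_h\times Q_h\times V_h$ be a solution of the discrete coupled problem for $0<h\le h_\star$ (both written in the context). Set $e_T=T-T_h$, $\mathbf e_{\mathbf u}=\mathbf u-\mathbf u_h$, $e_{\mathsf p}=\mathsf p-\mathsf p_h$. Assume that, for some $0<\rho<1$ and $0<\varrho<1$, $$\mathfrak C^{-1}\|\mathbf e_{\mathbf u}\|_{\mathbf L^2(\Omega)}\le\rho,\qquad C_{\mathcal L}\|\delta_z\|_{W^{-1,p}(\Omega)}\|\mathbf u\|_{\mathbf L^{p'}(\Omega)}\le\varrho(1-\rho)\nu_-\mathfrak C^2.$$ Then, for every $K\in\mathscr T_h$, $$\mathscr E_K\le C\Big[h_K^{\frac2{p'}}\Big(\|\mathbf e_{\mathbf u}\|_{\mathbf L^2(\mathcal N_K)}+\|e_T\|_{L^{\frac{2p}{2-p}}(\mathcal N_K)}+\|\nabla e_T\|_{\mathbf L^p(\mathcal N_K)}\Big)+\|e_{\mathsf p}\|_{L^2(\mathcal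 N_K)}+\sum_{K'\in\mathcal N_K}h_{K'}\Big(\|\nu_h(T)-\nu(T)\|_{L^{\frac{2p}{2-p}}(K')}+\|\mathbf f-\mathscr P_{K'}\mathbf f\|_{\mathbf L^2(K')}\Big)\Big],$$ where $\mathscr P_K$ denotes the $\mathbf L^2(K)$-orthogonal projection onto $[\mathbb P_0(K)]^2$ and the constant $C>0$ is independent of the continuous and discrete solutions $(\mathbf u,\mathsf p,T)$ and $(\mathbf u_h,\mathsf p_h,T_h)$, the size of the elements of $\mathscr T_h$, and $\#\mathscr T_h$.
   Context: $\Omega\subset\mathbb R^2$ is an open bounded polygonal domain with Lipschitz boundary and unit outward normal $\mathbf n$; $z\in\Omega$; bold letters denote vector-valued functions and spaces. $W^{-1,p}(\Omega)=(W^{1,p'}_0(\Omega))'$ with the dual norm induced by $S\mapsto\|\nabla S\|_{\mathbf L^{p'}(\Omega)}$; $\langle\delta_z,S\rangle=S(z)$. $L^2_0(\Omega)$: zero-average $L^2$ functions; $\mathbf H_0(\mathrm{div},\Omega)=\{\mathbf v\in\mathbf L^2(\Omega):\mathrm{div}\,\mathbf v\in L^2(\Omega),\ \mathbf v\cdot\mathbf n|_{\partial\Omega}=0\}$. The viscosity $\nu:\mathbb R\to\mathbb R$ is Lipschitz with constant $C_{\mathcal L}$ and $0<\nu_-\le\nu(s)\le\nu_+$ for all $s$. Continuous coupled problem: $\int_\Omega(\nu(T)\mathbf u\cdot\mathbf v-\mathsf p\,\mathrm{div}\,\mathbf v)=\int_\Omega\mathbf f\cdot\mathbf v$ for all $\mathbf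 v\in\mathbf H_0(\mathrm{div},\Omega)$; $\int_\Omega\mathsf q\,\mathrm{div}\,\mathbf u=0$ for all $\mathsf q\in L^2_0(\Omega)$; $\int_\Omega(\kappa\nabla T\cdot\nabla S-T\mathbf u\cdot\nabla S)=\langle\delta_z,S\rangle$ for all $S\in W^{1,p'}_0(\Omega)$. Discrete coupled problem: the same three equations with $(\mathbf u,\mathsf p,T)$ replaced by $(\mathbf u_h,\mathsf p_h,T_h)$ and test functions in $\mathbf X_h$, $Q_h$, $V_h$, where $\mathscr T_h$ is a member of a family of conforming shape regular meshes of $\bar\Omega$ into closed triangles $K$, with $h_K=\mathrm{diam}(K)$ (here $h=1/k$ is only an index, $k\in\mathbb N$ numbering a sequence of refinements of an initial mesh), $V_h=\{S_h\in C(\bar\Omega):S_h|_K\in\mathbb P_1(K)\ \forall K,\ S_h|_{\partial\Omega}=0\}$, $\mathbf X_h=\{\mathbf v_h\in\mathbf H_0(\mathrm{div},\Omega):\mathbf v_h|_K=a_K\mathbf x+\mathbf b_K,\ a_K\in\mathbb R,\ \mathbf b_K\in\mathbb R^2\}$, $Q_h=\{\mathsf q_h\in L^2_0(\Omega):\mathsf q_h|_K\in\mathbb P_0(K)\}$. The numbers $\epsilon>0$, $h_\star>0$ are such that the discrete problem admits a solution for $0<h\le h_\star$, $2-\epsilon\le p<2$. Constants: $C_e$ is the best constant in $\|R\|_{L^{2p/(2-p)}(\Omega)}\le C_e\|\nabla R\|_{\mathbf L^p(\Omega)}$ on $W^{1,p}_0(\Omega)$; $C_\kappa$ is such that $\|\nabla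 R\|_{\mathbf L^p(\Omega)}\le C_\kappa\sup_{0\ne S\in W^{1,p'}_0(\Omega)}\int_\Omega\kappa\nabla R\cdot\nabla S/\|\nabla S\|_{\mathbf L^{p'}(\Omega)}$ for all $R\in W^{1,p}_0(\Omega)$; $\tilde C_\kappa$, independent of $h$, is such that $\|\nabla R_h\|_{\mathbf L^p(\Omega)}\le\tilde C_\kappa\sup_{0\ne S_h\in V_h}\int_\Omega\kappa\nabla R_h\cdot\nabla S_h/\|\nabla S_h\|_{\mathbf L^{p'}(\Omega)}$ for all $R_h\in V_h$, $0<h\le h_\star$. $\mathfrak C=(2C_eC_\kappa)^{-1}$, $\tilde{\mathfrak C}=(2C_e\tilde C_\kappa)^{-1}$. Indicator: for an internal side $\gamma=\partial K^+\cap\partial K^-$ with unit normals $\mathbf n^\pm$ pointing towards $K^\pm$, $\mathscr J_\gamma=[\![\mathsf p_h\mathbf n]\!]=\mathsf p_h|_{K^+}\mathbf n^++\mathsf p_h|_{K^-}\mathbf n^-$; $\mathscr R_K=(\mathbf f-\nu(T_h)\mathbf u_h-\nabla\mathsf p_h)|_K$; $\mathscr E_K=(h_K^2\|\mathscr R_K\|^2_{\mathbf L^2(K)}+h_K\|\mathscr J_\gamma\|^2_{\mathbf L^2(\partial K\setminus\partial\Omega)})^{1/2}$. With $\mathscr S_K$ the set of internal sides of $K$, $\mathcal N_K=\bigcup\{K'\in\mathscr T_h:\mathscr S_K\cap\mathscr S_{K'}\ne\emptyset\}$, also used for the set of those $K'$. Linear approximation of $\nu$: for $S\in W^{1,p}(K)$,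 $\nu_h(S)\in\mathbb P_1(K)$ is defined by $\nu_h(S)(\mathbf x)=\frac1{|K|}\int_K\nu(S(\mathbf y))\,d\mathbf y+\big[\frac1{|K|}\int_K\nabla(\nu(S))(\mathbf y)\,d\mathbf y\big]\cdot(\mathbf x-\mathbf c)$, $\mathbf x\in K$, where $|K|$ is the area and $\mathbf c$ the center of $K$.
   Formalization: The patch N_K is taken always to contain K itself; this differs from the stated definition only when K has no internal side (a mesh with a single triangle), where the literal N_K is empty, the right-hand side is 0 and the claim fails for a nonzero constant f. *)

(* Defs.v *)
From HB Require Import structures.
From mathcomp Require Import all_boot all_order all_algebra.
From mathcomp Require Import all_classical all_reals all_analysis.
Set Implicit Arguments.
Unset Strict Implicit.
Unset Printing Implicit Defensive.
Import Order.TTheory GRing.Theory Num.Theory.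
Import numFieldNormedType.Exports.
Local Open Scope classical_set_scope.
Local Open Scope ring_scope.

(* Points and vectors of the plane are pairs.  The library norm on pairs is the
   max norm, so the Euclidean structure is defined here; the product topology
   and the product Borel structure of the library are the usual
   ones. *)

Notation plane R := (R * R)%type.

(* [measurableTypeR R] is R with its Borel sigma-algebra, on which the library
   states Lebesgue measure. *)
Notation mplane R := (measurableTypeR R * measurableTypeR R)%type.

Definition leb2 (R : realType) : {measure set (mplane R) -> \bar R} :=
  (@lebesgue_measure R \x @lebesgue_measure R)%E.

Definition borel_fun (R : realType) (f : plane R -> R) : Prop :=
  measurable_fun [set: mplane R] (f : mplane R -> measurableTypeR R).

Definition dot (R : realType) (u v : plane R) : R := u.1 * v.1 + u.2 * v.2.

Definition enorm (R : realType) (u : plane R) : R := Num.sqrt (dot u u).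

Definition smul (R : realType) (a : R) (u : plane R) : plane R :=
  (a * u.1, a * u.2).

Definition perp (R : realType) (u : plane R) : plane R := (- u.2, u.1).

Definition lerp (R : realType) (a b : plane R) (t : R) : plane R :=
  a + smul t (b - a).

Definition segment (R : realType) (a b : plane R) : set (plane R) :=
  lerp a b @` `[0, 1].

Definition ediam (R : realType) (A : set (plane R)) : R :=
  sup [set enorm (xy.1 - xy.2) | xy in A `*` A].

(* A class of functions on [D] is represented by a Borel function on the whole
   plane, whose values outside [D] are irrelevant. *)

Definition nLp (R : realType) (D : set (plane R)) (p : R)
    (f : plane R -> R) : \bar R :=
  'N[leb2 R]_(p%:E)[EFin \o (f \_ D)]%E.

Definition nLpv (R : realType) (D : set (plane R)) (p : R)
    (v : plane R -> plane R) : \bar R :=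
  nLp D p (fun x => enorm (v x)).

Definition Lp (R : realType) (D : set (plane R)) (p : R)
    (f : plane R -> R) : Prop :=
  borel_fun f /\ f \_ D \in Lfun (leb2 R) p%:E.

Definition Lpv (R : realType) (D : set (plane R)) (p : R)
    (v : plane R -> plane R) : Prop :=
  Lp D p (fun x => (v x).1) /\ Lp D p (fun x => (v x).2).

Definition L20 (R : realType) (D : set (plane R)) (q : plane R -> R) : Prop :=
  Lp D 2 q /\ \int[leb2 R]_(x in D) q x = 0.

Definition locally_integrable2 (R : realType) (D : set (plane R))
    (f : plane R -> R) : Prop :=
  forall A : set (plane R), compact A -> A `<=` D ->
    (leb2 R).-integrable A (EFin \o f).

Definition pd1 (R : realType) (f : plane R -> R) (x : plane R) : R :=
  derive1 (fun t => f (t, x.2)) x.1.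

Definition pd2 (R : realType) (f : plane R -> R) (x : plane R) : R :=
  derive1 (fun t => f (x.1, t)) x.2.

Fixpoint Ck (R : realType) (n : nat) (f : plane R -> R) : Prop :=
  match n with
  | 0%N => continuous f
  | n'.+1 => [/\ continuous f,
      forall x : plane R, derivable (fun t : R => f (t, x.2)) x.1 1
                       /\ derivable (fun t : R => f (x.1, t)) x.2 1,
      Ck n' (pd1 f) & Ck n' (pd2 f)]
  end.

Definition test_fun (R : realType) (D : set (plane R))
    (phi : plane R -> R) : Prop :=
  (forall n, Ck n phi) /\
  exists A : set (plane R), [/\ compact A, A `<=` D &
    forall x, ~ A x -> phi x = 0].

Definition is_wgrad (R : realType) (D : set (plane R)) (S : plane R -> R)
    (G : plane R -> plane R) : Prop :=
  [/\ locally_integrable2 D S,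
      borel_fun (fun x => (G x).1)
        /\ borel_fun (fun x => (G x).2),
      locally_integrable2 D (fun x => (G x).1)
        /\ locally_integrable2 D (fun x => (G x).2) &
      forall phi, test_fun D phi ->
        \int[leb2 R]_(x in D) (S x * pd1 phi x) =
          - (\int[leb2 R]_(x in D) ((G x).1 * phi x)) /\
        \int[leb2 R]_(x in D) (S x * pd2 phi x) =
          - (\int[leb2 R]_(x in D) ((G x).2 * phi x))].

(* a representative of the weak gradient (junk value 0 if there is none) *)
Definition wgrad (R : realType) (D : set (plane R)) (S : plane R -> R) :
    plane R -> plane R :=
  xget (cst 0) [set G | is_wgrad D S G].

Definition is_wdiv (R : realType) (D : set (plane R))
    (v : plane R -> plane R) (d : plane R -> R) : Prop :=
  [/\ locally_integrable2 D (fun x => (v x).1)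
        /\ locally_integrable2 D (fun x => (v x).2),
      borel_fun d, locally_integrable2 D d &
      forall phi, test_fun D phi ->
        \int[leb2 R]_(x in D) dot (v x) (pd1 phi x, pd2 phi x) =
          - (\int[leb2 R]_(x in D) (d x * phi x))].

Definition wdiv (R : realType) (D : set (plane R))
    (v : plane R -> plane R) : plane R -> R :=
  xget (cst 0) [set d | is_wdiv D v d].

Definition W1p (R : realType) (D : set (plane R)) (p : R)
    (S : plane R -> R) : Prop :=
  [/\ Lp D p S, is_wgrad D S (wgrad D S) & Lpv D p (wgrad D S)].

(* W^{1,p}_0(D) is the closure of C_c^oo(D). *)
Definition W1p0 (R : realType) (D : set (plane R)) (p : R)
    (S : plane R -> R) : Prop :=
  W1p D p S /\
  exists phi : nat -> plane R -> R, [/\ forall n, test_fun D (phi n),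
    nLp D p (fun x => S x - phi n x) @[n --> \oo] --> 0%E &
    nLpv D p (fun x => wgrad D S x - (pd1 (phi n) x, pd2 (phi n) x))
      @[n --> \oo] --> 0%E].

(* The last clause is v . n = 0 on the boundary: the normal trace of a field in
   H(div) is the functional phi |-> \int (v . grad phi + (div v) phi) on the
   traces of the functions phi of H^1. *)
Definition Hdiv0 (R : realType) (D : set (plane R))
    (v : plane R -> plane R) : Prop :=
  [/\ Lpv D 2 v, is_wdiv D v (wdiv D v), Lp D 2 (wdiv D v) &
    forall phi, W1p D 2 phi ->
      \int[leb2 R]_(x in D) (dot (v x) (wgrad D phi x) + wdiv D v x * phi x)
        = 0].

(* <delta_z, S>: the value at z of the continuous representative of S *)
Definition delta (R : realType) (D : set (plane R)) (z : plane R)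
    (S : plane R -> R) : R :=
  xget (cst 0) [set g : plane R -> R |
    (forall x, D x -> {for x, continuous g}) /\
    {ae leb2 R, forall x, D x -> g x = S x}] z.

(* The supremum, over the S <> 0 of X, of L S / |grad S|_{L^q(D)}.  Adding 0
   changes nothing for an odd or nonnegative L, except when there is no such S:
   then the supremum is 0. *)
Definition dual_sup (R : realType) (D : set (plane R)) (q : R)
    (X : set (plane R -> R)) (L : (plane R -> R) -> R) : \bar R :=
  ereal_sup ([set 0%E] `|`
    [set (L S / fine (nLpv D q (wgrad D S)))%:E | S in
      [set S | X S /\ ~ {ae leb2 R, forall x, D x -> S x = 0}]]).

(* |delta_z|_{W^{-1,p}(D)}, where q is the exponent conjugate to p *)
Definition delta_norm (R : realType) (D : set (plane R)) (z : plane R)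
    (q : R) : \bar R :=
  dual_sup D q (W1p0 D q) (fun S => `|delta D z S|).

Definition test_fun1 (R : realType) (phi : R -> R) : Prop :=
  (forall n x, derivable (derive1n n phi) x 1) /\
  exists M : R, forall x, M < `|x| -> phi x = 0.

Definition is_wder (R : realType) (g g' : R -> R) : Prop :=
  [/\ locally_integrable setT g, locally_integrable setT g' &
    forall phi, test_fun1 phi ->
      \int[@lebesgue_measure R]_x (g x * derive1 phi x) =
        - (\int[@lebesgue_measure R]_x (g' x * phi x))].

(* g in W^{2,oo}(R), with g1 = g' and g2 = g'' *)
Definition W2oo (R : realType) (g : R -> R) : Prop :=
  exists g1 g2 : R -> R, [/\ is_wder g g1, is_wder g1 g2,
    g \in Lfun (@lebesgue_measure R) +oo%E,
    g1 \in Lfun (@lebesgue_measure R) +oo%E &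
    g2 \in Lfun (@lebesgue_measure R) +oo%E].

Definition bdry (R : realType) (D : set (plane R)) : set (plane R) :=
  closure D `\` interior D.

Definition lipschitz_boundary (R : realType) (D : set (plane R)) : Prop :=
  forall x, bdry D x ->
  exists (e : plane R) (r s L : R) (phi : R -> R),
    [/\ enorm e = 1, 0 < r, 0 < s,
        phi 0 = 0 /\ (forall a b, `|phi a - phi b| <= L * `|a - b|) &
        forall a b, `|a| < r -> `|b| < s ->
          (D (x + smul a e + smul b (perp e)) <-> phi a < b)].

Definition polygonal_domain (R : realType) (D : set (plane R)) : Prop :=
  [/\ open D, connected D,
      exists M : R, forall x, D x -> enorm x <= M,
      lipschitz_boundary D &
      exists s : seq (plane R * plane R),
        bdry D = \bigcup_(e in [set` s]) segment e.1 e.2].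

Definition triangle (R : realType) := {ffun 'I_3 -> plane R}.

Definition nondegenerate (R : realType) (K : triangle R) : Prop :=
  dot (K (inord 1) - K ord0) (perp (K (inord 2) - K ord0)) != 0.

Definition tri (R : realType) (K : triangle R) : set (plane R) :=
  [set x | exists l : 'I_3 -> R, [/\ forall i, 0 <= l i,
    \sum_(i < 3) l i = 1 & x = \sum_(i < 3) smul (l i) (K i)]].

Definition side_src (R : realType) (K : triangle R) (i : 'I_3) := K (ordS i).
Definition side_tgt (R : realType) (K : triangle R) (i : 'I_3) :=
  K (ord_pred i).

(* Side i is opposite to the vertex K i; ordS and ord_pred are cyclic. *)
Definition side (R : realType) (K : triangle R) (i : 'I_3) : set (plane R) :=
  segment (side_src K i) (side_tgt K i).

Definition barycenter (R : realType) (K : triangle R) : plane R :=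
  smul 3^-1 (\sum_(i < 3) K i).

Definition area (R : realType) (K : triangle R) : R := fine (leb2 R (tri K)).

Definition hK (R : realType) (K : triangle R) : R := ediam (tri K).

Definition indiam (R : realType) (K : triangle R) : R :=
  sup [set d | exists (c : plane R) (r : R), [/\ 0 <= r, d = 2 * r &
    forall x, enorm (x - c) <= r -> tri K x]].

Definition conforming_mesh (R : realType) (D : set (plane R))
    (Th : seq (triangle R)) : Prop :=
  [/\ uniq Th,
      forall K, K \in Th -> nondegenerate K,
      closure D = \bigcup_(K in [set` Th]) tri K &
      forall K K', K \in Th -> K' \in Th -> K != K' ->
        [\/ tri K `&` tri K' = set0,
            exists i j, K i = K' j /\ tri K `&` tri K' = [set K i] |
            exists i j, side K i = side K' j /\
                        tri K `&` tri K' = side K i]].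

Definition refines (R : realType) (Th Th0 : seq (triangle R)) : Prop :=
  forall K, K \in Th -> exists2 K0, K0 \in Th0 & tri K `<=` tri K0.

(* Refinements [mesh k] (k >= 1) of the initial mesh [mesh 0]; the mesh of
   index h = 1/k is [mesh k]. *)
Definition mesh_family (R : realType) (D : set (plane R))
    (mesh : nat -> seq (triangle R)) : Prop :=
  [/\ forall k, conforming_mesh D (mesh k),
      forall k, refines (mesh k) (mesh 0%N) &
      exists sigma : R, forall k K, K \in mesh k -> hK K <= sigma * indiam K].

Definition admissible (R : realType) (hs : R) (k : nat) : Prop :=
  (0 < k)%N /\ (k%:R : R)^-1 <= hs.

Definition P0_on (R : realType) (K : triangle R) (q : plane R -> R) (c : R) :
    Prop :=
  {ae leb2 R, forall x, tri K x -> q x = c}.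

Definition Vh (R : realType) (D : set (plane R)) (Th : seq (triangle R))
    (S : plane R -> R) : Prop :=
  [/\ {within closure D, continuous S},
      forall K, K \in Th -> exists (a : plane R) (b : R),
        forall x, tri K x -> S x = dot a x + b &
      forall x, bdry D x -> S x = 0].

Definition Xh (R : realType) (D : set (plane R)) (Th : seq (triangle R))
    (v : plane R -> plane R) : Prop :=
  Hdiv0 D v /\
  forall K, K \in Th -> exists (a : R) (b : plane R),
    {ae leb2 R, forall x, tri K x -> v x = smul a x + b}.

Definition Qh (R : realType) (D : set (plane R)) (Th : seq (triangle R))
    (q : plane R -> R) : Prop :=
  L20 D q /\ forall K, K \in Th -> exists c, P0_on K q c.

(* X, Q and V are the spaces of test functions. *)
Definition coupled_eqs (R : realType) (D : set (plane R)) (nu : R -> R)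
    (kappa : R) (f : plane R -> plane R) (z : plane R)
    (X : set (plane R -> plane R)) (Q V : set (plane R -> R))
    (u : plane R -> plane R) (p T : plane R -> R) : Prop :=
  [/\ forall v, X v ->
        \int[leb2 R]_(x in D)
          (nu (T x) * dot (u x) (v x) - p x * wdiv D v x) =
        \int[leb2 R]_(x in D) dot (f x) (v x),
      forall q, Q q -> \int[leb2 R]_(x in D) (q x * wdiv D u x) = 0 &
      forall S, V S ->
        \int[leb2 R]_(x in D) (kappa * dot (wgrad D T x) (wgrad D S x)
                               - T x * dot (u x) (wgrad D S x)) =
        delta D z S].

Definition continuous_solution (R : realType) (D : set (plane R))
    (r r' : R) (nu : R -> R) (kappa : R) (f : plane R -> plane R)
    (z : plane R) (u : plane R -> plane R) (p T : plane R -> R) : Prop :=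
  [/\ Hdiv0 D u, L20 D p, W1p0 D r T &
      coupled_eqs D nu kappa f z (Hdiv0 D) (L20 D) (W1p0 D r') u p T].

Definition discrete_solution (R : realType) (D : set (plane R))
    (Th : seq (triangle R)) (nu : R -> R) (kappa : R)
    (f : plane R -> plane R) (z : plane R)
    (u : plane R -> plane R) (p T : plane R -> R) : Prop :=
  [/\ Xh D Th u, Qh D Th p, Vh D Th T &
      coupled_eqs D nu kappa f z (Xh D Th) (Qh D Th) (Vh D Th) u p T].

Definition sobolev_exp (R : realType) (p : R) : R := 2 * p / (2 - p).

Definition embedding_constant (R : realType) (D : set (plane R)) (p C : R) :
    Prop :=
  forall S, W1p0 D p S ->
    (nLp D (sobolev_exp p) S <= C%:E * nLpv D p (wgrad D S))%E.

Definition best_embedding_constant (R : realType) (D : set (plane R))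
    (p C : R) : Prop :=
  embedding_constant D p C /\ forall C', embedding_constant D p C' -> C <= C'.

Definition infsup_constant (R : realType) (D : set (plane R)) (p p' kappa : R)
    (Y' Y : set (plane R -> R)) (C : R) : Prop :=
  0 < C /\
  forall S, Y' S ->
    (nLpv D p (wgrad D S) <=
     C%:E * dual_sup D p' Y (fun S' =>
       (\int[leb2 R]_(x in D) (kappa * dot (wgrad D S x) (wgrad D S' x)))%R))%E.

Definition internal (R : realType) (Th : seq (triangle R)) (K : triangle R)
    (i : 'I_3) : bool :=
  `[< exists K' j, [/\ K' \in Th, K' != K & side K' j = side K i] >].

(* K' = K is included explicitly; this only matters when K has no internal
   side, i.e. when the mesh consists of one triangle. *)
Definition neighbour (R : realType) (Th : seq (triangle R))
    (K K' : triangle R) : bool :=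
  (K' == K) ||
  `[< exists i j, [/\ internal Th K i, internal Th K' j &
                      side K i = side K' j] >].

Definition patch_set (R : realType) (Th : seq (triangle R)) (K : triangle R) :
    set (plane R) :=
  \bigcup_(K' in [set K' | K' \in Th /\ neighbour Th K K']) tri K'.

(* This normal points into K, as the n^+ and n^- of the jump do. *)
Definition side_normal (R : realType) (K : triangle R) (i : 'I_3) : plane R :=
  xget 0 [set n | [/\ enorm n = 1, dot n (side_tgt K i - side_src K i) = 0 &
                      0 < dot n (K i - side_src K i)]].

(* the constant value of q|_K, for q|_K \in P_0(K) *)
Definition P0_value (R : realType) (K : triangle R) (q : plane R -> R) : R :=
  xget 0 [set c | P0_on K q c].

(* The jump of q n across a side: the sum has one term q|_{K'} n_{K'} for each
   triangle K' having this side. *)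
Definition jump (R : realType) (Th : seq (triangle R)) (q : plane R -> R)
    (gamma : set (plane R)) : plane R :=
  \sum_(K' <- Th) \sum_(j < 3 | `[< side K' j = gamma >])
     smul (P0_value K' q) (side_normal K' j).

Definition side_integral (R : realType) (K : triangle R) (i : 'I_3)
    (g : plane R -> R) : R :=
  enorm (side_tgt K i - side_src K i) *
  \int[@lebesgue_measure R]_(t in `[0, 1]) g (lerp (side_src K i) (side_tgt K i) t).

(* squared L^2 norm of the jumps over the part of the boundary of K inside D *)
Definition jump_sqnorm (R : realType) (Th : seq (triangle R))
    (q : plane R -> R) (K : triangle R) : R :=
  \sum_(i < 3 | internal Th K i)
     side_integral K i (fun=> enorm (jump Th q (side K i)) ^+ 2).

Definition residual (R : realType) (nu : R -> R) (f u : plane R -> plane R)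
    (p T : plane R -> R) (K : triangle R) (x : plane R) : plane R :=
  f x - smul (nu (T x)) (u x) - wgrad (interior (tri K)) p x.

Definition indicator (R : realType) (Th : seq (triangle R)) (nu : R -> R)
    (f u : plane R -> plane R) (p T : plane R -> R) (K : triangle R) : \bar R :=
  (((hK K ^+ 2)%:E * nLpv (tri K) 2 (residual nu f u p T K) ^+ 2
    + (hK K * jump_sqnorm Th p K)%:E) `^ 2^-1)%E.

Definition nuh (R : realType) (nu : R -> R) (S : plane R -> R)
    (K : triangle R) (x : plane R) : R :=
  let G := wgrad (interior (tri K)) (nu \o S) in
  (area K)^-1 * (\int[leb2 R]_(y in tri K) nu (S y)) +
  dot (smul (area K)^-1 (\int[leb2 R]_(y in tri K) (G y).1,
                         \int[leb2 R]_(y in tri K) (G y).2))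
      (x - barycenter K).

(* the (constant) value of the L^2(K)-orthogonal projection of f onto
   [P_0(K)]^2 *)
Definition proj0 (R : realType) (K : triangle R) (f : plane R -> plane R) :
    plane R :=
  xget 0 [set c | forall d : plane R,
    \int[leb2 R]_(x in tri K) dot (f x - c) d = 0].

(* Main.v *)
(* The momentum equation is tested with smooth fields [psi e], [e] a constant
   vector, supported in small squares.

   Residual.  A triangle K contains a square of side comparable to h_K.  The
   functions [psi] that are dual on this square to the monomials of degree at
   most 2 in each variable control the coefficients of the polynomial
   P = c - A u_h, where c is constant and A affine (A = nu_h(T)), through
     f - nu(T_h) u_h - P =
       (f - c) + (A - nu(T)) u + (nu(T) - nu(T_h)) u - (A - nu(T_h)) e_u
   and Hoelder's inequality with 1/r + 1/p' = 1/2, r = 2p/(2-p).  No bound on A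
   is available, but when its coefficients are large A is far from the bounded
   function nu(T), and 0 can replace A.  The norm of u in L^p' is bounded by the
   smallness assumption because the norm of delta_z is positive; if C_L <= 0
   then nu is constant and the terms with u disappear.

   Jumps.  A field supported near the midpoint of an internal side transports
   mass from one triangle to the other; as p_h is constant on both, its pairing
   with the divergence of this field is a multiple of the jump of p_h. *)

From HB Require Import structures.
Require Import Defs.
From mathcomp Require Import all_boot all_order all_algebra.
From mathcomp Require Import all_classical all_reals all_analysis.
From mathcomp Require Import measurable_realfun.
From mathcomp Require Import ring lra.
Set Implicit Arguments. Unset Strict Implicit. Unset Printing Implicit Defensive.
Import Order.TTheory GRing.Theory Num.Theory.
Import numFieldNormedType.Exports.
Local Open Scope classical_set_scope.
Local Open Scope ring_scope.

(** * Planar Lebesgue measure *)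

(** A field [psi e] with [psi] smooth and compactly supported in the domain belongs to H_0(div) by
    the very definition of the weak gradient, so no trace theory enters. Taking [psi] a product of
    two functions of one variable reduces every integral to Fubini and the fundamental theorem of
    calculus. The squares have half side s = h_K / (32 sigma^2), where sigma >= 1 is a
    shape-regularity constant. On such a square [psi] is O(1), its derivatives are O(1/s) and
    Cauchy-Schwarz contributes 2s. Divided by s, the pairings leave the pressure error with weight
    1/s and the flux error with weight 1; multiplication by h_K gives the weights 1 and h_K. Since
    p' > 2 and the domain is bounded, h_K is at most a constant times h_K^(2/p'). Two geometric
    facts support this. The triangles cover only the closure of the domain, and squares crossing a
    side must lie in the domain itself: here the Lipschitz boundary is used. And two triangles with
    a common side lie on opposite sides of it, which has to be extracted from conformity. *)

Definition boxc (R : realType) (c : plane R) (s : R) : set (plane R) :=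
  `[c.1 - s, c.1 + s] `*` `[c.2 - s, c.2 + s].

Definition boxo (R : realType) (c : plane R) (s : R) : set (plane R) :=
  `]c.1 - s, c.1 + s[ `*` `]c.2 - s, c.2 + s[.

Section PlanarMeasure.
Variable R : realType.
Implicit Types (c x : plane R) (s e : R) (U A : set (plane R)).

Lemma boxcP c s x : boxc c s x <-> `|x.1 - c.1| <= s /\ `|x.2 - c.2| <= s.
Proof. by rewrite /boxc /= !in_itv /= !ler_distl. Qed.

Lemma boxoP c s x : boxo c s x <-> `|x.1 - c.1| < s /\ `|x.2 - c.2| < s.
Proof. by rewrite /boxo /= !in_itv /= !ltr_distl. Qed.

Lemma boxo_boxc c s : boxo c s `<=` boxc c s.
Proof. by move=> x /boxoP[h1 h2]; apply/boxcP; split; exact: ltW. Qed.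

Lemma measurable_rect (I J : interval R) :
  measurable ([set` I] `*` [set` J] : set (mplane R)).
Proof. by apply: measurableX; exact: measurable_itv. Qed.

Lemma measurable_boxc c s : measurable (boxc c s : set (mplane R)).
Proof. exact: measurable_rect. Qed.

Lemma measurable_boxo c s : measurable (boxo c s : set (mplane R)).
Proof. exact: measurable_rect. Qed.

Lemma leb2_boxc c s : 0 <= s -> leb2 R (boxc c s) = (4 * s ^+ 2)%:E.
Proof.
move=> s0.
have aux (a : R) : lebesgue_measure (`[a - s, a + s]%classic : set R) = (2 * s)%:E.
  rewrite lebesgue_measure_itv /= lte_fin.
  case: ifPn => [_|]; first by rewrite -EFinB; congr (_%:E); ring.
  by rewrite -leNgt => h; congr (_%:E); lra.
pose I (a : R) : set R := `[a - s, a + s]%classic.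
transitivity (lebesgue_measure (I c.1) * lebesgue_measure (I c.2))%E.
  by apply: product_measure1E; exact: measurable_itv.
by rewrite !aux -EFinM; congr (_%:E); ring.
Qed.

Lemma ball_planeP x e (y : plane R) :
  ball x e y <-> `|x.1 - y.1| < e /\ `|x.2 - y.2| < e.
Proof. by []. Qed.

Lemma open_boxcP U x : open U -> U x -> exists2 e, 0 < e & boxc x e `<=` U.
Proof.
move=> oU Ux; have /nbhs_ballP[e /= e0 eU] := open_nbhs_nbhs (conj oU Ux).
exists (e / 2); first by rewrite divr_gt0.
move=> y /boxcP[h1 h2]; apply: eU; apply/ball_planeP.
by rewrite distrC (distrC x.2); split; lra.
Qed.

(** Boxes with rational centre and radius, indexed by [nat] to make unions countable. A number that
    codes nothing gives radius 0, whose open box is empty. *)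
Definition qbox (n : nat) : plane R * R :=
  if unpickle n is Some (a, b, r) then ((ratr a, ratr b), ratr r) else (0, 0).

(** The closed boxes lie in [U] while the open ones cover it; this suits [du_bois_reymond], where
    integrability is known on compact sets only. *)
Lemma open_qbox U : open U -> U =
  \bigcup_(n in [set n | boxc (qbox n).1 (qbox n).2 `<=` U]) boxo (qbox n).1 (qbox n).2.
Proof.
move=> oU; apply/seteqP; split => [x Ux|x [n /= nU nx]]; last exact/nU/boxo_boxc.
have [e e0 eU] := open_boxcP oU Ux.
(* A centre within e/3 of [x] and a radius between e/3 and e/2: the box contains [x] and stays
   within distance e of it. *)
have hq (a : R) : exists q : rat, `|a - ratr q| < e / 3.
  have [|q] := @rat_in_itvoo R (a - e / 3) (a + e / 3); first by lra.
  by rewrite in_itv /= => /andP[h1 h2]; exists q; rewrite ltr_distl; lra.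
have [a ha] := hq x.1; have [b hb] := hq x.2.
have [|r] := @rat_in_itvoo R (e / 3) (e / 2); first by lra.
rewrite in_itv /= => /andP[r1 r2].
have q : qbox (pickle (a, b, r)) = ((ratr a, ratr b), ratr r).
  by rewrite /qbox pickleK.
exists (pickle (a, b, r)); rewrite ?/mkset q; last by apply/boxoP => /=; split; lra.
move=> y /boxcP /= [h1 h2]; apply: eU; apply/boxcP; split.
  by have := ler_normD (y.1 - ratr a) (ratr a - x.1); rewrite addrA subrK (distrC (ratr a)); lra.
by have := ler_normD (y.2 - ratr b) (ratr b - x.2); rewrite addrA subrK (distrC (ratr b)); lra.
Qed.

(** The product sigma-algebra is generated by rectangles, so an open set has to be written as a
    countable union of them. *)
Lemma open_measurable2 U : open U -> measurable (U : set (mplane R)).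
Proof.
move=> oU; rewrite (open_qbox oU); apply: bigcup_measurable => n _.
exact: measurable_boxo.
Qed.

Lemma closed_measurable2 A : closed A -> measurable (A : set (mplane R)).
Proof.
by move=> cA; rewrite -(setCK A); apply: measurableC; apply: open_measurable2;
  rewrite openC.
Qed.

Lemma continuous_borel (f : plane R -> R) : continuous f -> borel_fun f.
Proof.
move=> /continuousP cf; apply: (measurability _ (RGenOpens.measurableE R)).
move=> _ [_ [a [b ->] <-]]; rewrite setTI; apply: open_measurable2.
exact/cf/interval_open.
Qed.

End PlanarMeasure.

(** * Smooth cut-off functions *)

Section Smooth1D.
Variable R : realType.
Implicit Types (f g : R -> R) (n : nat) (x t : R).

Fixpoint Cn n f : Prop :=
  match n with
  | 0%N => continuous f
  | n'.+1 => (forall x, derivable f x 1) /\ Cn n' (derive1 f)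
  end.

Definition smooth1 f := forall n, Cn n f.

Lemma derivable_continuous f : (forall x, derivable f x 1) -> continuous f.
Proof. by move=> df x; apply: differentiable_continuous; apply/derivable1_diffP. Qed.

Lemma CnS_is_derive n f f' :
  (forall x, is_derive x 1 f (f' x)) -> Cn n f' -> Cn n.+1 f.
Proof.
move=> df cf; split=> [x|]; first by have := df x => ?; exact: ex_derive.
suff -> : derive1 f = f' by [].
by apply/funext => x; rewrite derive1E; have := df x => ?; exact: derive_val.
Qed.

Lemma CnW n f : Cn n.+1 f -> Cn n f.
Proof.
elim: n f => [|n IH] f [df cf]; first exact: derivable_continuous.
by split=> //; exact: IH.
Qed.

Lemma CnS_derive n f : Cn n.+1 f -> forall x, is_derive x 1 f (derive1 f x).
Proof. by move=> [df _] x; rewrite derive1E; exact: derivableP. Qed.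

Lemma Cn_cst n a : Cn n (cst a).
Proof.
elim: n a => [|n IH] a; first exact: cst_continuous.
by apply: (@CnS_is_derive _ _ (cst 0)) => // x; exact: is_derive_cst.
Qed.

Lemma CnD n f g : Cn n f -> Cn n g -> Cn n (fun x => f x + g x).
Proof.
elim: n f g => [|n IH] f g cf cg; first by move=> x; apply: continuousD; [exact: cf|exact: cg].
apply: (@CnS_is_derive _ _ (fun x => derive1 f x + derive1 g x)).
  move=> x; have := CnS_derive cf x; have := CnS_derive cg x => ? ?.
  exact: is_deriveD.
by apply: IH; [case: cf|case: cg].
Qed.

Lemma CnM n f g : Cn n f -> Cn n g -> Cn n (fun x => f x * g x).
Proof.
elim: n f g => [|n IH] f g cf cg; first by move=> x; apply: continuousM; [exact: cf|exact: cg].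
apply: (@CnS_is_derive _ _ (fun x => f x * derive1 g x + g x * derive1 f x)).
  move=> x; have := CnS_derive cf x; have := CnS_derive cg x => ? ?.
  exact: is_deriveM.
by apply: CnD; apply: IH; [exact: CnW|case: cg|exact: CnW|case: cf].
Qed.

Lemma Cn_affine n f a b : Cn n f -> Cn n (fun x => f (a * x + b)).
Proof.
have d x : is_derive x 1 (fun x => a * x + b : R) a.
  have h := is_deriveD (is_deriveM (is_derive_cst a x 1)
    (is_derive_id x 1)) (is_derive_cst b x 1).
  apply: (is_derive_eq h).
  by rewrite /GRing.scale /=; ring.
elim: n f => [|n IH] f cf.
  move=> x; apply: continuous_comp; last exact: cf.
  by apply: differentiable_continuous; apply/derivable1_diffP; have := d x => ?; exact: ex_derive.
apply: (@CnS_is_derive _ _ (fun x => a * derive1 f (a * x + b))).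
  move=> x; have h := @is_derive1_comp R f (fun x => a * x + b) x _ _
    (CnS_derive cf (a * x + b)) (d x).
  by apply: (is_derive_eq h); rewrite mulrC.
by apply: CnM; [exact: Cn_cst|apply: IH; case: cf].
Qed.

Lemma Cn_inv n f : (forall x, f x != 0) -> Cn n f -> Cn n (fun x => (f x)^-1).
Proof.
move=> f0; elim: n => [|n IH] cf.
  by move=> x; apply: cvgV => //; exact: cf.
apply: (@CnS_is_derive n (fun x => (f x)^-1)
  (fun x => - (derive1 f x) * ((f x)^-1 * (f x)^-1))).
  move=> x; have := CnS_derive cf x => h.
  apply: (is_derive_eq (is_deriveV (f0 x) h)).
  by rewrite /GRing.scale /= expr2 invfM; ring.
apply: CnM.
  have -> : (fun x => - derive1 f x) = (fun x => -1 * derive1 f x).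
    by apply/funext => x; rewrite mulN1r.
  by apply: CnM; [exact: Cn_cst|case: cf].
by have h := IH (CnW cf); exact: CnM.
Qed.

(* [flat P t] is [P(1/t) exp(-1/t)] for [t > 0]; the class of these functions
   is stable under differentiation. *)
Definition flat (P : {poly R}) t : R :=
  if 0 < t then P.[t^-1] * expR (- t^-1) else 0.

Lemma expX_bound n x : 0 <= x -> x ^+ n * expR (- x) <= n`!%:R.
Proof.
move=> x0; rewrite expRN ler_pdivrMr ?expR_gt0//.
case: n => [|n]; first by rewrite expr0 mul1r -[leLHS]addr0 (le_trans _ (expR_ge1Dx x))// lerD2l.
have h := expR_ge1Dxn n x0.
have f0 : 0 < n.+1`!%:R :> R by rewrite ltr0n fact_gt0.
rewrite mulrC -ler_pdivrMr//; apply: le_trans h.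
by rewrite lerDr.
Qed.

Lemma poly_exp_bound (P : {poly R}) :
  exists C, forall x, 0 <= x -> `|P.[x]| * expR (- x) <= C.
Proof.
exists (\sum_(i < size P) `|P`_i| * i`!%:R) => x x0.
rewrite horner_coef.
apply: (@le_trans _ _ ((\sum_(i < size P) `|P`_i * x ^+ i|) * expR (- x))).
  by rewrite ler_wpM2r ?expR_ge0// ler_norm_sum.
rewrite mulr_suml; apply: ler_sum => i _.
rewrite normrM (ger0_norm (exprn_ge0 _ x0)) -mulrA.
by rewrite ler_wpM2l// expX_bound.
Qed.

(** For t > 0 the chain rule on P(1/t) exp(-1/t) produces the factor t^-2 and the polynomial P - P'.
    At 0 the difference quotient is O(h), because exp(-x) dominates every polynomial. *)
Lemma is_derive_flat (P : {poly R}) t :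
  is_derive t 1 (flat P) (flat ('X^2 * (P - P^`())) t).
Proof.
have [t0|t0|<-] := ltgtP 0 t.
- have near_t : {near t, (fun x => P.[x^-1] * expR (- x^-1)) =1 flat P}.
    near=> y; rewrite /flat ifT//.
    near: y; exact: lt_nbhsr.
  have hV : is_derive t 1 (fun x : R => x^-1) (- t ^- 2).
    have tn0 : id t != 0 by rewrite gt_eqF.
    apply: (is_derive_eq (is_deriveV tn0 (is_derive_id t 1))).
    by rewrite /GRing.scale /= mulr1.
  apply: (near_eq_is_derive near_t).
  rewrite /flat t0.
  have hN : is_derive t 1 (fun x : R => - x^-1) (t ^- 2).
    by apply: (is_derive_eq (is_deriveN hV)); rewrite opprK.
  have hE := @is_derive1_comp R expR (fun x => - x^-1) t _ _ (is_derive_expR (- t^-1)) hN.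
  have hP := is_derive1_comp (is_derive_poly P t^-1) hV.
  apply: (is_derive_eq (is_deriveM hP hE)).
  by rewrite /GRing.scale /= hornerM hornerXn hornerD hornerN -!exprVn; ring.
- have near_t : {near t, cst 0 =1 flat P}.
    near=> y; rewrite /flat ifF//; apply/negbTE; rewrite -leNgt ltW//.
    near: y; exact: lt_nbhsl.
  apply: (near_eq_is_derive near_t).
  rewrite /flat ltNge (ltW t0) /=; exact: is_derive_cst.
- have -> : flat ('X^2 * (P - P^`())) 0 = 0 by rewrite /flat ltxx.
  (* One power of X pays for the division by h, the other leaves a factor h that tends to 0. *)
  have [C hC] := poly_exp_bound (P * 'X^2).
  have C0 : 0 <= C.
    by apply: le_trans (hC 0 (lexx _)); rewrite mulr_ge0// expR_ge0.
  have bd (h : R) : h != 0 -> `|h^-1 * flat P h| <= C * `|h|.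
    move=> h0; rewrite /flat; case: ifPn => [hp|_]; last first.
      by rewrite mulr0 normr0 mulr_ge0.
    have := hC h^-1; rewrite invr_ge0 (ltW hp) => /(_ isT).
    rewrite hornerM hornerXn expr2 !normrM (ger0_norm (expR_ge0 _)).
    rewrite normfV (gtr0_norm hp) => hh.
    rewrite -ler_pdivrMr//; apply: le_trans hh.
    by rewrite le_eqVlt; apply/orP; left; apply/eqP; field.
  have cv : (fun h => h^-1 *: (flat P (h *: (1 : R) + 0) - flat P 0)) @ 0^' --> (0 : R).
    apply/cvgr0Pnorm_lt => e e0; near=> h.
    have hn0 : h != 0 by near: h; exact: nbhs_dnbhs_neq.
    rewrite {2}/flat ltxx subr0 addr0 /GRing.scale /= mulr1.
    apply: (le_lt_trans (bd _ hn0)).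
    apply: (@le_lt_trans _ _ ((C + 1) * `|h|)); first by rewrite ler_wpM2r// lerDl.
    rewrite mulrC -ltr_pdivlMr; last by rewrite ltr_wpDl.
    near: h; apply: dnbhs0_lt; rewrite divr_gt0// ltr_wpDl//.
  by apply: DeriveDef; [exact: (cvgP _ cv)|exact: (cvg_lim _ cv)].
Unshelve. all: by end_near. Qed.

Lemma Cn_flat n (P : {poly R}) : Cn n (flat P).
Proof.
elim: n P => [|n IH] P; last exact: (CnS_is_derive (is_derive_flat P)).
by apply: derivable_continuous => x; have := is_derive_flat P x => ?; exact: ex_derive.
Qed.

(** The classical smooth transition from 0 to 1 on [0, 1]; the denominator is positive since t or 1
    - t is. *)
Definition smoothstep t : R := flat 1 t / (flat 1 t + flat 1 (1 - t)).

Lemma flat1_ge0 t : 0 <= flat 1 t.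
Proof. by rewrite /flat; case: ifP => // _; rewrite hornerE mul1r expR_ge0. Qed.

Lemma flat1_gt0 t : 0 < t -> 0 < flat 1 t.
Proof. by rewrite /flat => ->; rewrite hornerE mul1r expR_gt0. Qed.

Lemma flat1_eq0 t : t <= 0 -> flat 1 t = 0.
Proof. by rewrite /flat leNgt => /negbTE ->. Qed.

Lemma smoothstep_den t : 0 < flat 1 t + flat 1 (1 - t).
Proof.
have [t0|t0] := ltP 0 t; first by rewrite ltr_pwDl ?flat1_gt0 ?flat1_ge0.
by rewrite ltr_wpDl ?flat1_ge0// flat1_gt0//; lra.
Qed.

Lemma smooth_smoothstep : smooth1 smoothstep.
Proof.
move=> n; have h : Cn n (fun t => flat 1 (1 - t)).
  have -> : (fun t => flat 1 (1 - t)) = (fun t => flat 1 ((-1) * t + 1)).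
    by apply/funext => t; congr flat; ring.
  exact/Cn_affine/Cn_flat.
apply: CnM; first exact: Cn_flat.
apply: Cn_inv => [t|]; first by rewrite gt_eqF// smoothstep_den.
by apply: CnD => //; exact: Cn_flat.
Qed.

Lemma smoothstep0 t : t <= 0 -> smoothstep t = 0.
Proof. by move=> t0; rewrite /smoothstep flat1_eq0// mul0r. Qed.

Lemma smoothstep1 t : 1 <= t -> smoothstep t = 1.
Proof.
move=> t1; rewrite /smoothstep (@flat1_eq0 (1 - t)); last by lra.
by rewrite addr0 divff// gt_eqF// flat1_gt0; lra.
Qed.

Lemma smoothstep_ge0 t : 0 <= smoothstep t.
Proof. by rewrite divr_ge0 ?flat1_ge0// ltW// smoothstep_den. Qed.

Lemma smoothstep_le1 t : smoothstep t <= 1.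
Proof. by rewrite ler_pdivrMr ?smoothstep_den// mul1r lerDl flat1_ge0. Qed.

End Smooth1D.

(** * Tensor products and cut-offs *)

Section Tensors.
Variable R : realType.
Implicit Types (F G : R -> R) (x : plane R) (D A : set (plane R)).

Lemma smooth1M F G : smooth1 F -> smooth1 G -> smooth1 (fun t => F t * G t).
Proof. by move=> sF sG n; exact: CnM. Qed.

Lemma smooth1D F G : smooth1 F -> smooth1 G -> smooth1 (fun t => F t + G t).
Proof. by move=> sF sG n; exact: CnD. Qed.

Lemma smooth1Z a F : smooth1 F -> smooth1 (fun t => a * F t).
Proof. by move=> sF n; apply: CnM; [exact: Cn_cst|exact: sF]. Qed.

Lemma smooth1_affine F a b : smooth1 F -> smooth1 (fun t => F (a * t + b)).
Proof. by move=> sF n; exact: Cn_affine. Qed.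

Lemma smooth1_derive F : smooth1 F -> smooth1 (derive1 F).
Proof. by move=> sF n; case: (sF n.+1). Qed.

Lemma smooth1_is_derive F : smooth1 F -> forall t : R, is_derive t 1 F (derive1 F t).
Proof. by move=> sF; exact: CnS_derive (sF 1%N). Qed.

Lemma smooth1_continuous F : smooth1 F -> continuous F.
Proof. by move=> sF; exact: (sF 0%N). Qed.

Lemma derive1_eq0_off F a b : (forall t, ~~ (a <= t <= b) -> F t = 0) ->
  forall t, ~~ (a <= t <= b) -> derive1 F t = 0.
Proof.
move=> F0 t; rewrite negb_and -!ltNge => tab.
have n0 : {near t, cst 0 =1 F}.
  case/orP: tab => tab.
    near=> s; rewrite F0// negb_and -!ltNge; apply/orP; left.
    by near: s; exact: lt_nbhsl.
  near=> s; rewrite F0// negb_and -!ltNge; apply/orP; right.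
  by near: s; exact: lt_nbhsr.
have := near_eq_is_derive n0 (is_derive_cst (0 : R) t 1).
by rewrite derive1E => ?; exact: derive_val.
Unshelve. all: by end_near. Qed.

Lemma compact_norm_bound (T : topologicalType) (f : T -> R) (A : set T) :
  compact A -> continuous f -> exists M : R, forall y, A y -> `|f y| <= M.
Proof.
move=> cA cf; have : compact (f @` A).
  by apply: continuous_compact => //; exact: continuous_subspaceT.
move=> /compact_bounded [M [_ hM]]; exists (M + 1) => x Ax.
by apply: (hM (M + 1)); [rewrite ltrDl|exists x].
Qed.

Definition tens F G : plane R -> R := fun x => F x.1 * G x.2.

Lemma continuous_tens F G : continuous F -> continuous G -> continuous (tens F G).
Proof.
move=> cF cG x; apply: continuousM.
  by apply: continuous_comp; [exact: cvg_fst|exact: cF].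
by apply: continuous_comp; [exact: cvg_snd|exact: cG].
Qed.

Lemma is_derive_mulr F (f' a t : R) : is_derive t 1 F f' ->
  is_derive t 1 (fun s => F s * a) (f' * a).
Proof.
move=> h; apply: (is_derive_eq (is_deriveM h (is_derive_cst a t 1))).
by rewrite /GRing.scale /=; ring.
Qed.

Lemma is_derive_mull F (f' a t : R) : is_derive t 1 F f' ->
  is_derive t 1 (fun s => a * F s) (a * f').
Proof.
move=> h; apply: (is_derive_eq (is_deriveM (is_derive_cst a t 1) h)).
by rewrite /GRing.scale /=; ring.
Qed.

Lemma pd1_tens F G : (forall t, derivable F t 1) -> pd1 (tens F G) = tens (derive1 F) G.
Proof.
move=> dF; apply/funext => x; rewrite /pd1 /tens /= derive1E.
have h : is_derive x.1 1 F (derive1 F x.1) by rewrite derive1E; exact: derivableP.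
by have := is_derive_mulr (G x.2) h => ?; exact: derive_val.
Qed.

Lemma pd2_tens F G : (forall t, derivable G t 1) -> pd2 (tens F G) = tens F (derive1 G).
Proof.
move=> dG; apply/funext => x; rewrite /pd2 /tens /= derive1E.
have h : is_derive x.2 1 G (derive1 G x.2) by rewrite derive1E; exact: derivableP.
by have := is_derive_mull (F x.1) h => ?; exact: derive_val.
Qed.

Lemma Ck_tens n F G : smooth1 F -> smooth1 G -> Ck n (tens F G).
Proof.
elim: n F G => [|n IH] F G sF sG; first exact: continuous_tens (sF 0%N) (sG 0%N).
have dF := (sF 1%N).1; have dG := (sG 1%N).1.
split; first exact: continuous_tens (sF 0%N) (sG 0%N).
- move=> x; split; rewrite /tens /=.
    have h := smooth1_is_derive sF x.1.
    by have := is_derive_mulr (G x.2) h => ?; exact: ex_derive.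
  have h := smooth1_is_derive sG x.2.
  by have := is_derive_mull (F x.1) h => ?; exact: ex_derive.
- by rewrite (pd1_tens _ dF); apply: IH => //; exact: smooth1_derive.
- by rewrite (pd2_tens _ dG); apply: IH => //; exact: smooth1_derive.
Qed.

Lemma test_fun_tens D F G a b c d : smooth1 F -> smooth1 G ->
  (forall t, ~~ (a <= t <= b) -> F t = 0) ->
  (forall t, ~~ (c <= t <= d) -> G t = 0) ->
  `[a, b] `*` `[c, d] `<=` D -> test_fun D (tens F G).
Proof.
move=> sF sG F0 G0 sD; split; first by move=> n; exact: Ck_tens.
exists (`[a, b] `*` `[c, d]); split => //.
  by apply: compact_setX; exact: segment_compact.
move=> x /= /not_andP[h|h]; rewrite /tens.
  by rewrite F0 ?mul0r//; apply/negP => h'; apply: h; rewrite in_itv.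
by rewrite G0 ?mulr0//; apply/negP => h'; apply: h; rewrite in_itv.
Qed.

(** It equals 1 at distance at least 1/k from both end points. With k = n it tends to the indicator
    of ]a, b[; with k = 1/s it is 1 at the centre of an interval of half length s. *)
Definition cutoff (k a b t : R) := smoothstep (k * (t - a)) * smoothstep (k * (b - t)).

Lemma smooth_cutoff k a b : smooth1 (cutoff k a b).
Proof.
have -> : cutoff k a b = fun t => smoothstep (k * t + - (k * a)) * smoothstep ((- k) * t + k * b).
  by apply/funext => t; rewrite /cutoff; congr (smoothstep _ * smoothstep _); ring.
by apply: smooth1M; apply: smooth1_affine; exact: smooth_smoothstep.
Qed.

Lemma cutoff_off k a b t : 0 <= k -> ~~ (a < t < b) -> cutoff k a b t = 0.
Proof.
move=> k0; rewrite negb_and -!leNgt => /orP[h|h]; rewrite /cutoff.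
  by rewrite smoothstep0 ?mul0r// mulr_ge0_le0// subr_le0.
by rewrite (@smoothstep0 _ (k * (b - t))) ?mulr0// mulr_ge0_le0// subr_le0.
Qed.

Lemma cutoff_ge0 k a b t : 0 <= cutoff k a b t.
Proof. by rewrite mulr_ge0 ?smoothstep_ge0. Qed.

Lemma cutoff_le1 k a b t : cutoff k a b t <= 1.
Proof. by rewrite mulr_ile1 ?smoothstep_ge0 ?smoothstep_le1. Qed.

Lemma cutoff_eq1 k a b t : 1 <= k * (t - a) -> 1 <= k * (b - t) -> cutoff k a b t = 1.
Proof. by move=> h1 h2; rewrite /cutoff !smoothstep1// mulr1. Qed.

Lemma cutoff_center s t : 0 < s -> cutoff s^-1 (t - s) (t + s) t = 1.
Proof.
move=> s0; apply: cutoff_eq1.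
  by rewrite (_ : t - (t - s) = s) ?mulVf ?gt_eqF//; ring.
by rewrite (_ : t + s - t = s) ?mulVf ?gt_eqF//; ring.
Qed.

Lemma cutoff_cvg1 a b t : a < t < b -> (fun n => cutoff n%:R a b t) @ \oo --> (1 : R).
Proof.
move=> /andP[ha hb].
have h (e : R) : 0 < e -> \forall n \near \oo, 1 <= n%:R * e.
  move=> e0; near=> n; rewrite -ler_pdivrMr//.
  by near: n; exact: nbhs_infty_ger.
apply: cvg_near_cst; near=> n; apply: cutoff_eq1; near: n; apply: h; by rewrite subr_gt0.
Unshelve. all: by end_near. Qed.

End Tensors.

(** * Integration by parts in the plane *)

Section Integrals.
Variable R : realType.
Implicit Types (x : plane R) (D A : set (plane R)) (f g psi phi : plane R -> R).
Local Notation mu := (@lebesgue_measure R).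
Local Notation leb := (leb2 R).

Lemma FTC_is_derive (h h' : R -> R) (a b : R) : a < b ->
  (forall t : R, is_derive t 1 h (h' t)) -> continuous h' ->
  (\int[mu]_(t in `[a, b]) (h' t)%:E = (h b - h a)%:E)%E.
Proof.
move=> ab dh ch'.
have ddh t : derivable h t 1 by have := dh t => ?; exact: ex_derive.
have ch := derivable_continuous ddh.
rewrite (@continuous_FTC2 R h' h a b ab) ?EFinB//.
- exact: continuous_subspaceT.
- split; first by move=> t _; exact: ddh.
    by apply: cvg_at_right_filter; exact: ch.
  by apply: cvg_at_left_filter; exact: ch.
- by move=> t _; rewrite derive1E; have := dh t => ?; exact: derive_val.
Qed.

Lemma integral_derive_eq0 (h h' : R -> R) (M : R) :
  (forall t : R, is_derive t 1 h (h' t)) -> continuous h' ->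
  (forall t, ~~ (- M <= t <= M) -> h t = 0) ->
  (\int[mu]_t (h' t)%:E = 0)%E.
Proof.
move=> dh ch' h0.
have h'E : h' = derive1 h.
  by apply/funext => t; rewrite derive1E; have := dh t => ?; rewrite derive_val.
have h'0 t : ~~ (- M <= t <= M) -> h' t = 0.
  by rewrite h'E; exact: derive1_eq0_off.
(* The absolute value keeps the interval nondegenerate when [M] is negative, and the summand 1 puts
   both end points outside the support. *)
pose N := `|M| + 1.
have MN : M < N by rewrite /N ltr_pwDr// ler_norm.
have N0 : 0 < N by rewrite /N ltr_wpDl.
transitivity (\int[mu]_(t in `[(- N)%R, N]) (h' t)%:E)%E.
  rewrite [RHS]integral_mkcond; apply: eq_integral => t _.
  rewrite /patch; case: ifPn => // /negP tN; rewrite h'0//.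
  by apply/negP => /andP[t1 t2]; apply: tN; rewrite inE /= in_itv /=; lra.
rewrite (@FTC_is_derive h)//; last by lra.
by rewrite !h0 ?subrr//; apply/negP => /andP[]; lra.
Qed.

Lemma ae2W (P Q : plane R -> Prop) : (forall x, P x -> Q x) ->
  {ae leb, forall x, P x} -> {ae leb, forall x, Q x}.
Proof.
by move=> PQ [N [mN N0 hN]]; exists N; split => // x nQ; apply: hN => /PQ.
Qed.

Lemma ae2_and (P Q : plane R -> Prop) : {ae leb, forall x, P x} ->
  {ae leb, forall x, Q x} -> {ae leb, forall x, P x /\ Q x}.
Proof.
move=> h1 h2; apply: negligibleS (negligibleU h1 h2) => x /= /not_andP[h|h].
  by left.
by right.
Qed.

Lemma plane_hausdorff : hausdorff_space (R * R)%type.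
Proof. exact: norm_hausdorff. Qed.

Lemma compact_measurable2 A : compact A -> measurable (A : set (mplane R)).
Proof.
by move=> cA; apply: closed_measurable2; exact: compact_closed plane_hausdorff cA.
Qed.

Lemma compact_boxc A : compact A -> exists2 M, 0 < M & A `<=` boxc 0 M.
Proof.
move=> cA.
have [M1 h1] := compact_norm_bound cA (fun x : plane R => @cvg_fst _ _ _ _ _ : _).
have [M2 h2] := compact_norm_bound cA (fun x : plane R => @cvg_snd _ _ _ _ _ : _).
exists (`|M1| + `|M2| + 1) => [|x Ax]; first by rewrite ltr_wpDl// addr_ge0.
apply/boxcP; rewrite !subr0; split.
  by apply: (le_trans (h1 _ Ax)); have := ler_norm M1; have := normr_ge0 M2; lra.
by apply: (le_trans (h2 _ Ax)); have := ler_norm M2; have := normr_ge0 M1; lra.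
Qed.

Lemma leb2_sub_boxc_lty A c s : measurable (A : set (mplane R)) ->
  A `<=` boxc c s -> (leb A < +oo)%E.
Proof.
move=> mA As; have sub : A `<=` boxc c `|s|.
  by move=> x /As /boxcP[h1 h2]; apply/boxcP; have := ler_norm s; split; lra.
have h : (leb A <= leb (boxc c `|s|))%E.
  by apply: le_measure => //; rewrite inE //; exact: measurable_boxc.
by apply: (le_lt_trans h); rewrite leb2_boxc// ltry.
Qed.

Lemma compact_leb2_lty A : compact A -> (leb A < +oo)%E.
Proof.
move=> cA; have [M _ AM] := compact_boxc cA.
exact: leb2_sub_boxc_lty (compact_measurable2 cA) AM.
Qed.

Lemma bounded_withinP (T : Type) (f : T -> R) (A : set T) (M : R) :
  (forall y, A y -> `|f y| <= M) -> [bounded f y | y in A].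
Proof.
move=> fM; exists M; split; first exact: num_real.
by move=> N MN x Ax; exact: le_trans (fM _ Ax) (ltW MN).
Qed.

Lemma bounded_integrable2 f A (M : R) : measurable (A : set (mplane R)) ->
  (leb A < +oo)%E -> measurable_fun (A : set (mplane R)) f ->
  (forall x, A x -> `|f x| <= M) -> leb.-integrable A (EFin \o f).
Proof.
move=> mA Afin mf fM; apply: measurable_bounded_integrable => //.
exact: bounded_withinP fM.
Qed.

Lemma borel_funS (A : set (mplane R)) f : borel_fun f -> measurable_fun A f.
Proof. by move=> bf; exact: measurable_funTS. Qed.

Lemma patch_off (D A : set (plane R)) f : A `<=` D -> (forall x, ~ A x -> f x = 0) ->
  f \_ D = f \_ A.
Proof.
move=> AD f0; apply/funext => x; rewrite /patch.
case: ifPn => [|/negP] xD; case: ifPn => [|/negP] xA //.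
  by rewrite f0// => /mem_set.
by exfalso; apply: xD; rewrite inE; apply: AD; rewrite -inE.
Qed.

Lemma integrable_supp D A f : measurable (D : set (mplane R)) ->
  measurable (A : set (mplane R)) -> A `<=` D -> (forall x, ~ A x -> f x = 0) ->
  leb.-integrable A (EFin \o f) -> leb.-integrable D (EFin \o f).
Proof.
move=> mD mA AD f0 /(integrable_mkcond _ mA) iA; apply/(integrable_mkcond _ mD).
by move: iA; rewrite !restrict_EFin (patch_off AD f0).
Qed.

Lemma Rintegral_supp D A f : A `<=` D -> (forall x, ~ A x -> f x = 0) ->
  \int[leb]_(x in D) f x = \int[leb]_(x in A) f x.
Proof.
by move=> AD f0; rewrite Rintegral_mkcond [RHS]Rintegral_mkcond (patch_off AD f0).
Qed.

Lemma integrable_cont_supp D A f : measurable (D : set (mplane R)) ->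
  compact A -> A `<=` D -> continuous f -> (forall x, ~ A x -> f x = 0) ->
  leb.-integrable D (EFin \o f).
Proof.
move=> mD cA AD cf f0; have mA := compact_measurable2 cA.
apply: (integrable_supp mD mA AD f0).
have [M hM] := compact_norm_bound cA cf.
apply: (bounded_integrable2 mA (compact_leb2_lty cA) _ hM).
exact: borel_funS (continuous_borel cf).
Qed.

Lemma integrable_mul_supp D A g f : measurable (D : set (mplane R)) ->
  compact A -> A `<=` D -> continuous f -> (forall x, ~ A x -> f x = 0) ->
  leb.-integrable A (EFin \o g) ->
  leb.-integrable D (EFin \o (fun x => g x * f x)).
Proof.
move=> mD cA AD cf f0 ig; have mA := compact_measurable2 cA.
apply: (@integrable_supp D A) => //; first by move=> x Ax; rewrite f0// mulr0.
have [M hM] := compact_norm_bound cA cf.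
have h := integrableMl mA ig (borel_funS (continuous_borel cf)) (bounded_withinP hM).
exact: h.
Qed.

Lemma compact_box0 (M : R) : compact (boxc (0 : plane R) M).
Proof. by apply: compact_setX; exact: segment_compact. Qed.

Lemma box0P (M : R) x : boxc 0 M x <-> - M <= x.1 <= M /\ - M <= x.2 <= M.
Proof. by rewrite boxcP !subr0 !ler_norml. Qed.

Lemma pd1_eq0_off f (M : R) : (forall x, ~ boxc 0 M x -> f x = 0) ->
  forall x, ~ boxc 0 M x -> pd1 f x = 0.
Proof.
move=> f0 x; rewrite box0P => /not_andP[h|h].
  apply: (@derive1_eq0_off _ _ (- M) M); last exact/negP.
  by move=> t /negP ht; apply: f0; rewrite box0P => -[].
rewrite /pd1; have -> : (fun t => f (t, x.2)) = cst 0.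
  by apply/funext => t; apply: f0; rewrite box0P => -[].
by rewrite derive1_cst.
Qed.

Lemma pd2_eq0_off f (M : R) : (forall x, ~ boxc 0 M x -> f x = 0) ->
  forall x, ~ boxc 0 M x -> pd2 f x = 0.
Proof.
move=> f0 x; rewrite box0P => /not_andP[h|h]; last first.
  apply: (@derive1_eq0_off _ _ (- M) M); last exact/negP.
  by move=> t /negP ht; apply: f0; rewrite box0P => -[].
rewrite /pd2; have -> : (fun t => f (x.1, t)) = cst 0.
  by apply/funext => t; apply: f0; rewrite box0P => -[].
by rewrite derive1_cst.
Qed.

Lemma continuous_pairl (b : R) : continuous (fun t : R => (t, b) : plane R).
Proof. by move=> t; exact: (@cvg_pair R R R (nbhs t) (nbhs t) (nbhs b) _ _ _ id (cst b)
  (@cvg_id _ _) (cvg_cst b)). Qed.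

Lemma continuous_pairr (a : R) : continuous (fun t : R => (a, t) : plane R).
Proof. by move=> t; exact: (@cvg_pair R R R (nbhs t) (nbhs a) (nbhs t) _ _ _ (cst a) id
  (cvg_cst a) (@cvg_id _ _)). Qed.

(** Fubini, integrating first along the lines on which [pd1] is the derivative: each line integral
    vanishes because [f] has bounded support. *)
Lemma integral_pd1_eq0 f (M : R) : Ck 1 f -> (forall x, ~ boxc 0 M x -> f x = 0) ->
  leb.-integrable setT (EFin \o pd1 f) /\ \int[leb]_x pd1 f x = 0.
Proof.
move=> [cf df c1 _] f0.
have ipd : leb.-integrable setT (EFin \o pd1 f).
  apply: (integrable_cont_supp measurableT (@compact_box0 M)) => //.
  exact: pd1_eq0_off.
split => //; rewrite /Rintegral.
have inner (y : R) : (\int[mu]_t (pd1 f (t, y))%:E = 0)%E.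
  apply: (@integral_derive_eq0 (fun t => f (t, y)) _ M).
  - by move=> t; rewrite /pd1 derive1E; exact: derivableP (df (t, y)).1.
  - move=> t; apply: (@continuous_comp _ _ _ (fun t => (t, y)) (pd1 f)); last exact: c1.
    exact: continuous_pairl.
  - by move=> t /negP ht; apply: f0; rewrite box0P => -[].
have -> : (\int[leb]_x (pd1 f x)%:E = 0)%E; last by [].
rewrite -[LHS](integral21_prod_meas1 ipd) /fubini_G.
by apply: integral0_eq => y _; exact: inner.
Qed.

Lemma integral_pd2_eq0 f (M : R) : Ck 1 f -> (forall x, ~ boxc 0 M x -> f x = 0) ->
  leb.-integrable setT (EFin \o pd2 f) /\ \int[leb]_x pd2 f x = 0.
Proof.
move=> [cf df _ c2] f0.
have ipd : leb.-integrable setT (EFin \o pd2 f).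
  apply: (integrable_cont_supp measurableT (@compact_box0 M)) => //.
  exact: pd2_eq0_off.
split => //; rewrite /Rintegral.
have inner (y : R) : (\int[mu]_t (pd2 f (y, t))%:E = 0)%E.
  apply: (@integral_derive_eq0 (fun t => f (y, t)) _ M).
  - by move=> t; rewrite /pd2 derive1E; exact: derivableP (df (y, t)).2.
  - move=> t; apply: (@continuous_comp _ _ _ (fun t => (y, t)) (pd2 f)); last exact: c2.
    exact: continuous_pairr.
  - by move=> t /negP ht; apply: f0; rewrite box0P => -[].
have -> : (\int[leb]_x (pd2 f x)%:E = 0)%E; last by [].
rewrite -[LHS](integral12_prod_meas1 ipd) /fubini_F.
by apply: integral0_eq => y _; exact: inner.
Qed.

Lemma test_fun_box0 D psi : test_fun D psi ->
  exists2 M, 0 < M & forall x, ~ boxc 0 M x -> psi x = 0.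
Proof.
move=> [_ [A [cA _ p0]]]; have [M M0 AM] := compact_boxc cA.
by exists M => // x xM; apply: p0 => /AM.
Qed.

Lemma continuousM_plane f g : continuous f -> continuous g -> continuous (fun x => f x * g x).
Proof. by move=> cf cg x; apply: continuousM; [exact: cf|exact: cg]. Qed.

Lemma is_derive_mul (h k : R -> R) (t h' k' : R) : is_derive t 1 h h' ->
  is_derive t 1 k k' -> is_derive t 1 (fun s => h s * k s) (h' * k t + h t * k').
Proof.
move=> dh dk; apply: (is_derive_eq (is_deriveM dh dk)).
by rewrite /GRing.scale /=; ring.
Qed.

Lemma pd1M f g x : derivable (fun t : R => f (t, x.2)) x.1 1 ->
  derivable (fun t : R => g (t, x.2)) x.1 1 ->
  is_derive x.1 1 (fun t => f (t, x.2) * g (t, x.2)) (pd1 f x * g x + f x * pd1 g x).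
Proof.
move=> df dg; have := is_derive_mul (derivableP df) (derivableP dg).
by rewrite -!derive1E; case: x df dg.
Qed.

Lemma pd2M f g x : derivable (fun t : R => f (x.1, t)) x.2 1 ->
  derivable (fun t : R => g (x.1, t)) x.2 1 ->
  is_derive x.2 1 (fun t => f (x.1, t) * g (x.1, t)) (pd2 f x * g x + f x * pd2 g x).
Proof.
move=> df dg; have := is_derive_mul (derivableP df) (derivableP dg).
by rewrite -!derive1E; case: x df dg.
Qed.

Lemma Ck1M f g : Ck 1 f -> Ck 1 g -> [/\ Ck 1 (fun x => f x * g x),
  forall x, pd1 (fun x => f x * g x) x = pd1 f x * g x + f x * pd1 g x &
  forall x, pd2 (fun x => f x * g x) x = pd2 f x * g x + f x * pd2 g x].
Proof.
move=> [cf df cf1 cf2] [cg dg cg1 cg2].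
have e1 x : pd1 (fun x => f x * g x) x = pd1 f x * g x + f x * pd1 g x.
  have := pd1M (df x).1 (dg x).1 => ?.
  by rewrite {1}/pd1 derive1E; exact: derive_val.
have e2 x : pd2 (fun x => f x * g x) x = pd2 f x * g x + f x * pd2 g x.
  have := pd2M (df x).2 (dg x).2 => ?.
  by rewrite {1}/pd2 derive1E; exact: derive_val.
split; [split|exact: e1|exact: e2].
- exact: continuousM_plane.
- move=> x; split.
    by have := pd1M (df x).1 (dg x).1 => ?; exact: ex_derive.
  by have := pd2M (df x).2 (dg x).2 => ?; exact: ex_derive.
- rewrite (_ : pd1 _ = fun x => pd1 f x * g x + f x * pd1 g x); last exact/funext.
  by move=> x; apply: (@continuousD _ _ _ (fun x => pd1 f x * g x) (fun x => f x * pd1 g x));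
    exact: continuousM_plane.
- rewrite (_ : pd2 _ = fun x => pd2 f x * g x + f x * pd2 g x); last exact/funext.
  by move=> x; apply: (@continuousD _ _ _ (fun x => pd2 f x * g x) (fun x => f x * pd2 g x));
    exact: continuousM_plane.
Qed.

Lemma Ck_pd1 n f : Ck n.+1 f -> Ck n (pd1 f). Proof. by case. Qed.
Lemma Ck_pd2 n f : Ck n.+1 f -> Ck n (pd2 f). Proof. by case. Qed.
Lemma Ck_continuous n f : Ck n f -> continuous f. Proof. by case: n => [|n] // []. Qed.

Lemma test_fun_pd1 D psi : test_fun D psi -> test_fun D (pd1 psi).
Proof.
move=> [cp [A [cA AD p0]]]; split; first by move=> n; exact: Ck_pd1 (cp n.+1).
exists A; split => // x xA; rewrite /pd1.
have oA : open (~` A) by rewrite openC; exact: compact_closed plane_hausdorff cA.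
have n0 : {near x.1, cst 0 =1 fun t => psi (t, x.2)}.
  have := @continuous_pairl x.2 x.1 (~` A); rewrite -surjective_pairing => /(_ (open_nbhs_nbhs (conj oA xA))).
  by move=> h; near=> t; rewrite /= p0//; near: t; exact: h.
have := near_eq_is_derive n0 (is_derive_cst (0 : R) x.1 1).
by rewrite derive1E => ?; exact: derive_val.
Unshelve. all: by end_near. Qed.

Lemma test_fun_pd2 D psi : test_fun D psi -> test_fun D (pd2 psi).
Proof.
move=> [cp [A [cA AD p0]]]; split; first by move=> n; exact: Ck_pd2 (cp n.+1).
exists A; split => // x xA; rewrite /pd2.
have oA : open (~` A) by rewrite openC; exact: compact_closed plane_hausdorff cA.
have n0 : {near x.2, cst 0 =1 fun t => psi (x.1, t)}.
  have := @continuous_pairr x.1 x.2 (~` A); rewrite -surjective_pairing => /(_ (open_nbhs_nbhs (conj oA xA))).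
  by move=> h; near=> t; rewrite /= p0//; near: t; exact: h.
have := near_eq_is_derive n0 (is_derive_cst (0 : R) x.2 1).
by rewrite derive1E => ?; exact: derive_val.
Unshelve. all: by end_near. Qed.

Lemma test_fun_continuous D psi : test_fun D psi -> continuous psi.
Proof. by move=> [cp _]; exact: (cp 0%N). Qed.

Lemma integrable_mul_test D g psi : measurable (D : set (mplane R)) ->
  locally_integrable2 D g -> test_fun D psi ->
  leb.-integrable D (EFin \o (fun x => g x * psi x)).
Proof.
move=> mD lg [cp [A [cA AD p0]]].
by apply: (integrable_mul_supp mD cA AD (cp 0%N) p0); exact: lg.
Qed.

Lemma continuous_locally_integrable2 D f : continuous f -> locally_integrable2 D f.
Proof.
move=> cf A cA AD; have mA := compact_measurable2 cA.
have [M hM] := compact_norm_bound cA cf.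
apply: (bounded_integrable2 mA (compact_leb2_lty cA) _ hM).
exact: borel_funS (continuous_borel cf).
Qed.

(** The product has compact support, so the integral of its derivative is 0. Only [phi] is compactly
    supported: [psi] may be the constant 1, as in [is_wgrad_const_ae]. *)
Lemma ibp_pd1 D psi phi : measurable (D : set (mplane R)) ->
  (forall n, Ck n psi) -> test_fun D phi ->
  \int[leb]_(x in D) (psi x * pd1 phi x) = - \int[leb]_(x in D) (pd1 psi x * phi x).
Proof.
move=> mD cp tphi; have [cphi _] := tphi.
have [c e1 _] := Ck1M (cp 1%N) (cphi 1%N).
have [M M0 hM] := test_fun_box0 tphi.
have z x : ~ boxc 0 M x -> psi x * phi x = 0 by move=> xM; rewrite hM// mulr0.
have [_] := integral_pd1_eq0 c z.
have i1 : leb.-integrable D (EFin \o (fun x => psi x * pd1 phi x)).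
  apply: integrable_mul_test => //; last exact: test_fun_pd1.
  exact: continuous_locally_integrable2 (cp 0%N).
have i2 : leb.-integrable D (EFin \o (fun x => pd1 psi x * phi x)).
  apply: integrable_mul_test => //.
  exact: continuous_locally_integrable2 (Ck_pd1 (cp 1%N)).
have [_ [A [cA AD p0]]] := tphi; have [_ [B [cB BD q0]]] := test_fun_pd1 tphi.
rewrite (@Rintegral_supp setT D (pd1 (fun x => psi x * phi x)))//; last first.
  by move=> x xD; rewrite e1 p0 ?q0 ?mulr0 ?addr0 // => [/BD|/AD].
under eq_Rintegral do rewrite e1.
by rewrite RintegralD// => /eqP; rewrite addrC addr_eq0 => /eqP ->.
Qed.

Lemma ibp_pd2 D psi phi : measurable (D : set (mplane R)) ->
  (forall n, Ck n psi) -> test_fun D phi ->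
  \int[leb]_(x in D) (psi x * pd2 phi x) = - \int[leb]_(x in D) (pd2 psi x * phi x).
Proof.
move=> mD cp tphi; have [cphi _] := tphi.
have [c _ e1] := Ck1M (cp 1%N) (cphi 1%N).
have [M M0 hM] := test_fun_box0 tphi.
have z x : ~ boxc 0 M x -> psi x * phi x = 0 by move=> xM; rewrite hM// mulr0.
have [_] := integral_pd2_eq0 c z.
have i1 : leb.-integrable D (EFin \o (fun x => psi x * pd2 phi x)).
  apply: integrable_mul_test => //; last exact: test_fun_pd2.
  exact: continuous_locally_integrable2 (cp 0%N).
have i2 : leb.-integrable D (EFin \o (fun x => pd2 psi x * phi x)).
  apply: integrable_mul_test => //.
  exact: continuous_locally_integrable2 (Ck_pd2 (cp 1%N)).
have [_ [A [cA AD p0]]] := tphi; have [_ [B [cB BD q0]]] := test_fun_pd2 tphi.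
rewrite (@Rintegral_supp setT D (pd2 (fun x => psi x * phi x)))//; last first.
  by move=> x xD; rewrite e1 p0 ?q0 ?mulr0 ?addr0 // => [/BD|/AD].
under eq_Rintegral do rewrite e1.
by rewrite RintegralD// => /eqP; rewrite addrC addr_eq0 => /eqP ->.
Qed.

End Integrals.

(** * The fundamental lemma of the calculus of variations *)

Section DuBoisReymond.
Variable R : realType.
Implicit Types (x : plane R) (D : set (plane R)) (g h psi : plane R -> R).
Local Notation leb := (leb2 R).

(** Dynkin's theorem for the pi-system of bounded open intervals. The whole line is not one of them,
    hence the separate hypothesis. *)
Lemma sub_interval_dynkin (P : set (set R)) :
  P setT -> (forall a b, P `]a, b[%classic) ->
  (forall S, measurable (S : set (measurableTypeR R)) -> P S -> P (~` S)) ->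
  (forall F : (set R)^nat, (forall n, measurable (F n : set (measurableTypeR R))) ->
    trivIset setT F -> (forall n, P (F n)) -> P (\bigcup_k F k)) ->
  forall S, measurable (S : set (measurableTypeR R)) -> P S.
Proof.
move=> PT PI PC PU S mS.
have e : measurable = <<s @RGenOpens.G R >>
  := RGenOpens.measurableE R.
apply: (dynkin_induction e _ PT _ PC PU).
- move=> _ _ [a [b ->]] [c [d ->]]; exists (Num.max a c), (Num.min b d).
  apply/seteqP; split => t /=; rewrite !in_itv /= gt_max lt_min.
    by move=> [/andP[-> ->] /andP[-> ->]].
  by move=> /andP[/andP[-> ->] /andP[-> ->]].
- by move=> _ [a [b ->]]; exact: PI.
- by rewrite -e.
Qed.

Section Rectangles.
Variable h : plane R -> R.
Hypothesis ih : leb.-integrable setT (EFin \o h).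
Let Z (S : set (plane R)) := (\int[leb]_(x in S) (h x)%:E = 0)%E.

Let mh (S : set (mplane R)) : measurable S -> measurable_fun S h.
Proof.
by move=> mS; apply/measurable_EFinP; apply: measurable_funTS; exact: measurable_int ih.
Qed.

Let ZD (S C : set (plane R)) : measurable (S : set (mplane R)) ->
  measurable (C : set (mplane R)) -> S `<=` C -> Z C -> Z S -> Z (C `\` S).
Proof.
move=> mS mC SC; rewrite /Z -{1}(setDUK SC) integral_setU_EFin//.
- by move=> e1 e2; rewrite -[RHS]e1 [X in _ = (X + _)%E]e2 add0e.
- exact: measurableD.
- by rewrite setDUK//; exact: mh.
- by apply/disj_setPS => x [Sx [_ nSx]].
Qed.

Let ZU (F : (set (plane R))^nat) : (forall n, measurable (F n : set (mplane R))) ->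
  trivIset setT F -> (forall n, Z (F n)) -> Z (\bigcup_k F k).
Proof.
move=> mF tF ZF; rewrite /Z integral_bigcup//; last first.
  by apply: (integrableS measurableT) => //; exact: bigcup_measurable.
by rewrite eseries0// => i _ _; exact: ZF.
Qed.

Hypothesis hbox : forall a b c d, Z (`]a, b[ `*` `]c, d[).
Variable M : R.
Hypothesis hM : forall x, ~ boxc 0 M x -> h x = 0.

Let hbox' (S : set (plane R)) a b c d : measurable (S : set (mplane R)) ->
  `]a, b[ `*` `]c, d[ `<=` S ->
  (forall x, S x -> boxc 0 M x -> (`]a, b[ `*` `]c, d[) x) -> Z S.
Proof.
move=> mS sub Sx; have := @hbox a b c d; rewrite /Z => <-.
rewrite integral_mkcond [RHS]integral_mkcond; apply: eq_integral => x _.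
rewrite /patch; case: ifPn => [|/negP] xS; case: ifPn => [|/negP] xB //.
  rewrite hM// => xM; apply: xB; rewrite inE; apply: Sx => //.
  by rewrite -inE.
by exfalso; apply: xS; rewrite inE; apply: sub; rewrite -inE.
Qed.

Let I0 x : boxc 0 M x -> (x.1 \in `](- `|M| - 1), (`|M| + 1)[) /\
  (x.2 \in `](- `|M| - 1), (`|M| + 1)[).
Proof.
by move=> /box0P[/andP[h1 h2] /andP[h3 h4]]; have := ler_norm M; rewrite !in_itv /=; split; apply/andP; split; lra.
Qed.

(** Three Dynkin arguments: in the first variable over a fixed interval, in the second over a fixed
    measurable set, and from measurable rectangles to the product sigma-algebra. The bounded support
    of [h] reduces a full line to a bounded interval each time. *)
Lemma integral_measurable_eq0 (S : set (mplane R)) : measurable S -> Z S.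
Proof.
have step1 c d (A : set R) : measurable (A : set (measurableTypeR R)) ->
    Z (A `*` `]c, d[).
  move: A; apply: sub_interval_dynkin.
  - apply: (@hbox' _ (- `|M| - 1) (`|M| + 1) c d).
    + by apply: measurableX => //; exact: measurable_itv.
    + by move=> x [_ ?]; split.
    + by move=> x [_ ?] /I0[]; split.
  - by move=> a b; exact: hbox.
  - move=> A mA ZA; have -> : ~` A `*` `]c, d[ = (setT `*` `]c, d[) `\` (A `*` `]c, d[).
      apply/seteqP; split => x /=.
        by move=> [nA xJ]; split => // -[].
      by move=> [[_ xJ] nAJ]; split => // xA; apply: nAJ.
    apply: ZD => //.
    + by apply: measurableX => //; exact: measurable_itv.
    + by apply: measurableX => //; exact: measurable_itv.
    + by move=> x [_ ?]; split.
    + apply: (@hbox' _ (- `|M| - 1) (`|M| + 1) c d).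
      * by apply: measurableX => //; exact: measurable_itv.
      * by move=> x [_ ?]; split.
      * by move=> x [_ ?] /I0[]; split.
  - move=> F mF tF ZF; have -> : \bigcup_k F k `*` `]c, d[ = \bigcup_k (F k `*` `]c, d[).
      apply/seteqP; split => x /=; first by move=> [[k _ xk] xJ]; exists k.
      by move=> [k _ [xk xJ]]; split => //; exists k.
    apply: ZU => //.
      by move=> n; apply: measurableX => //; exact: measurable_itv.
    apply/trivIsetP => i j _ _ ij; move/trivIsetP : tF => /(_ i j I I ij) Fij.
    apply/seteqP; split => // x [[xi _] [xj _]].
    by have : (F i `&` F j) x.1 by []; rewrite Fij.
have step2 (A B : set R) : measurable (A : set (measurableTypeR R)) ->
    measurable (B : set (measurableTypeR R)) -> Z (A `*` B).
  move=> mA; move: B; apply: sub_interval_dynkin.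
  - have := @step1 (- `|M| - 1) (`|M| + 1) A mA; rewrite /Z => <-.
    rewrite integral_mkcond [RHS]integral_mkcond; apply: eq_integral => x _.
    rewrite /patch; case: ifPn => [|/negP] xS; case: ifPn => [|/negP] xB //.
      rewrite hM// => /I0[_ xM]; apply: xB; move: xS; rewrite !inE /= => -[? _].
      by split.
    by exfalso; apply: xS; move: xB; rewrite !inE => -[? _]; split.
  - by move=> a b; exact: step1.
  - move=> B mB ZB; have -> : A `*` ~` B = (A `*` setT) `\` (A `*` B).
      apply/seteqP; split => x /=.
        by move=> [xA nB]; split => // -[].
      by move=> [[xA _] nAB]; split => // xB; apply: nAB.
    apply: ZD => //; [exact: measurableX|exact: measurableX| |].
      by move=> x [? _]; split.
    have := @step1 (- `|M| - 1) (`|M| + 1) A mA; rewrite /Z => <-.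
    rewrite integral_mkcond [RHS]integral_mkcond; apply: eq_integral => x _.
    rewrite /patch; case: ifPn => [|/negP] xS; case: ifPn => [|/negP] xB //.
      rewrite hM// => /I0[_ xM]; apply: xB; move: xS; rewrite !inE /= => -[? _].
      by split.
    by exfalso; apply: xS; move: xB; rewrite !inE => -[? _]; split.
  - move=> F mF tF ZF; have -> : A `*` \bigcup_k F k = \bigcup_k (A `*` F k).
      apply/seteqP; split => x /=; first by move=> [xJ [k _ xk]]; exists k.
      by move=> [k _ [xk xJ]]; split => //; exists k.
    apply: ZU => //; first by move=> n; apply: measurableX.
    apply/trivIsetP => i j _ _ ij; move/trivIsetP : tF => /(_ i j I I ij) Fij.
    apply/seteqP; split => // x [[_ xi] [_ xj]].
    by have : (F i `&` F j) x.2 by []; rewrite Fij.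
move=> mS.
have e := @measurable_prod_measurableType _ _ (measurableTypeR R) (measurableTypeR R).
apply: (dynkin_induction e).
- move=> _ _ [A mA [B mB <-]] [A' mA' [B' mB' <-]].
  exists (A `&` A'); first exact: measurableI.
  by exists (B `&` B'); [exact: measurableI|rewrite setXI].
- by rewrite -setXTT; exact: step2.
- by move=> _ [A mA [B mB <-]]; exact: step2.
- move=> B mB ZB; rewrite -setTD; apply: ZD => //.
  by rewrite -setXTT; exact: step2.
- by move=> F mF tF ZF; exact: ZU.
- by rewrite -e.
Qed.

End Rectangles.

Section FundamentalLemma.
Variables (D : set (plane R)) (g : plane R -> R).
Hypothesis oD : open D.
Hypothesis lg : locally_integrable2 D g.
Hypothesis g0 : forall psi, test_fun D psi -> \int[leb]_(x in D) (g x * psi x) = 0.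

Let mD : measurable (D : set (mplane R)) := open_measurable2 oD.

(** Products of cut-offs converge to the indicator of the open rectangle and are bounded by 1, so
    dominated convergence applies with |g| as majorant. *)
Lemma integral_rect_eq0 a b c d : `[a, b] `*` `[c, d] `<=` D ->
  (\int[leb]_(x in `]a, b[ `*` `]c, d[) (g x)%:E = 0)%E.
Proof.
move=> sD; set O := `]a, b[ `*` `]c, d[.
have mO : measurable (O : set (mplane R)) by exact: measurable_rect.
have sub t u v : t \in `]u, v[ -> t \in `[u, v] :> Prop.
  by rewrite !in_itv /= => /andP[/ltW -> /ltW ->].
have ig : leb.-integrable O (EFin \o g).
  have h : leb.-integrable (`[a, b] `*` `[c, d]) (EFin \o g).
    by apply: lg => //; apply: compact_setX; exact: segment_compact.
  apply: integrableS h => //; first exact: measurable_rect.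
  by move=> x [x1 x2]; split; exact: sub.
pose psi n := tens (cutoff n%:R a b) (cutoff n%:R c d).
have tp n : test_fun D (psi n).
  apply: (test_fun_tens _ _ _ _ sD); try exact: smooth_cutoff.
    move=> t /negP ht; apply: cutoff_off => //; apply/negP => /andP[t1 t2].
    by apply: ht; rewrite !ltW.
  move=> t /negP ht; apply: cutoff_off => //; apply/negP => /andP[t1 t2].
  by apply: ht; rewrite !ltW.
have p0 n x : ~ O x -> psi n x = 0.
  move=> /not_andP[h|h]; rewrite /psi /tens.
    by rewrite cutoff_off ?mul0r//; apply/negP => h'; apply: h; rewrite /= in_itv.
  by rewrite (@cutoff_off _ _ c d) ?mulr0//; apply/negP => h'; apply: h; rewrite /= in_itv.
have OD : O `<=` D by move=> x [x1 x2]; apply: sD; split; exact: sub.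
have mp n : measurable_fun (O : set (mplane R)) (psi n).
  exact: borel_funS (continuous_borel (test_fun_continuous (tp n))).
have p1 n x : `|psi n x| <= 1.
  rewrite /psi /tens normrM !ger0_norm ?cutoff_ge0//.
  by rewrite mulr_ile1 ?cutoff_ge0 ?cutoff_le1.
have int0 n : (\int[leb]_(x in O) (g x * psi n x)%:E = 0)%E.
  have : \int[leb]_(x in O) (g x * psi n x) = 0.
    rewrite -(@Rintegral_supp _ D O)//; first exact: g0.
    by move=> x /p0 ->; rewrite mulr0.
  rewrite /Rintegral => e; rewrite -[LHS]fineK ?e//.
  apply: integrable_fin_num => //.
  exact: (integrableMl mO ig (mp n) (bounded_withinP (fun x _ => p1 n x))).
have mgO : measurable_fun (O : set (mplane R)) (EFin \o g).
  exact: measurable_int ig.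
have [] := @dominated_convergence _ _ _ leb O mO (fun n x => (g x * psi n x)%:E)
  (EFin \o g) (fun x => `|(g x)%:E|%E).
- move=> n; apply/measurable_EFinP; apply: measurable_funM => //.
  exact/measurable_EFinP.
- exact: mgO.
- apply: nearW => x [x1 x2]; apply: cvg_EFin; first exact: nearW.
  rewrite -[X in _ --> X]mulr1; apply: cvgM; first exact: cvg_cst.
  rewrite -[X in _ --> X]mulr1; apply: cvgM; apply: cutoff_cvg1.
    by move: x1; rewrite /= in_itv.
  by move: x2; rewrite /= in_itv.
- exact: integrable_abse.
- apply: nearW => x n _; rewrite EFinM abseM -[leRHS]mule1.
  by apply: lee_wpmul2l => //; rewrite lee_fin.
move=> _ _ cv.
have cv0 : (fun n => (\int[leb]_(x in O) (g x * psi n x)%:E)%E) @ \oo --> (0 : \bar R)%E.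
  by under eq_fun do rewrite int0; exact: cvg_cst.
exact: (cvg_unique _ cv cv0).
Qed.

(** The truncation of [g] to the box integrates to 0 over every open rectangle, since the
    intersection with the box is again a rectangle; hence over every measurable set, and it vanishes
    almost everywhere. *)
Lemma ae_eq0_boxo c s : boxc c s `<=` D ->
  {ae leb, forall x, boxo c s x -> g x = 0}.
Proof.
move=> sD; set O := boxo c s.
have mO : measurable (O : set (mplane R)) by exact: measurable_rect.
pose h := g \_ O.
have ih : leb.-integrable setT (EFin \o h).
  have : leb.-integrable (boxc c s) (EFin \o g).
    by apply: lg => //; apply: compact_setX; exact: segment_compact.
  move=> /(integrableS (measurable_boxc c s) mO (@boxo_boxc _ _ _)).
  by move/(integrable_mkcond _ mO); rewrite restrict_EFin.
have hbox a b c' d : (\int[leb]_(x in `]a, b[ `*` `]c', d[) (h x)%:E = 0)%E.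
  pose a' := Num.max a (c.1 - s); pose b' := Num.min b (c.1 + s).
  pose c'' := Num.max c' (c.2 - s); pose d' := Num.min d (c.2 + s).
  have <- : (\int[leb]_(x in `]a', b'[ `*` `]c'', d'[) (g x)%:E = 0)%E.
    apply: integral_rect_eq0 => x [/= x1 x2]; apply: sD; split => /=.
      by move: x1; rewrite /a' /b' !in_itv /= ge_max le_min => /andP[/andP[_ ->] /andP[_ ->]].
    by move: x2; rewrite /c'' /d' !in_itv /= ge_max le_min => /andP[/andP[_ ->] /andP[_ ->]].
  rewrite [RHS]integral_mkcond [LHS]integral_mkcond; apply: eq_integral => x _.
  have e : (`]a', b'[ `*` `]c'', d'[) x <-> (`]a, b[ `*` `]c', d[) x /\ O x.
    rewrite /O /boxo /a' /b' /c'' /d' /= !in_itv /= !gt_max !lt_min; split.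
      by move=> [/andP[/andP[-> ->] /andP[-> ->]] /andP[/andP[-> ->] /andP[-> ->]]].
    by move=> [[/andP[-> ->] /andP[-> ->]] [/andP[-> ->] /andP[-> ->]]].
  rewrite /patch /h /patch; case: ifPn => [|/negP]; rewrite inE => x1.
    case: ifPn => [|/negP]; rewrite inE => x2; case: ifPn => [|/negP]; rewrite inE => x3 //.
      by exfalso; apply: x3; apply/e.
    by move/e : x3 => [].
  by case: ifPn => // /[!inE] /e[].
have hM x : ~ boxc 0 (`|c.1| + `|c.2| + `|s|) x -> h x = 0.
  move=> xM; rewrite /h /patch; case: ifPn => // /[!inE] /boxoP[h1 h2].
  exfalso; apply: xM; apply/boxcP; rewrite !subr0; have hs := ler_norm s.
  have := ler_normD (x.1 - c.1) c.1; have := ler_normD (x.2 - c.2) c.2.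
  by rewrite !subrK; have := normr_ge0 c.1; have := normr_ge0 c.2; split; lra.
have := @integral_ae_eq _ _ _ leb setT measurableT (cst 0%E) (EFin \o h) ih
  (measurable_cst _).
case.
  move=> E _ mE; rewrite integral0; exact: (integral_measurable_eq0 ih hbox hM).
move=> N [mN N0 hN]; exists N; split => // x /= xg; apply: hN => /= hx.
apply: xg => xO; have := hx I; rewrite /h /patch mem_set//.
by move=> [].
Qed.

Lemma du_bois_reymond : {ae leb, forall x, D x -> g x = 0}.
Proof.
pose P n x := boxc (qbox R n).1 (qbox R n).2 `<=` D ->
  boxo (qbox R n).1 (qbox R n).2 x -> g x = 0.
have : {ae leb, forall x, forall n, P n x}.
  apply: ae_foralln => n; rewrite /P.
  have [sD|nsD] := pselect (boxc (qbox R n).1 (qbox R n).2 `<=` D).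
    by apply: ae2W (ae_eq0_boxo sD) => x h _; exact: h.
  by apply: nearW => x /nsD.
apply: ae2W => x h Dx; move: (Dx); rewrite (open_qbox oD) => -[n nD xn].
exact: (h n).
Qed.

End FundamentalLemma.

End DuBoisReymond.

(** * Norms on subsets of the plane *)

(** Measurability relative to [D]: a function of [Vh] is constrained only on the closure of the
    domain, so it cannot be expected to be Borel on the plane. *)
Definition mfun2 (R : realType) (D : set (plane R)) (f : plane R -> R) : Prop :=
  measurable_fun (D : set (mplane R)) (f : mplane R -> measurableTypeR R).

Section LpNorms.
Variable R : realType.
Implicit Types (x : plane R) (D A : set (plane R)) (f g : plane R -> R) (q M : R).
Local Notation leb := (leb2 R).
Local Notation mset D := (measurable (D : set (mplane R))).

Lemma mfun2D D f g : mfun2 D f -> mfun2 D g -> mfun2 D (fun x => f x + g x).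
Proof. exact: measurable_funD. Qed.

Lemma mfun2B D f g : mfun2 D f -> mfun2 D g -> mfun2 D (fun x => f x - g x).
Proof. exact: measurable_funB. Qed.

Lemma mfun2M D f g : mfun2 D f -> mfun2 D g -> mfun2 D (fun x => f x * g x).
Proof. exact: measurable_funM. Qed.

Lemma mfun2_cst D M : mfun2 D (fun=> M).
Proof. exact: measurable_cst. Qed.

Lemma borel_mfun2 D f : borel_fun f -> mfun2 D f.
Proof. exact: borel_funS. Qed.

Lemma mfun2S D A f : mset D -> A `<=` D -> mfun2 D f -> mfun2 A f.
Proof. by move=> mD AD; exact: measurable_funS. Qed.

Lemma mfun2_comp D f (h : R -> R) : continuous h -> mfun2 D f -> mfun2 D (fun x => h (f x)).
Proof. by move=> ch mf; apply: measurableT_comp mf; exact: continuous_measurable_fun. Qed.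

Lemma mfun2_powR D f q : mfun2 D f ->
  measurable_fun (D : set (mplane R)) (fun x => (`|f x| `^ q)%:E).
Proof.
move=> mf; apply/measurable_EFinP.
apply: (@measurableT_comp _ _ _ _ _ _ (@powR R ^~ q)); first exact: measurable_powR.
by apply: measurableT_comp => //; exact: normr_measurable.
Qed.

Lemma mfun2_patch D f : mset D -> mfun2 D f -> mfun2 setT (f \_ D).
Proof. by move=> mD mf; exact: ((measurable_restrictT f mD).1 mf). Qed.

Lemma LpP D q f : mset D -> Lp D q f <-> borel_fun f /\ (nLp D q f < +oo)%E.
Proof.
move=> mD; rewrite /Lp; split => -[bf].
  by rewrite !inE => /andP[_]; rewrite inE.
move=> h; split => //; rewrite !inE; apply/andP; split; rewrite inE //=.
exact: mfun2_patch mD (borel_mfun2 bf).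
Qed.

Lemma nLp_ge0 D q f : (0 <= nLp D q f)%E.
Proof. exact: Lnorm_ge0. Qed.

Lemma nLpE D q f : 0 < q ->
  nLp D q f = ((\int[leb]_(x in D) (`|f x| `^ q)%:E) `^ q^-1)%E.
Proof.
move=> q0; rewrite /nLp Lnorm.unlock.
apply: (congr1 (fun y => (y `^ q^-1)%E)).
rewrite [RHS]integral_mkcond; apply: eq_integral => x _ /=.
rewrite /patch; case: ifPn => _ //=.
by rewrite normr0 powR0// gt_eqF.
Qed.

Lemma integral_powR_ge0 D q f : (0 <= \int[leb]_(x in D) (`|f x| `^ q)%:E)%E.
Proof. by apply: integral_ge0 => x _; rewrite lee_fin powR_ge0. Qed.

Lemma nLp_le D A q f g : 0 < q -> mset D -> mset A -> D `<=` A ->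
  mfun2 D f -> mfun2 A g ->
  {ae leb, forall x, D x -> `|f x| <= `|g x|} -> (nLp D q f <= nLp A q g)%E.
Proof.
move=> q0 mD mA DA mf mg fg; rewrite !(nLpE _ _ q0).
apply: gt0_ler_poweR.
- by rewrite invr_ge0 ltW.
- by rewrite in_itv /= integral_powR_ge0 leey.
- by rewrite in_itv /= integral_powR_ge0 leey.
apply: (@le_trans _ _ (\int[leb]_(x in D) (`|g x| `^ q)%:E)%E).
  apply: ae_ge0_le_integral => //.
  - exact: mfun2_powR.
  - exact: mfun2_powR (mfun2S mA DA mg).
  - apply: ae2W fg => x h Dx; rewrite lee_fin.
    by apply: ge0_ler_powR; rewrite ?nnegrE ?h// ltW.
by apply: ge0_subset_integral => //; exact: mfun2_powR.
Qed.

Lemma nLp_ae_eq D q f g : 0 < q -> mset D -> mfun2 D f -> mfun2 D g ->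
  {ae leb, forall x, D x -> f x = g x} -> nLp D q f = nLp D q g.
Proof.
move=> q0 mD mf mg fg; apply/eqP; rewrite eq_le !nLp_le//.
  by apply: ae2W fg => x h Dx; rewrite h.
by apply: ae2W fg => x h Dx; rewrite h.
Qed.

Lemma nLp_eq D q f g : 0 < q -> (forall x, D x -> f x = g x) -> nLp D q f = nLp D q g.
Proof.
move=> q0 fg; rewrite !(nLpE _ _ q0); apply: (congr1 (fun y => (y `^ _)%E)).
by apply: eq_integral => x /[!inE] Dx; rewrite fg.
Qed.

Lemma nLpD D q f g : 1 <= q -> mset D -> mfun2 D f -> mfun2 D g ->
  (nLp D q (fun x => f x + g x)%R <= nLp D q f + nLp D q g)%E.
Proof.
move=> q1 mD mf mg.
have h := @minkowski_EFin _ _ _ leb (f \_ D) (g \_ D) q (mfun2_patch mD mf)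
  (mfun2_patch mD mg) q1.
apply: le_trans h; rewrite le_eqVlt; apply/orP; left; apply/eqP.
apply: eq_Lnorm => x /=; rewrite /patch; case: ifPn => //= _.
by rewrite addr0.
Qed.

Lemma nLpZ D q M f : 0 < q -> mset D -> mfun2 D f ->
  (nLp D q (fun x => M * f x)%R = `|M|%:E * nLp D q f)%E.
Proof.
move=> q0 mD mf; rewrite !(nLpE _ _ q0).
have -> : (\int[leb]_(x in D) (`|M * f x| `^ q)%:E =
   (`|M| `^ q)%:E * \int[leb]_(x in D) (`|f x| `^ q)%:E)%E.
  rewrite -ge0_integralZl_EFin ?powR_ge0//.
  - by apply: eq_integral => x _; rewrite normrM powRM// EFinM.
  - exact: mfun2_powR.
rewrite poweRM ?lee_fin ?powR_ge0 ?integral_powR_ge0//; congr (_ * _)%E.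
by rewrite poweR_EFin -powRrM mulfV ?gt_eqF// powRr1.
Qed.

Lemma nLp_leZ D q M f g : 0 < q -> 0 <= M -> mset D -> mfun2 D f -> mfun2 D g ->
  {ae leb, forall x, D x -> `|f x| <= M * `|g x|} -> (nLp D q f <= M%:E * nLp D q g)%E.
Proof.
move=> q0 M0 mD mf mg fg; rewrite -[in leRHS](ger0_norm M0) -nLpZ//.
apply: nLp_le => //; first by apply: mfun2M => //; exact: @mfun2_cst.
by apply: ae2W fg => x h Dx; rewrite normrM (ger0_norm M0) h.
Qed.

Lemma nLp_bound D q M m f : 0 < q -> 0 <= M -> mset D -> mfun2 D f ->
  (leb D <= m%:E)%E ->
  {ae leb, forall x, D x -> `|f x| <= M} -> (nLp D q f <= (M * m `^ q^-1)%:E)%E.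
Proof.
move=> q0 M0 mD mf Dm fM.
have := @nLp_leZ D q M f (cst 1) q0 M0 mD mf (@mfun2_cst D 1) => /(_ _)/le_trans; apply.
  by apply: ae2W fM => x h Dx; rewrite /= normr1 mulr1 h.
rewrite EFinM; apply: lee_wpmul2l; first by rewrite lee_fin.
rewrite (nLpE _ _ q0); have -> : (\int[leb]_(x in D) (`|cst 1 x : R| `^ q)%:E = leb D)%E.
  transitivity (\int[leb]_(x in D) (cst 1%E x))%E; last by rewrite integral_cst// mul1e.
  by apply: eq_integral => x _; rewrite /= normr1 powR1.
rewrite -poweR_EFin; apply: gt0_ler_poweR => //.
- by rewrite invr_ge0 ltW.
- by rewrite in_itv /= measure_ge0 leey.
- by rewrite in_itv /= leey andbT (le_trans _ Dm).
Qed.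

Lemma nLp_hoelder1 D q s f g : 0 < q -> 0 < s -> q^-1 + s^-1 = 1 -> mset D ->
  mfun2 D f -> mfun2 D g ->
  (nLp D 1 (fun x => f x * g x)%R <= nLp D q f * nLp D s g)%E.
Proof.
move=> q0 s0 qs mD mf mg.
have := @hoelder _ _ _ leb (f \_ D) (g \_ D) q s (mfun2_patch mD mf)
  (mfun2_patch mD mg) q0 s0 qs.
apply: le_trans; rewrite le_eqVlt; apply/orP; left; apply/eqP.
apply: eq_Lnorm => x /=; rewrite /patch; case: ifPn => //= _.
by rewrite mulr0.
Qed.

(** The usual inequality applied to the squares |f|^2 and |g|^2 with the conjugate exponents r/2 and
    s/2. *)
Lemma nLp_hoelder2 D r s f g : 2 < r -> 2 < s -> r^-1 + s^-1 = 2^-1 -> mset D ->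
  mfun2 D f -> mfun2 D g ->
  (nLp D 2 (fun x => f x * g x)%R <= nLp D r f * nLp D s g)%E.
Proof.
move=> r2 s2 rs mD mf mg.
have sq_m h : mfun2 D h -> mfun2 D (fun x => `|h x| `^ 2).
  by move=> /mfun2_powR-/(_ 2)/measurable_EFinP.
have P q h : 2 < q -> nLp D (q / 2) (fun x => `|h x| `^ 2) = (nLp D q h `^ 2)%E.
  move=> q2; rewrite !nLpE//; [|by lra|by rewrite divr_gt0//; lra].
  rewrite -poweRrM (_ : (q / 2)^-1 = q^-1 * 2); last by rewrite invf_div mulrC.
  apply: (congr1 (fun y => (y `^ (q^-1 * 2))%E)).
  apply: eq_integral => x _; congr EFin.
  rewrite (ger0_norm (powR_ge0 _ _)) -powRrM; congr (_ `^ _); by field.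
have P1 : nLp D 1 (fun x => `|f x| `^ 2 * `|g x| `^ 2)%R =
    (nLp D 2 (fun x => f x * g x)%R `^ 2)%E.
  rewrite !nLpE// -poweRrM mulVf// invr1; apply: (congr1 (fun y => (y `^ 1)%E)).
  apply: eq_integral => x _; congr EFin.
  rewrite powRr1 ?normr_ge0// ger0_norm ?mulr_ge0 ?powR_ge0//.
  by rewrite normrM powRM.
have := @nLp_hoelder1 D (r / 2) (s / 2) _ _ _ _ _ mD (sq_m _ mf) (sq_m _ mg).
rewrite P1 !P// -poweRM ?nLp_ge0// => /(_ _ _ _) h.
have {}h : (nLp D 2 (fun x => f x * g x)%R `^ 2 <= (nLp D r f * nLp D s g) `^ 2)%E.
  apply: h; [by rewrite divr_gt0//; lra|by rewrite divr_gt0//; lra|].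
  by rewrite !invf_div -mulrDr rs mulfV.
have sq (x : \bar R) : (0 <= x -> (x `^ 2) `^ 2^-1 = x)%E.
  by move=> x0; rewrite -poweRrM mulfV// poweRe1.
rewrite -[leLHS]sq ?nLp_ge0// -[leRHS]sq ?mule_ge0 ?nLp_ge0//.
apply: gt0_ler_poweR => //; rewrite ?invr_ge0// in_itv /= leey andbT poweR_ge0//.
Qed.

Lemma nLp1E D f : nLp D 1 f = (\int[leb]_(x in D) `|f x|%:E)%E.
Proof.
rewrite nLpE// invr1 poweRe1 ?integral_powR_ge0//.
by apply: eq_integral => x _; rewrite powRr1.
Qed.

Lemma nLp1_integrable D f a : mset D -> mfun2 D f -> (nLp D 1 f <= a%:E)%E ->
  leb.-integrable D (EFin \o f) /\ `|\int[leb]_(x in D) f x| <= a.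
Proof.
move=> mD mf; rewrite nLp1E => fa.
have iF : leb.-integrable D (EFin \o f).
  by apply/integrableP; split; [exact/measurable_EFinP|exact: le_lt_trans fa (ltry _)].
split => //; rewrite -lee_fin EFin_normr_Rintegral//.
by apply: le_trans fa; apply: le_abse_integral => //; exact/measurable_EFinP.
Qed.

Lemma nLp1_bound D q M m a f g : 1 < q -> 0 <= M -> 0 <= m -> mset D ->
  mfun2 D f -> mfun2 D g -> (leb D <= m%:E)%E -> (nLp D q f <= a%:E)%E ->
  (forall x, D x -> `|g x| <= M) ->
  (nLp D 1 (fun x => f x * g x)%R <= (a * (M * m `^ (1 - q^-1)))%:E)%E.
Proof.
move=> q1 M0 m0 mD mf mg Dm fa gM.
have q0 : 0 < q by exact: lt_trans q1.
have i1 : 0 < 1 - q^-1 by rewrite subr_gt0 invf_lt1.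
apply: (le_trans (@nLp_hoelder1 D q (1 - q^-1)^-1 f g q0 _ _ mD mf mg)).
- by rewrite invr_gt0.
- by rewrite invrK; ring.
rewrite EFinM; apply: lee_pmul; rewrite ?nLp_ge0//.
rewrite -[X in m `^ X]invrK; apply: nLp_bound => //; first by rewrite invr_gt0.
by apply: nearW => x Dx; exact: gM.
Qed.

Definition rintegrable D f := leb.-integrable D (EFin \o f).

Lemma rintegrableZ D M f : mset D -> rintegrable D f -> rintegrable D (fun x => M * f x).
Proof. by move=> mD; exact: (@integrableZl _ _ _ leb D mD M (EFin \o f)). Qed.

Lemma rintegrableD D f g : mset D -> rintegrable D f -> rintegrable D g ->
  rintegrable D (fun x => f x + g x).
Proof. by move=> mD; exact: (@integrableD _ _ _ leb D mD (EFin \o f) (EFin \o g)). Qed.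

Lemma rintegrableB D f g : mset D -> rintegrable D f -> rintegrable D g ->
  rintegrable D (fun x => f x - g x).
Proof. by move=> mD; exact: (@integrableB _ _ _ leb D mD (EFin \o f) (EFin \o g)). Qed.

Lemma eq_rintegrable D f g : (forall x, f x = g x) -> rintegrable D f -> rintegrable D g.
Proof. by move=> fg; suff -> : g = f by []; apply/funext. Qed.

Lemma rintegrableS D A f : mset D -> mset A -> A `<=` D -> rintegrable D f -> rintegrable A f.
Proof. by move=> mD mA; exact: (integrableS mD mA). Qed.

Lemma Rintegral_lin D (a b : R) f g : mset D -> rintegrable D f -> rintegrable D g ->
  \int[leb]_(x in D) (a * f x + b * g x) =
  a * \int[leb]_(x in D) f x + b * \int[leb]_(x in D) g x.
Proof.
move=> mD jf jg; rewrite RintegralD//; first by rewrite !RintegralZl.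
  exact: rintegrableZ.
exact: rintegrableZ.
Qed.

End LpNorms.

(** * Weak derivatives and smooth test fields *)

Definition dirder (R : realType) (e : plane R) (psi : plane R -> R) (x : plane R) : R :=
  e.1 * pd1 psi x + e.2 * pd2 psi x.

Section WeakDerivatives.
Variable R : realType.
Implicit Types (x e : plane R) (D A : set (plane R)) (f g psi phi S : plane R -> R).
Implicit Types (G v : plane R -> plane R).
Local Notation leb := (leb2 R).
Local Notation mset D := (measurable (D : set (mplane R))).

Lemma Rintegral_ae_eq D f g : mset D -> mfun2 D f -> mfun2 D g ->
  {ae leb, forall x, D x -> f x = g x} ->
  \int[leb]_(x in D) f x = \int[leb]_(x in D) g x.
Proof.
move=> mD mf mg fg; rewrite /Rintegral; congr fine.
apply: ae_eq_integral => //; [exact/measurable_EFinP|exact/measurable_EFinP|].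
by apply: ae2W fg => x h Dx; rewrite /= h.
Qed.

Lemma locally_integrable2B D f g : locally_integrable2 D f ->
  locally_integrable2 D g -> locally_integrable2 D (fun x => f x - g x).
Proof.
move=> lf lg A cA AD; have mA := compact_measurable2 cA.
exact: (@integrableB _ _ _ leb A mA (EFin \o f) (EFin \o g) (lf A cA AD) (lg A cA AD)).
Qed.

Lemma ae_eq_of_test D f g : open D ->
  locally_integrable2 D f -> locally_integrable2 D g ->
  (forall psi, test_fun D psi ->
    \int[leb]_(x in D) (f x * psi x) = \int[leb]_(x in D) (g x * psi x)) ->
  {ae leb, forall x, D x -> f x = g x}.
Proof.
move=> oD lf lg fg; have mD := open_measurable2 oD.
have := @du_bois_reymond R D (fun x => f x - g x) oD
  (locally_integrable2B lf lg).
have h psi : test_fun D psi -> \int[leb]_(x in D) ((f x - g x) * psi x) = 0.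
  move=> tp; under eq_Rintegral do rewrite mulrBl.
  rewrite RintegralB//; first by rewrite fg// subrr.
    exact: integrable_mul_test.
  exact: integrable_mul_test.
by move=> /(_ h); apply: ae2W => x hx Dx; apply/eqP; rewrite -subr_eq0 hx.
Qed.

Lemma wgrad_unique D S G1 G2 : open D -> is_wgrad D S G1 -> is_wgrad D S G2 ->
  {ae leb, forall x, D x -> G1 x = G2 x}.
Proof.
move=> oD [_ [b11 b12] [l11 l12] t1] [_ [b21 b22] [l21 l22] t2].
have h1 : {ae leb, forall x, D x -> (G1 x).1 = (G2 x).1}.
  apply: ae_eq_of_test => // psi tp.
  by apply: oppr_inj; rewrite -(t1 _ tp).1 -(t2 _ tp).1.
have h2 : {ae leb, forall x, D x -> (G1 x).2 = (G2 x).2}.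
  apply: ae_eq_of_test => // psi tp.
  by apply: oppr_inj; rewrite -(t1 _ tp).2 -(t2 _ tp).2.
apply: ae2W (ae2_and h1 h2) => x [e1 e2] Dx.
by rewrite (surjective_pairing (G1 x)) e1// e2// -surjective_pairing.
Qed.

(** [wgrad] is an arbitrary choice. Existence of [G] makes the choice a weak gradient instead of the
    default value, and uniqueness identifies it with [G]. *)
Lemma wgrad_ae_eq D S G : open D -> is_wgrad D S G ->
  is_wgrad D S (wgrad D S) /\ {ae leb, forall x, D x -> wgrad D S x = G x}.
Proof.
move=> oD wG; have w : is_wgrad D S (wgrad D S).
  by rewrite /wgrad; apply: (@xgetPex _ _ [set G | is_wgrad D S G]); exists G.
by split => //; exact: wgrad_unique wG.
Qed.

Lemma wdiv_ae_eq D v d : open D -> is_wdiv D v d ->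
  is_wdiv D v (wdiv D v) /\ {ae leb, forall x, D x -> wdiv D v x = d x}.
Proof.
move=> oD wd; have w : is_wdiv D v (wdiv D v).
  by rewrite /wdiv; apply: (@xgetPex _ _ [set d | is_wdiv D v d]); exists d.
split => //; case: w => _ b1 l1 t1; case: wd => _ b2 l2 t2.
apply: ae_eq_of_test => // psi tp.
by apply: oppr_inj; rewrite -(t1 _ tp) -(t2 _ tp).
Qed.

Lemma Lp_cont_supp D A f (q : R) : 0 < q -> mset D -> compact A -> A `<=` D ->
  continuous f -> (forall x, ~ A x -> f x = 0) -> Lp D q f.
Proof.
move=> q0 mD cA AD cf f0; have mA := compact_measurable2 cA.
have bf := continuous_borel cf; apply/(LpP _ _ mD); split => //.
have -> : nLp D q f = nLp A q f by rewrite /nLp (patch_off AD f0).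
have [M hM] := compact_norm_bound cA cf.
have Afin := compact_leb2_lty cA.
have := @nLp_bound R A q `|M| (fine (leb A)) f q0 (normr_ge0 _) mA (borel_mfun2 bf).
rewrite fineK ?ge0_fin_numE// => /(_ (lexx _)) h.
apply: (le_lt_trans (h _)); last exact: ltry.
by apply: nearW => x Ax; apply: (le_trans (hM _ Ax)); exact: ler_norm.
Qed.

Lemma test_fun_Lp D psi (q : R) : 0 < q -> mset D -> test_fun D psi -> Lp D q psi.
Proof.
by move=> q0 mD [cp [A [cA AD p0]]]; exact: Lp_cont_supp (cp 0%N) p0.
Qed.

Lemma LpZ D f (q c : R) : 0 < q -> mset D -> Lp D q f -> Lp D q (fun x => c * f x).
Proof.
move=> q0 mD /(LpP _ _ mD)[bf hf]; apply/(LpP _ _ mD); split.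
  by apply: measurable_funM => //; exact: measurable_cst.
rewrite nLpZ//; last exact: borel_mfun2.
by rewrite lte_mul_pinfty// nLp_ge0.
Qed.

Lemma LpD D f g (q : R) : 1 <= q -> mset D -> Lp D q f -> Lp D q g ->
  Lp D q (fun x => f x + g x).
Proof.
move=> q1 mD /(LpP _ _ mD)[bf hf] /(LpP _ _ mD)[bg hg]; apply/(LpP _ _ mD); split.
  exact: measurable_funD.
apply: (le_lt_trans (nLpD q1 mD (borel_mfun2 bf) (borel_mfun2 bg))).
exact: lte_add_pinfty.
Qed.

Lemma Lp_ae_eq D f g (q : R) : 0 < q -> mset D -> borel_fun f -> Lp D q g ->
  {ae leb, forall x, D x -> f x = g x} -> Lp D q f.
Proof.
move=> q0 mD bf /(LpP _ _ mD)[bg hg] fg; apply/(LpP _ _ mD); split => //.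
by rewrite (nLp_ae_eq q0 mD (borel_mfun2 bf) (borel_mfun2 bg) fg).
Qed.

Lemma Lp2_integrableM D f g : mset D -> Lp D 2 f -> Lp D 2 g ->
  leb.-integrable D (EFin \o (fun x => f x * g x)).
Proof.
move=> mD /(LpP _ _ mD)[bf hf] /(LpP _ _ mD)[bg hg].
have h := @nLp_hoelder1 R D 2 2 f g (ltr0n _ _) (ltr0n _ _) _ mD (borel_mfun2 bf) (borel_mfun2 bg).
apply/integrableP; split.
  by apply/measurable_EFinP; apply: mfun2M; exact: borel_mfun2.
rewrite -nLp1E; apply: (le_lt_trans (h _)); first by field.
by rewrite lte_mul_pinfty ?nLp_ge0// ge0_fin_numE ?nLp_ge0.
Qed.

Lemma dirder_test D e psi : test_fun D psi ->
  exists A, [/\ compact A, A `<=` D, continuous (dirder e psi) &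
    forall x, ~ A x -> dirder e psi x = 0].
Proof.
move=> tp; have [c1 [A [cA AD a0]]] := test_fun_pd1 tp.
have [c2 [B [cB BD b0]]] := test_fun_pd2 tp.
exists (A `|` B); split.
- exact: compactU.
- by move=> x [/AD|/BD].
- move=> x; apply: (@continuousD _ _ _ (fun x => e.1 * pd1 psi x) (fun x => e.2 * pd2 psi x)).
    by apply: continuousM; [exact: cst_continuous|exact: (c1 0%N)].
  by apply: continuousM; [exact: cst_continuous|exact: (c2 0%N)].
- by move=> x /not_orP[xA xB]; rewrite /dirder a0// b0// !mulr0 addr0.
Qed.

Lemma dirder_Lp D e psi (q : R) : 0 < q -> mset D -> test_fun D psi ->
  Lp D q (dirder e psi).
Proof.
move=> q0 mD tp; have [A [cA AD cd d0]] := dirder_test e tp.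
exact: Lp_cont_supp cd d0.
Qed.

Lemma dirder_continuous D e psi : test_fun D psi -> continuous (dirder e psi).
Proof. by move=> /(dirder_test e) [A []]. Qed.

Definition field e psi : plane R -> plane R := fun x => smul (psi x) e.

Lemma is_wdiv_field D e psi : open D -> test_fun D psi ->
  is_wdiv D (field e psi) (dirder e psi).
Proof.
move=> oD tp; have mD := open_measurable2 oD.
have [cp _] := tp.
split.
- split; rewrite /field /smul /=; apply: continuous_locally_integrable2.
    exact: (continuousM_plane (cp 0%N) (@cst_continuous _ _ e.1)).
  exact: (continuousM_plane (cp 0%N) (@cst_continuous _ _ e.2)).
- exact: continuous_borel (@dirder_continuous D e psi tp).
- exact: continuous_locally_integrable2 (@dirder_continuous D e psi tp).
move=> phi tphi.
have i1 : leb.-integrable D (EFin \o (fun x => psi x * pd1 phi x)).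
  by apply: integrable_mul_test (test_fun_pd1 tphi) => //; exact: continuous_locally_integrable2 (cp 0%N).
have i2 : leb.-integrable D (EFin \o (fun x => psi x * pd2 phi x)).
  by apply: integrable_mul_test (test_fun_pd2 tphi) => //; exact: continuous_locally_integrable2 (cp 0%N).
have j1 : leb.-integrable D (EFin \o (fun x => pd1 psi x * phi x)).
  by apply: integrable_mul_test tphi => //; exact: continuous_locally_integrable2 (test_fun_continuous (test_fun_pd1 tp)).
have j2 : leb.-integrable D (EFin \o (fun x => pd2 psi x * phi x)).
  by apply: integrable_mul_test tphi => //; exact: continuous_locally_integrable2 (test_fun_continuous (test_fun_pd2 tp)).
transitivity (e.1 * \int[leb]_(x in D) (psi x * pd1 phi x) +
   e.2 * \int[leb]_(x in D) (psi x * pd2 phi x)).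
  rewrite -(Rintegral_lin _ _ mD i1 i2).
  by apply: eq_Rintegral => x _; rewrite /dot /field /smul /=; ring.
rewrite (ibp_pd1 mD cp tphi) (ibp_pd2 mD cp tphi) !mulrN -opprD; congr (- _).
rewrite -(Rintegral_lin _ _ mD j1 j2).
by apply: eq_Rintegral => x _; rewrite /dirder; ring.
Qed.

(** The boundary condition against [phi] in H^1 is the definition of the weak gradient of [phi]
    tested with [psi], combined over the two components of [e]. *)
Lemma Hdiv0_field D e psi : open D -> test_fun D psi -> Hdiv0 D (field e psi).
Proof.
move=> oD tp; have mD := open_measurable2 oD.
have [wv aev] := wdiv_ae_eq oD (is_wdiv_field e oD tp).
have bd : borel_fun (wdiv D (field e psi)) by case: wv.
have Lw : Lp D 2 (wdiv D (field e psi)).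
  by apply: Lp_ae_eq aev => //; exact: dirder_Lp.
split => //.
  split; rewrite /field /smul /=.
    rewrite (_ : (fun x => _) = fun x => e.1 * psi x); last by apply/funext => x; rewrite mulrC.
    by apply: LpZ => //; exact: test_fun_Lp.
  rewrite (_ : (fun x => _) = fun x => e.2 * psi x); last by apply/funext => x; rewrite mulrC.
  by apply: LpZ => //; exact: test_fun_Lp.
move=> phi [Lphi [lphi [b1 b2] [l1 l2] tphi] _].
have bphi : borel_fun phi by case: Lphi.
have [t1 t2] := tphi _ tp.
have i1 : leb.-integrable D (EFin \o (fun x => phi x * pd1 psi x)).
  exact: integrable_mul_test (test_fun_pd1 tp).
have i2 : leb.-integrable D (EFin \o (fun x => phi x * pd2 psi x)).
  exact: integrable_mul_test (test_fun_pd2 tp).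
have j1 : leb.-integrable D (EFin \o (fun x => (wgrad D phi x).1 * psi x)).
  exact: integrable_mul_test tp.
have j2 : leb.-integrable D (EFin \o (fun x => (wgrad D phi x).2 * psi x)).
  exact: integrable_mul_test tp.
have bpsi := continuous_borel (test_fun_continuous tp).
have md : mfun2 D (fun x => dot (field e psi x) (wgrad D phi x)).
  rewrite /dot /field /smul /=; apply: mfun2D; apply: mfun2M.
  - by apply: mfun2M; [exact: borel_mfun2|exact: mfun2_cst].
  - exact: borel_mfun2.
  - by apply: mfun2M; [exact: borel_mfun2|exact: mfun2_cst].
  - exact: borel_mfun2.
rewrite (@Rintegral_ae_eq _ _ (fun x => dot (field e psi x) (wgrad D phi x) +
   dirder e psi x * phi x))//.
- rewrite (_ : \int[leb]_(x in D) _ = e.1 * (\int[leb]_(x in D) ((wgrad D phi x).1 * psi x) +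
      \int[leb]_(x in D) (phi x * pd1 psi x)) +
      e.2 * (\int[leb]_(x in D) ((wgrad D phi x).2 * psi x) +
      \int[leb]_(x in D) (phi x * pd2 psi x))).
    by rewrite t1 t2 !subrr !mulr0 addr0.
  rewrite -!RintegralD// -Rintegral_lin//; [|exact: rintegrableD..].
  by apply: eq_Rintegral => x _; rewrite /dot /field /smul /dirder /=; ring.
- by apply: mfun2D => //; apply: mfun2M; exact: borel_mfun2.
- apply: mfun2D => //; apply: mfun2M; apply: borel_mfun2 => //.
  exact: continuous_borel (@dirder_continuous D e psi tp).
- by apply: ae2W aev => x h Dx; rewrite h.
Qed.

End WeakDerivatives.

(** * Null sets and functions constant almost everywhere *)

Section NullSets.
Variable R : realType.
Implicit Types (x : plane R) (D A U : set (plane R)) (f g psi phi S : plane R -> R).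
Local Notation leb := (leb2 R).
Local Notation mset D := (measurable (D : set (mplane R))).

Lemma continuous_dotr (a : plane R) : continuous (fun x : plane R => dot a x).
Proof.
move=> x; apply: (@continuousD _ _ _ (fun x : plane R => a.1 * x.1) (fun x : plane R => a.2 * x.2)).
  by apply: continuousM; [exact: cst_continuous|exact: cvg_fst].
by apply: continuousM; [exact: cst_continuous|exact: cvg_snd].
Qed.

(** A nonvertical line meets each vertical line in one point; a vertical line is a product with a
    null factor, and 0 times +oo is 0. *)
Lemma line_null (a : plane R) (c : R) : a != 0 -> leb [set x | dot a x = c] = 0.
Proof.
move=> a0; set A := [set x | dot a x = c].
have [a2|a2] := eqVneq a.2 0.
  have a1 : a.1 != 0.
    apply/eqP => a1; move/eqP: a0; apply; rewrite (surjective_pairing a) a1 a2.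
    by [].
  have -> : A = [set c / a.1] `*` setT.
    apply/seteqP; split => x; rewrite /A /dot /= a2 mul0r addr0.
      by move=> <-; split => //; field.
    by move=> [-> _]; field.
  move: (c / a.1) => d; pose mu := @lebesgue_measure R.
  have h : leb ([set d] `*` setT) = (mu [set d] * mu setT)%E.
    by apply: product_measure1E => //; exact: measurable_set1.
  by rewrite h /mu lebesgue_measure_set1 mul0e.
have -> : leb A = (\int[@lebesgue_measure R]_x (@lebesgue_measure R (xsection A x)))%E by [].
apply: integral0_eq => x _.
rewrite (_ : xsection A x = [set (c - a.1 * x) / a.2]) ?lebesgue_measure_set1//.
apply/seteqP; split => y; rewrite /xsection /= ?inE /A /dot /=.
  by move=> <-; field.
by move=> ->; field.
Qed.

Lemma open_not_null U (P : plane R -> Prop) : open U -> U !=set0 ->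
  {ae leb, forall x, P x} -> exists2 x, U x & P x.
Proof.
move=> oU [x0 Ux0] [N [mN N0 hN]]; apply: contrapT => h.
have [e e0 eU] := open_boxcP oU Ux0.
have sub : boxc x0 e `<=` N.
  by move=> x /eU Ux; apply: hN => Px; apply: h; exists x.
have : (leb (boxc x0 e) <= leb N)%E.
  by apply: le_measure => //; rewrite inE//; exact: measurable_boxc.
have n0 : leb N = 0 := N0.
rewrite n0 (leb2_boxc _ (ltW e0)) lee_fin leNgt => /negP; apply.
by rewrite mulr_gt0// exprn_gt0.
Qed.

Lemma ae_eq_continuous_at U f g z : open U -> U z -> {for z, continuous f} ->
  {for z, continuous g} -> {ae leb, forall x, U x -> f x = g x} -> f z = g z.
Proof.
move=> oU Uz cf cg fg; apply/eqP; rewrite -subr_eq0; apply/negP => /negP fgz.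
have c : {for z, continuous (fun x => f x - g x)} by apply: continuousB.
have h : nbhs z [set x | f x - g x != 0].
  have oV : open [set y : R | y != 0] by exact: open_neq.
  exact: c _ (open_nbhs_nbhs (conj oV fgz)).
pose V := interior [set x | f x - g x != 0] `&` U.
have oV : open V by apply: openI => //; exact: open_interior.
have V0 : V !=set0 by exists z; split.
have [x [Vx1 Vx2] hx] := open_not_null oV V0 fg.
by have /= := interior_subset Vx1; rewrite hx// subrr eqxx.
Qed.

(** Meant for the discrete pressure, constant almost everywhere on a triangle. The integral of a
    derivative of a test function is 0, by integration by parts against the constant 1. *)
Lemma is_wgrad_const_ae U f (c : R) : open U -> borel_fun f ->
  {ae leb, forall x, U x -> f x = c} -> is_wgrad U f (fun=> 0).
Proof.
move=> oU bf fc; have mU := open_measurable2 oU.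
have lf : locally_integrable2 U f.
  move=> A cA AU; have mA := compact_measurable2 cA.
  have Afin := compact_leb2_lty cA.
  have h := @nLp_bound R A 1 `|c| (fine (leb A)) f ltr01 (normr_ge0 _) mA (borel_mfun2 bf).
  have [|//] := @nLp1_integrable R A f (`|c| * fine (leb A) `^ 1^-1) mA (borel_mfun2 bf).
  apply: h; first by rewrite fineK ?ge0_fin_numE.
  by apply: ae2W fc => x h Ax; rewrite h//; exact: AU.
have b0 : borel_fun (fun=> 0 : R) by exact: measurable_cst.
have l0 : locally_integrable2 U (fun=> 0 : R).
  exact/continuous_locally_integrable2/cst_continuous.
split => //.
have C1 n : Ck n (cst (1 : R) : plane R -> R).
  have -> : cst (1 : R) = tens (cst 1) (cst 1) by apply/funext => x; rewrite /tens /= mulr1.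
  by apply: Ck_tens => k; exact: Cn_cst.
have p1 x : pd1 (cst (1 : R)) x = 0 by rewrite /pd1 derive1_cst.
have p2 x : pd2 (cst (1 : R)) x = 0 by rewrite /pd2 derive1_cst.
have z0 (h : plane R -> R) : \int[leb]_(x in U) (0 * h x) = 0.
  by under eq_Rintegral do rewrite mul0r; rewrite Rintegral_cst// mul0r.
have key (h : plane R -> R) : continuous h -> rintegrable U h -> \int[leb]_(x in U) h x = 0 ->
    \int[leb]_(x in U) (f x * h x) = 0.
  move=> ch jh h0; rewrite (@Rintegral_ae_eq _ _ _ (fun x => c * h x))//.
  - by rewrite RintegralZl// h0 mulr0.
  - by apply: mfun2M; apply: borel_mfun2 => //; exact: continuous_borel.
  - by apply: mfun2M; [exact: mfun2_cst|exact: borel_mfun2 (continuous_borel ch)].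
  - by apply: ae2W fc => x h' Ux; rewrite h'.
have l1 : locally_integrable2 U (cst (1 : R)) by exact/continuous_locally_integrable2/cst_continuous.
move=> phi tphi; split; rewrite z0 oppr0; apply: key.
- exact: test_fun_continuous (test_fun_pd1 tphi).
- apply: (eq_rintegrable _ (integrable_mul_test mU l1 (test_fun_pd1 tphi))) => x.
  by rewrite /= mul1r.
- have := ibp_pd1 mU C1 tphi; under eq_Rintegral do rewrite mul1r; move=> ->.
  by under eq_Rintegral do rewrite p1; rewrite z0 oppr0.
- exact: test_fun_continuous (test_fun_pd2 tphi).
- apply: (eq_rintegrable _ (integrable_mul_test mU l1 (test_fun_pd2 tphi))) => x.
  by rewrite /= mul1r.
- have := ibp_pd2 mU C1 tphi; under eq_Rintegral do rewrite mul1r; move=> ->.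
  by under eq_Rintegral do rewrite p2; rewrite z0 oppr0.
Qed.

End NullSets.

(** * Positivity of the norm of the point evaluation *)

Section PointEvaluation.
Variable R : realType.
Implicit Types (x z : plane R) (D A U : set (plane R)) (f g psi phi S : plane R -> R).
Local Notation leb := (leb2 R).
Local Notation mset D := (measurable (D : set (mplane R))).

Lemma enorm_ge0 (v : plane R) : 0 <= enorm v.
Proof. exact: sqrtr_ge0. Qed.

Lemma enormE (v : plane R) : enorm v ^+ 2 = v.1 ^+ 2 + v.2 ^+ 2.
Proof. by rewrite /enorm sqr_sqrtr /dot -?expr2// addr_ge0// sqr_ge0. Qed.

Lemma enorm_ge1 (v : plane R) : `|v.1| <= enorm v.
Proof.
rewrite -(@ler_pXn2r _ 2)// ?nnegrE ?enorm_ge0// enormE real_normK ?num_real//.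
by rewrite lerDl sqr_ge0.
Qed.

Lemma enorm_ge2 (v : plane R) : `|v.2| <= enorm v.
Proof.
rewrite -(@ler_pXn2r _ 2)// ?nnegrE ?enorm_ge0// enormE real_normK ?num_real//.
by rewrite lerDr sqr_ge0.
Qed.

Lemma enorm_le (v : plane R) : enorm v <= `|v.1| + `|v.2|.
Proof.
rewrite -(@ler_pXn2r _ 2)// ?nnegrE ?enorm_ge0 ?addr_ge0// enormE sqrrD.
rewrite !real_normK ?num_real//.
have := mulr_ge0 (normr_ge0 v.1) (normr_ge0 v.2); lra.
Qed.

Lemma enorm_eq0 (v : plane R) : enorm v = 0 -> v = 0.
Proof.
move=> v0; have := enorm_ge1 v; have := enorm_ge2 v; rewrite v0 !normr_le0.
by move=> /eqP v2 /eqP v1; rewrite (surjective_pairing v) v1 v2.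
Qed.

Lemma mfun2_enorm D (v : plane R -> plane R) : mfun2 D (fun x => (v x).1) ->
  mfun2 D (fun x => (v x).2) -> mfun2 D (fun x => enorm (v x)).
Proof.
move=> m1 m2; apply: (@mfun2_comp _ _ _ (@Num.sqrt R)); first exact: sqrt_continuous.
by apply: mfun2D; apply: mfun2M.
Qed.

Lemma mfun2_norm D f : mfun2 D f -> mfun2 D (fun x => `|f x|).
Proof. by apply: mfun2_comp; exact: norm_continuous. Qed.

Lemma nLp_norm D f (q : R) : 0 < q -> nLp D q (fun x => `|f x|) = nLp D q f.
Proof.
move=> q0; rewrite !(nLpE _ _ q0); apply: (congr1 (fun y => (y `^ q^-1)%E)).
by apply: eq_integral => x _; rewrite normr_id.
Qed.

Lemma nLpv_le D (v : plane R -> plane R) (q : R) : 1 <= q -> mset D ->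
  mfun2 D (fun x => (v x).1) -> mfun2 D (fun x => (v x).2) ->
  (nLpv D q v <= nLp D q (fun x => (v x).1) + nLp D q (fun x => (v x).2))%E.
Proof.
move=> q1 mD m1 m2; have q0 : 0 < q by exact: lt_le_trans q1.
rewrite -(nLp_norm D (fun x => (v x).1) q0) -(nLp_norm D (fun x => (v x).2) q0).
apply: le_trans (nLpD q1 mD (mfun2_norm m1) (mfun2_norm m2)).
apply: nLp_le => //; first exact: mfun2_enorm.
  by apply: mfun2D; exact: mfun2_norm.
by apply: nearW => x _; rewrite (ger0_norm (enorm_ge0 _)) (ger0_norm (addr_ge0 _ _))//; exact: enorm_le.
Qed.

Lemma is_wgrad_test D psi : open D -> test_fun D psi ->
  is_wgrad D psi (fun x => (pd1 psi x, pd2 psi x)).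
Proof.
move=> oD tp; have mD := open_measurable2 oD.
have c1 := test_fun_continuous (test_fun_pd1 tp).
have c2 := test_fun_continuous (test_fun_pd2 tp).
split.
- exact: continuous_locally_integrable2 (test_fun_continuous tp).
- by split; [exact: (continuous_borel c1)|exact: (continuous_borel c2)].
- by split; [exact: (continuous_locally_integrable2 c1)|exact: (continuous_locally_integrable2 c2)].
- by case: tp => cp _ phi tphi; split; [exact: ibp_pd1|exact: ibp_pd2].
Qed.

Lemma W1p0_test D psi (q : R) : 1 <= q -> open D -> test_fun D psi ->
  W1p0 D q psi /\ {ae leb, forall x, D x -> wgrad D psi x = (pd1 psi x, pd2 psi x)}.
Proof.
move=> q1 oD tp; have mD := open_measurable2 oD; have q0 : 0 < q by exact: lt_le_trans q1.
have [wG aeG] := wgrad_ae_eq oD (is_wgrad_test oD tp).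
have [_ [b1 b2] _ _] := wG.
have c1 := test_fun_continuous (test_fun_pd1 tp).
have c2 := test_fun_continuous (test_fun_pd2 tp).
split => //; split.
  split; [exact: test_fun_Lp|by []|split].
    apply: (@Lp_ae_eq _ _ _ (pd1 psi)) => //; first exact: test_fun_Lp (test_fun_pd1 tp).
    by apply: ae2W aeG => x h Dx; rewrite h.
  apply: (@Lp_ae_eq _ _ _ (pd2 psi)) => //; first exact: test_fun_Lp (test_fun_pd2 tp).
  by apply: ae2W aeG => x h Dx; rewrite h.
have n0 : nLp D q (fun=> 0) = 0%E.
  apply/eqP; rewrite eq_le nLp_ge0 andbT.
  have := @nLpZ R D q 0 (fun=> 0) q0 mD (@mfun2_cst R D 0).
  by rewrite normr0 mul0e => <-; rewrite le_eqVlt; apply/orP; left; apply/eqP; apply: nLp_eq => // x _; rewrite mulr0.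
exists (fun=> psi); split => //.
  rewrite (_ : (fun n => _) = fun=> 0%E); first exact: cvg_cst.
  by apply/funext => n; rewrite -n0; apply: nLp_eq => // x _; rewrite subrr.
rewrite (_ : (fun n => _) = fun=> 0%E); first exact: cvg_cst.
apply/funext => n; rewrite -n0; apply: nLp_ae_eq => //.
- apply: mfun2_enorm.
    by apply: mfun2B; apply: borel_mfun2; [exact: b1|exact: (continuous_borel c1)].
  by apply: mfun2B; apply: borel_mfun2; [exact: b2|exact: (continuous_borel c2)].
- exact: mfun2_cst.
- apply: ae2W aeG => x h Dx; rewrite h// subrr.
  by rewrite /enorm /dot /= mulr0 addr0 sqrtr0.
Qed.

(** [delta] evaluates a chosen continuous representative; two functions continuous at [z] and equal
    almost everywhere agree there. *)
Lemma delta_continuous D z S : open D -> D z -> continuous S -> delta D z S = S z.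
Proof.
move=> oD Dz cS; rewrite /delta; set P := [set g | _].
have PS : P S by split; [by move=> x _; exact: cS|exact: nearW].
have [Pc Pae] : P (xget (cst 0) P) by apply: (@xgetPex _ _ P); exists S.
exact: ae_eq_continuous_at Dz (Pc z Dz) (cS z) Pae.
Qed.

(** A bump [S] with S(z) = 1 gives the lower bound, one over the norm of its gradient. That norm
    must be finite and nonzero, as [fine] of +oo and division by 0 both give 0. A real [d] is
    produced because the dual norm is extended-valued. *)
Lemma delta_norm_gt0 D z (q : R) : 1 <= q -> open D -> D z ->
  exists2 d : R, 0 < d & (d%:E <= delta_norm D z q)%E.
Proof.
move=> q1 oD Dz; have mD := open_measurable2 oD; have q0 : 0 < q by exact: lt_le_trans q1.
have [s s0 sD] := open_boxcP oD Dz.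
pose F t := cutoff s^-1 (z.1 - s) (z.1 + s) t.
pose G t := cutoff s^-1 (z.2 - s) (z.2 + s) t.
pose S := tens F G.
have sF : smooth1 F by exact: smooth_cutoff.
have sG : smooth1 G by exact: smooth_cutoff.
have tS : test_fun D S.
  apply: (test_fun_tens sF sG _ _ sD) => t /negP ht; apply: cutoff_off; rewrite ?invr_ge0 ?(ltW s0)//.
    by apply/negP => /andP[t1 t2]; apply: ht; rewrite !ltW.
  by apply/negP => /andP[t1 t2]; apply: ht; rewrite !ltW.
have F1 : F z.1 = 1 by exact: cutoff_center.
have G1 : G z.2 = 1 by exact: cutoff_center.
have Sz : S z = 1 by rewrite /S /tens F1 G1 mulr1.
have cS := test_fun_continuous tS.
have [WS aeG] := W1p0_test q1 oD tS.
have [[_ wG [L1 L2]] _] := WS; have [_ [b1 b2] _ _] := wG.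
have me : mfun2 D (fun x => enorm (wgrad D S x)).
  by apply: mfun2_enorm; exact: borel_mfun2.
set n := nLpv D q (wgrad D S).
have nfin : (n < +oo)%E.
  move/(LpP _ _ mD) : L1 => [_ h1]; move/(LpP _ _ mD) : L2 => [_ h2].
  apply: le_lt_trans (nLpv_le q1 mD (borel_mfun2 b1) (borel_mfun2 b2)) _.
  exact: lte_add_pinfty.
(* If the norm were 0, the continuous function [pd1 S] would vanish on [D]; along the horizontal
   segment ending at [z], [F] would be constant while it goes from 0 to 1. *)
have n0 : n != 0%E.
  apply/eqP => n0.
  have g0 : {ae leb, forall x, D x -> pd1 S x = 0}.
    have := @Lnorm_eq0_eq0 _ _ _ leb (EFin \o ((fun x => enorm (wgrad D S x)) \_ D)) q%:E.
    have m : measurable_fun setT (EFin \o ((fun x => enorm (wgrad D S x)) \_ D)).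
      by apply/measurable_EFinP; exact: mfun2_patch.
    move=> /(_ m); rewrite lte_fin q0 => /(_ isT n0) h.
    apply: ae2W (ae2_and h aeG) => x [/= h1 h2] Dx.
    have [] := h1 I; rewrite /patch mem_set// => /enorm_eq0 e0.
    by have := h2 Dx; rewrite e0 => -[<- _].
  have p0 x : D x -> pd1 S x = 0.
    move=> Dx; apply: (ae_eq_continuous_at oD Dx _ _ g0).
      exact: (test_fun_continuous (test_fun_pd1 tS)).
    exact: cst_continuous.
  have dF t : z.1 - s <= t <= z.1 -> derive1 F t = 0.
    move=> ht; have := p0 (t, z.2); rewrite /S pd1_tens; last exact: (sF 1%N).1.
    rewrite /tens /= G1 mulr1; apply; apply: sD; apply/boxcP => /=.
    by rewrite subrr normr0; split; [rewrite ler_distl; move: ht => /andP[]; lra|exact: ltW].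
  have zs : z.1 - s < z.1 by rewrite ltrBlDr ltrDl.
  have := FTC_is_derive zs (smooth1_is_derive sF) (smooth1_continuous (smooth1_derive sF)).
  rewrite integral0_eq; last first.
    by move=> t /=; rewrite in_itv /= => /dF ->.
  rewrite F1 /F cutoff_off ?invr_ge0 ?(ltW s0) ?ltxx// subr0 => -[] /eqP.
  by rewrite eq_sym oner_eq0.
have fn : 0 < fine n by rewrite fine_gt0// nfin andbT lt0e n0 nLp_ge0.
exists (fine n)^-1; first by rewrite invr_gt0.
apply: ereal_sup_ubound; right; exists S; last first.
  by rewrite delta_continuous// Sz normr1 div1r.
split => // S0; have := @ae_eq_continuous_at _ _ S (fun=> 0) z oD Dz (cS z) (@cst_continuous _ _ _ z) S0.
by rewrite Sz => /eqP; rewrite oner_eq0.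
Qed.

End PointEvaluation.

(** * The momentum equation tested with smooth fields *)

Section Momentum.
Variable R : realType.
Implicit Types (x e : plane R) (D A : set (plane R)) (g psi phi : plane R -> R).
Local Notation leb := (leb2 R).
Local Notation mset D := (measurable (D : set (mplane R))).

Lemma Lp_le D (q M : R) f g : 0 < q -> 0 <= M -> mset D -> borel_fun f -> Lp D q g ->
  (forall x, `|f x| <= M * `|g x|) -> Lp D q f.
Proof.
move=> q0 M0 mD bf /(LpP _ _ mD)[bg hg] fg; apply/(LpP _ _ mD); split => //.
apply: (@le_lt_trans _ _ (M%:E * nLp D q g)%E).
  by apply: nLp_leZ => //; [exact: borel_mfun2|exact: borel_mfun2|apply: nearW => x _].
by rewrite lte_mul_pinfty// nLp_ge0.
Qed.

Lemma Lpv_dot D (v : plane R -> plane R) e (q : R) : 1 <= q -> mset D -> Lpv D q v ->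
  Lp D q (fun x => dot (v x) e).
Proof.
move=> q1 mD [L1 L2]; have q0 : 0 < q by exact: lt_le_trans q1.
apply: LpD => //.
  rewrite (_ : (fun x => _) = fun x => e.1 * (v x).1); first exact: LpZ.
  by apply/funext => x; rewrite mulrC.
rewrite (_ : (fun x => _) = fun x => e.2 * (v x).2); first exact: LpZ.
by apply/funext => x; rewrite mulrC.
Qed.

Variables (D : set (plane R)) (nu : R -> R) (N : R).
Variables (f u : plane R -> plane R) (pr T : plane R -> R).
Hypotheses (oD : open D) (cnu : continuous nu) (nuN : forall s, `|nu s| <= N).
Hypotheses (Lf : Lpv D 2 f) (Lu : Lpv D 2 u) (Lpr : Lp D 2 pr) (bT : borel_fun T).
Hypothesis mom : forall v, Hdiv0 D v ->
  \int[leb]_(x in D) (nu (T x) * dot (u x) (v x) - pr x * wdiv D v x) =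
  \int[leb]_(x in D) dot (f x) (v x).

Lemma momentum_test psi e : test_fun D psi ->
  \int[leb]_(x in D) (dot (f x - smul (nu (T x)) (u x)) e * psi x) =
  - \int[leb]_(x in D) (pr x * dirder e psi x).
Proof.
move=> tp; have mD := open_measurable2 oD.
have N0 : 0 <= N by apply: le_trans (nuN 0).
have bpsi := continuous_borel (test_fun_continuous tp).
have bnuT : borel_fun (fun x => nu (T x)) by exact: (mfun2_comp cnu bT).
have Lpsi : Lp D 2 psi by exact: test_fun_Lp.
have Lnpsi : Lp D 2 (fun x => nu (T x) * psi x).
  apply: (@Lp_le _ _ N _ psi) => //; first exact: measurable_funM.
  by move=> x; rewrite normrM ler_wpM2r.
have Lue := Lpv_dot e (ler1n _ 2) mD Lu; have Lfe := Lpv_dot e (ler1n _ 2) mD Lf.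
have iu := Lp2_integrableM mD Lue Lnpsi.
have jf := Lp2_integrableM mD Lfe Lpsi.
have Ldd := dirder_Lp e (ltr0n R 2) mD tp.
have ip := Lp2_integrableM mD Lpr Ldd.
have [wv aev] := wdiv_ae_eq oD (is_wdiv_field e oD tp).
have bw : borel_fun (wdiv D (field e psi)) by case: wv.
have := mom (Hdiv0_field e oD tp).
have e1 : \int[leb]_(x in D) (nu (T x) * dot (u x) (field e psi x) - pr x * wdiv D (field e psi) x)
  = \int[leb]_(x in D) (dot (u x) e * (nu (T x) * psi x) - pr x * dirder e psi x).
  have bp : borel_fun pr by case: Lpr.
  have bu1 : borel_fun (fun x => (u x).1) by case: Lu => -[].
  have bu2 : borel_fun (fun x => (u x).2) by case: Lu => _ [].
  apply: Rintegral_ae_eq => //.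
  - apply: mfun2B; apply: mfun2M; try exact: borel_mfun2.
    rewrite /dot /field /smul /=; apply: mfun2D; apply: mfun2M; try exact: borel_mfun2.
      by apply: mfun2M; [exact: borel_mfun2|exact: mfun2_cst].
    by apply: mfun2M; [exact: borel_mfun2|exact: mfun2_cst].
  - by case/integrableP : (rintegrableB mD iu ip) => /measurable_EFinP.
  - by apply: ae2W aev => x h Dx; rewrite h//; rewrite /dot /field /smul /=; ring.
rewrite e1 RintegralB// => e2.
have -> : \int[leb]_(x in D) (dot (f x - smul (nu (T x)) (u x)) e * psi x) =
  \int[leb]_(x in D) (dot (f x) e * psi x - dot (u x) e * (nu (T x) * psi x)).
  by apply: eq_Rintegral => x _; rewrite /dot /smul /=; ring.
rewrite RintegralB//.
have -> : \int[leb]_(x in D) (dot (f x) e * psi x) = \int[leb]_(x in D) dot (f x) (field e psi x).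
  by apply: eq_Rintegral => x _; rewrite /dot /field /smul /=; ring.
by rewrite -e2; ring.
Qed.

End Momentum.

(** * Lipschitz domains and the interior of their closure *)

Section LipschitzDomain.
Variable R : realType.
Implicit Types (x y e : plane R) (D : set (plane R)).

Lemma enorm_sub_ball (x : plane R) (r : R) y : `|y.1 - x.1| <= r -> `|y.2 - x.2| <= r ->
  enorm (y - x) <= 2 * r.
Proof. by move=> h1 h2; apply: (le_trans (enorm_le _)) => /=; lra. Qed.

Lemma dot_le (a b : plane R) : `|dot a b| <= enorm a * enorm b.
Proof.
rewrite -(@ler_pXn2r _ 2)// ?nnegrE ?mulr_ge0 ?enorm_ge0//.
rewrite exprMn !enormE real_normK ?num_real// /dot.
have := sqr_ge0 (a.1 * b.2 - a.2 * b.1); rewrite !expr2; lra.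
Qed.

(* A Lipschitz domain lies locally on one side of its boundary. *)
Lemma interior_closure_lipschitz D : open D -> lipschitz_boundary D ->
  interior (closure D) `<=` D.
Proof.
move=> oD lD x xi; apply: contrapT => nDx.
have bx : bdry D x by split; [exact: interior_subset xi|move/interior_subset].
have [e [r [s [L [phi [e1 r0 s0 [phi0 phiL] hD]]]]]] := lD x bx.
have [d d0 dD] := open_boxcP (@open_interior _ _) xi.
have ee : e.1 ^+ 2 + e.2 ^+ 2 = 1 by rewrite -enormE e1 expr1n.
have L0 : 0 <= L.
  have := phiL 1 0; rewrite subr0 normr1 mulr1 => /(le_trans (normr_ge0 _)); exact.
(* The point [y] at depth [t] below the boundary point [x] still lies in the closure, so [D] has a
   point [w] within [rho] of it in each coordinate. In local coordinates w = (a, b) with b <= - t/2,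
   while |phi a| <= t/4: this contradicts phi a < b. The three bounds in [rho] below are chosen for
   these estimates. *)
pose t := Num.min (d / 2) (s / 2).
have t0 : 0 < t by rewrite lt_min !divr_gt0.
have td : t <= d / 2 by rewrite ge_min lexx.
have ts : t <= s / 2 by rewrite ge_min lexx orbT.
pose y := x - smul t (perp e).
have e11 : `|e.1| <= 1 by rewrite -e1 enorm_ge1.
have e22 : `|e.2| <= 1 by rewrite -e1 enorm_ge2.
have yx : boxc x d y.
  apply/boxcP; rewrite /y /smul /perp /=.
  rewrite (_ : x.1 - t * - e.2 - x.1 = t * e.2); last by ring.
  rewrite (_ : x.2 - t * e.1 - x.2 = - (t * e.1)); last by ring.
  rewrite normrN !normrM (gtr0_norm t0).
  have := ler_wpM2l (ltW t0) e11; have := ler_wpM2l (ltW t0) e22; lra.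
have yc : closure D y by exact: interior_subset (dD _ yx).
pose rho := Num.min (Num.min (t / 4) (r / 4)) (t / (8 * (L + 1))).
have rho0 : 0 < rho by rewrite !lt_min !divr_gt0 ?mulr_gt0// ltr_wpDl.
have rt : rho <= t / 4 by rewrite !ge_min lexx.
have rr : rho <= r / 4 by rewrite !ge_min lexx orbT.
have rL : L * (2 * rho) <= t / 4.
  have h : rho <= t / (8 * (L + 1)) by rewrite ge_min lexx orbT.
  have L1 : 0 < L + 1 by rewrite ltr_wpDl.
  apply: (@le_trans _ _ ((L + 1) * (2 * rho))).
    by rewrite (mulrDl L 1) lerDl mul1r; lra.
  apply: (@le_trans _ _ ((L + 1) * (2 * (t / (8 * (L + 1)))))).
    by rewrite ler_pM2l// ler_pM2l.
  rewrite le_eqVlt; apply/orP; left; apply/eqP; field; lra.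
have nb : nbhs y (ball y rho) by exact: nbhsx_ballx.
have [w [Dw /ball_planeP[w1 w2]]] := yc _ nb.
pose a := dot (w - x) e; pose b := dot (w - x) (perp e).
have wE : w = x + smul a e + smul b (perp e).
  have fstD (p q : plane R) : (p + q).1 = p.1 + q.1 by [].
  have sndD (p q : plane R) : (p + q).2 = p.2 + q.2 by [].
  rewrite [LHS]surjective_pairing [RHS]surjective_pairing !fstD !sndD.
  rewrite /a /b /dot /smul /perp /=; congr (_, _).
    transitivity (x.1 + (w.1 - x.1) * (e.1 ^+ 2 + e.2 ^+ 2)); last by ring.
    by rewrite ee; ring.
  transitivity (x.2 + (w.2 - x.2) * (e.1 ^+ 2 + e.2 ^+ 2)); last by ring.
  by rewrite ee; ring.
have wy : enorm (w - y) <= 2 * rho.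
  by apply: enorm_sub_ball; rewrite distrC ltW.
have ee' : enorm (perp e) = 1.
  by apply/eqP; rewrite -(@eqrXn2 _ 2)// ?enorm_ge0// enormE /perp /= sqrrN expr1n addrC ee.
have ha : `|a| <= 2 * rho.
  have -> : a = dot (w - y) e by rewrite /a /y /dot /smul /perp /=; ring.
  by apply: (le_trans (dot_le _ _)); rewrite e1 mulr1.
have hb : `|b + t| <= 2 * rho.
  have -> : b + t = dot (w - y) (perp e).
    rewrite /b /y /dot /smul /perp /=.
    rewrite -[in LHS](mulr1 t) -ee; ring.
  by apply: (le_trans (dot_le _ _)); rewrite ee' mulr1.
move: hb; rewrite ler_norml => /andP[hb1 hb2].
have bs : `|b| < s by rewrite ltr_norml; lra.
have ar : `|a| < r by apply: (le_lt_trans ha); lra.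
have := (hD a b ar bs).1; rewrite -wE => /(_ Dw).
have := phiL a 0; rewrite phi0 !subr0 => ha'.
have : `|phi a| <= t / 4.
  by apply: (le_trans ha'); apply: le_trans rL; rewrite ler_wpM2l.
rewrite ler_norml => /andP[p1 p2]; lra.
Qed.

End LipschitzDomain.

(** * Dual functions of polynomials on squares *)

Section Scaling.
Variable R : realType.
Implicit Types (H F G : R -> R) (c s t : R).
Local Notation mu := (@lebesgue_measure R).
Local Notation leb := (leb2 R).

Definition scl H c s t : R := H ((t - c) / s).

Lemma scl_smooth H c s : smooth1 H -> smooth1 (scl H c s).
Proof.
move=> sH; rewrite (_ : scl H c s = fun t => H (s^-1 * t + - (c / s))).
  exact: smooth1_affine.
by apply/funext => t; rewrite /scl mulrBl mulrC.
Qed.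

Lemma scl_derive H c s : smooth1 H -> derive1 (scl H c s) = fun t => s^-1 * scl (derive1 H) c s t.
Proof.
move=> sH; apply/funext => t.
have d : is_derive t 1 (fun x => (x - c) / s) (s^-1 : R).
  have h := is_derive_mulr s^-1 (is_deriveB (is_derive_id t (1 : R)) (is_derive_cst c t 1)).
  by apply: (is_derive_eq h); rewrite subr0 mul1r.
have h := @is_derive1_comp R H (fun x => (x - c) / s) t _ _ (smooth1_is_derive sH _) d.
by rewrite derive1E mulrC; exact: (@derive_val _ _ _ _ _ _ _ h).
Qed.

Lemma scl_off H c s : 0 < s -> (forall t, ~~ (-1 <= t <= 1) -> H t = 0) ->
  forall t, ~~ (c - s <= t <= c + s) -> scl H c s t = 0.
Proof.
move=> s0 H0 t ht; apply: H0; apply: contra ht => /andP[h1 h2].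
by move: h1 h2; rewrite ler_pdivlMr// ler_pdivrMr// => h1 h2; apply/andP; split; lra.
Qed.

Lemma Rintegral_off H a b : (forall t, ~~ (a <= t <= b) -> H t = 0) ->
  \int[mu]_t H t = \int[mu]_(t in `[a, b]) H t.
Proof.
move=> H0; rewrite [RHS]Rintegral_mkcond; apply: eq_Rintegral => t _.
by rewrite /patch; case: ifPn => // /negP; rewrite inE /= in_itv /= => /negP; exact: H0.
Qed.

Lemma integrable_off H a b : continuous H -> (forall t, ~~ (a <= t <= b) -> H t = 0) ->
  mu.-integrable setT (EFin \o H).
Proof.
move=> cH H0; have mI : measurable (`[a, b]%classic : set (measurableTypeR R)).
  exact: measurable_itv.
have := @continuous_compact_integrable R H `[a, b]%classic (@segment_compact _ a b)
  (continuous_subspaceT cH).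
move/(integrable_mkcond _ mI); rewrite restrict_EFin.
rewrite (_ : H \_ _ = H)//; apply/funext => t; rewrite /patch.
by case: ifPn => // /negP; rewrite inE /= in_itv /= => /negP; move=> /H0 ->.
Qed.

Lemma Rintegral_scl H c s : 0 < s -> continuous H ->
  (forall t, ~~ (-1 <= t <= 1) -> H t = 0) ->
  \int[mu]_t scl H c s t = s * \int[mu]_t H t.
Proof.
move=> s0 cH H0; rewrite (Rintegral_off (scl_off s0 H0)) (Rintegral_off H0).
pose F t : R := (t - c) / s.
have dF t : is_derive t 1 F (s^-1 : R).
  have h := is_derive_mulr s^-1 (is_deriveB (is_derive_id t (1 : R)) (is_derive_cst c t 1)).
  by apply: (is_derive_eq h); rewrite subr0 mul1r.
have ddF t : derivable F t 1 by have := dF t => ?; exact: ex_derive.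
have F'E : derive1 F = cst s^-1.
  by apply/funext => t; rewrite derive1E; have := dF t => ?; exact: derive_val.
have cF := derivable_continuous ddF.
have Fa : F (c - s) = -1 by rewrite /F; field; rewrite gt_eqF.
have Fb : F (c + s) = 1 by rewrite /F; field; rewrite gt_eqF.
have ccH : continuous (H \o F) by move=> t; apply: continuous_comp; [exact: cF|exact: cH].
have mI : measurable (`[c - s, c + s]%classic : set (measurableTypeR R)).
  exact: measurable_itv.
have iHF : mu.-integrable `[c - s, c + s] (EFin \o (H \o F)).
  apply: continuous_compact_integrable; first exact: segment_compact.
  exact: continuous_subspaceT.
have := @integration_by_substitution_increasing R F H (c - s) (c + s).
rewrite Fa Fb F'E => h.
rewrite /Rintegral h; first last.
- exact: continuous_subspaceT.
- split; first by move=> t _; exact: ddF.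
    by apply: cvg_at_right_filter; exact: cF.
  by apply: cvg_at_left_filter; exact: cF.
- exact: is_cvg_cst.
- exact: is_cvg_cst.
- by move=> t _; exact: cst_continuous.
- by move=> t1 t2 _ _ t12; rewrite /F ltr_pM2r ?invr_gt0// ltrD2r.
- by lra.
under [in RHS]eq_integral do rewrite EFinM.
rewrite integralZr// fineM//; last exact: integrable_fin_num.
by rewrite mulrC /= -mulrA mulVf ?mulr1 ?gt_eqF.
Qed.

Lemma Rintegral_tens F G a b c d : continuous F -> continuous G ->
  (forall t, ~~ (a <= t <= b) -> F t = 0) -> (forall t, ~~ (c <= t <= d) -> G t = 0) ->
  \int[leb]_x tens F G x = (\int[mu]_t F t) * (\int[mu]_t G t).
Proof.
move=> cF cG F0 G0.
have iF := integrable_off cF F0; have iG := integrable_off cG G0.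
have iT : leb.-integrable setT (EFin \o tens F G).
  apply: (@integrable_cont_supp R setT (`[a, b] `*` `[c, d])) => //.
  - by apply: compact_setX; exact: segment_compact.
  - exact: continuous_tens.
  - move=> x /= /not_andP[h|h]; rewrite /tens.
      by rewrite F0 ?mul0r//; apply/negP => h'; apply: h; rewrite in_itv.
    by rewrite G0 ?mulr0//; apply/negP => h'; apply: h; rewrite in_itv.
have fG := integrable_fin_num measurableT iG.
have fF := integrable_fin_num measurableT iF.
rewrite /Rintegral -fineM//; congr fine.
rewrite -[LHS](integral12_prod_meas1 iT) /fubini_F.
transitivity (\int[mu]_x ((F x)%:E * \int[mu]_y (G y)%:E))%E.
  by apply: eq_integral => x _; rewrite -integralZl.
have [g gE] : exists g, (\int[mu]_x (G x)%:E)%E = g%:E.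
  by exists (fine (\int[mu]_x (G x)%:E)%E); rewrite fineK.
by rewrite gE integralZr.
Qed.

End Scaling.

(** * Functions of one variable dual to 1, t and t^2 *)

Section DualFunctions.
Variable R : realType.
Implicit Types (H F G : R -> R) (s t : R).
Local Notation mu := (@lebesgue_measure R).

Definition off1 H := forall t, ~~ (-1 <= t <= 1) -> H t = 0.

Definition moment H k : R := \int[mu]_t (H t * t ^+ k).

Lemma continuous_mulX H k : continuous H -> continuous (fun t => H t * t ^+ k).
Proof. by move=> cH; exact: (@CnM R 0 H (fun t => t ^+ k) cH (@exprn_continuous R k)). Qed.

Lemma moment_integrable H k : continuous H -> off1 H ->
  mu.-integrable setT (EFin \o (fun t => H t * t ^+ k)).
Proof.
move=> cH oH; apply: (@integrable_off _ _ (-1) 1); first exact: continuous_mulX.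
by move=> t /oH ->; rewrite mul0r.
Qed.

Lemma integrableZ_setT (a : R) H : mu.-integrable setT (EFin \o H) ->
  mu.-integrable setT (EFin \o (fun t => a * H t)).
Proof. exact: (@integrableZl _ _ _ mu setT measurableT a (EFin \o H)). Qed.

Lemma moment_lin a b F G k : continuous F -> off1 F -> continuous G -> off1 G ->
  moment (fun t => a * F t + b * G t) k = a * moment F k + b * moment G k.
Proof.
move=> cF oF cG oG; have iF := moment_integrable k cF oF.
have iG := moment_integrable k cG oG.
rewrite /moment -!RintegralZl// -RintegralD//; [|exact: integrableZ_setT..].
by apply: eq_Rintegral => t _; ring.
Qed.

(** Integration by parts: differentiation lowers the degree of the moment. For k = 0 the predecessor
    is 0 again, which the factor k makes harmless. *)
Lemma moment_derive H k : smooth1 H -> off1 H ->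
  moment (derive1 H) k = - k%:R * moment H k.-1.
Proof.
move=> sH oH; have dH := smooth1_is_derive sH.
have cH := smooth1_continuous sH; have cH' := smooth1_continuous (smooth1_derive sH).
have oH' : off1 (derive1 H) by exact: derive1_eq0_off.
have dX t : is_derive t 1 (fun t : R => t ^+ k) (k%:R * t ^+ k.-1).
  have := is_derive_poly ('X^k : {poly R}) t.
  rewrite derivXn hornerMn hornerXn (_ : horner _ = fun t : R => t ^+ k).
    by rewrite mulr_natl.
  by apply/funext => u; rewrite hornerXn.
have dP t := is_derive_mul (dH t) (dX t).
have e := @integral_derive_eq0 R _ _ 1 dP.
have {e} : \int[mu]_t (derive1 H t * t ^+ k + H t * (k%:R * t ^+ k.-1)) = 0.
  rewrite /Rintegral e//.
  - have c1 : Cn 0 (fun t => derive1 H t * t ^+ k) by exact: continuous_mulX.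
    have c2 : Cn 0 (fun t : R => k%:R * t ^+ k.-1).
      by apply: CnM; [exact: Cn_cst|exact: exprn_continuous].
    exact: (CnD c1 (CnM (cH : Cn 0 H) c2)).
  - by move=> t ht; rewrite oH// mul0r.
have -> : \int[mu]_t (derive1 H t * t ^+ k + H t * (k%:R * t ^+ k.-1)) =
    moment (derive1 H) k + k%:R * moment H k.-1.
  rewrite /moment -RintegralZl//; last exact: moment_integrable.
  rewrite -RintegralD//; [|exact: moment_integrable|].
    by apply: eq_Rintegral => t _; ring.
  by apply: integrableZ_setT; exact: moment_integrable.
by move=> /eqP; rewrite addr_eq0 => /eqP ->; rewrite mulNr.
Qed.

Lemma off1_derive H : off1 H -> off1 (derive1 H).
Proof. exact: derive1_eq0_off. Qed.

Lemma moment0_bump : 0 < moment (cutoff 2 (-1) 1 : R -> R) 0.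
Proof.
set H : R -> R := cutoff 2 (-1) 1.
have cH : continuous H by exact: smooth1_continuous (smooth_cutoff _ _ _).
have oH : off1 H.
  by move=> t ht; apply: cutoff_off => //; apply: contra ht => /andP[h1 h2]; rewrite !ltW.
have iH := moment_integrable 0 cH oH.
apply: (@lt_le_trans _ _ 1) => //.
have mI : measurable (`[(-2^-1)%R, 2^-1]%classic : set (measurableTypeR R)).
  exact: measurable_itv.
have -> : (1 : R) = \int[mu]_(t in `[(-2^-1)%R, 2^-1]) 1.
  have h : lebesgue_measure (`[(-2^-1)%R, 2^-1]%classic : set R) = 1%:E.
    rewrite lebesgue_measure_itv /= lte_fin ifT; last by lra.
    by rewrite -EFinB; congr EFin; lra.
  rewrite Rintegral_cst// -[LHS](mul1r (fine 1%E)).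
  by congr (_ * fine _); exact: esym h.
rewrite /moment Rintegral_mkcond; apply: le_Rintegral => //.
  have c1 : continuous (cst (1 : R) : R -> R) by exact: cst_continuous.
  have := @continuous_compact_integrable R (cst 1) _ (@segment_compact _ (-2^-1) 2^-1)
    (continuous_subspaceT c1).
  by move/(integrable_mkcond _ mI); rewrite restrict_EFin.
move=> t _; rewrite expr0 mulr1 /patch; case: ifPn => [|_]; last exact: cutoff_ge0.
by rewrite inE /= in_itv /= => /andP[h1 h2]; rewrite /H cutoff_eq1//; lra.
Qed.

Lemma dual_functions : exists D : 'I_3 -> R -> R, forall i, [/\ smooth1 (D i), off1 (D i) &
  forall k : 'I_3, moment (D i) k = (i == k)%:R].
Proof.
set H : R -> R := cutoff 2 (-1) 1.
have sH : smooth1 H by exact: smooth_cutoff.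
have oH : off1 H.
  by move=> t ht; apply: cutoff_off => //; apply: contra ht => /andP[h1 h2]; rewrite !ltW.
have m0 : 0 < moment H 0 by exact: moment0_bump.
have sH1 := smooth1_derive sH; have sH2 := smooth1_derive sH1.
have oH1 := off1_derive oH; have oH2 := off1_derive oH1.
have cH := smooth1_continuous sH; have cH1 := smooth1_continuous sH1.
have cH2 := smooth1_continuous sH2.
set H1 := derive1 H in sH1 oH1 cH1; set H2 := derive1 H1 in sH2 oH2 cH2.
have M1 k : moment H1 k = - k%:R * moment H k.-1 by exact: moment_derive.
have M2 k : moment H2 k = - k%:R * moment H1 k.-1 by exact: moment_derive.
pose lin a (F : R -> R) b G t := a * F t + b * G t.
have good_lin a F b G : smooth1 F /\ off1 F -> smooth1 G /\ off1 G ->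
    smooth1 (lin a F b G) /\ off1 (lin a F b G).
  move=> [sF oF] [sG oG]; split; last by move=> t ht; rewrite /lin oF// oG// !mulr0 addr0.
  by apply: smooth1D; exact: smooth1Z.
have m_lin a F b G k : smooth1 F /\ off1 F -> smooth1 G /\ off1 G ->
    moment (lin a F b G) k = a * moment F k + b * moment G k.
  by move=> [sF oF] [sG oG]; apply: moment_lin => //; exact: smooth1_continuous.
set mm := moment H 0 in m0.
pose E2 := lin (2 * mm)^-1 H2 0 H.
have gE2 : smooth1 E2 /\ off1 E2 by exact: good_lin.
pose E1 := lin (- mm^-1) H1 (- (2 * moment H 1 / mm)) E2.
have gE1 : smooth1 E1 /\ off1 E1 by exact: good_lin.
pose E01 := lin mm^-1 H (- (moment H 1 / mm)) E1.
have gE01 : smooth1 E01 /\ off1 E01 by exact: good_lin.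
pose E0 := lin 1 E01 (- (moment H 2 / mm)) E2.
have gE0 : smooth1 E0 /\ off1 E0 by exact: good_lin.
have mE2 k : moment E2 k = (2 * mm)^-1 * moment H2 k.
  by rewrite m_lin// mul0r addr0.
have mn0 : mm != 0 by rewrite gt_eqF.
have e20 : moment E2 0 = 0 by rewrite mE2 M2 oppr0 mul0r mulr0.
have e21 : moment E2 1 = 0 by rewrite mE2 M2 M1 /= oppr0 mul0r !mulr0.
have e22 : moment E2 2 = 1 by rewrite mE2 M2 M1 /= -/mm; field.
have e10 : moment E1 0 = 0 by rewrite m_lin// e20 M1 oppr0 mul0r !mulr0 addr0.
have e11 : moment E1 1 = 1 by rewrite m_lin// e21 M1 /= -/mm; field.
have e12 : moment E1 2 = 0 by rewrite m_lin// e22 M1 /=; field.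
have e00 : moment E0 0 = 1 by rewrite [moment E0 _]m_lin// [moment E01 _]m_lin// e20 e10 -/mm; field.
have e01 : moment E0 1 = 0 by rewrite [moment E0 _]m_lin// [moment E01 _]m_lin// e21 e11 ; field.
have e02 : moment E0 2 = 0 by rewrite [moment E0 _]m_lin// [moment E01 _]m_lin// e22 e12; field.
exists (fun i : 'I_3 => if val i == 0%N then E0 else if val i == 1%N then E1 else E2).
by case=> -[|[|[|//]]] hi /=; split; try exact: gE0.1; try exact: gE0.2;
  try exact: gE1.1; try exact: gE1.2; try exact: gE2.1; try exact: gE2.2;
  case=> -[|[|[|//]]] hk /=; rewrite ?e00 ?e01 ?e02 ?e10 ?e11 ?e12 ?e20 ?e21 ?e22.
Qed.

End DualFunctions.

(** * Inverse estimate by duality *)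

Section LocalPolynomials.
Variable R : realType.
Implicit Types (c x e : plane R) (s : R) (K : set (plane R)) (f g : plane R -> R).
Local Notation leb := (leb2 R).
Local Notation mu := (@lebesgue_measure R).
Local Notation mset D := (measurable (D : set (mplane R))).

Lemma off1_bound (H : R -> R) : continuous H -> off1 H -> exists M, forall t, `|H t| <= M.
Proof.
move=> cH oH; have [M hM] := compact_norm_bound (@segment_compact R (-1) 1) cH.
exists (Num.max M 0) => t; have [ht|ht] := boolP (-1 <= t <= 1).
  by rewrite le_max hM//= in_itv.
by rewrite oH// normr0 le_max lexx orbT.
Qed.

(** The coefficients refer to the rescaled variables (x - c)/s, so that estimates on them do not
    depend on the size of the square. *)
Definition poly2 (a : 'I_3 -> 'I_3 -> R) c s x : R :=
  \sum_(i < 3) \sum_(j < 3) a i j * (((x.1 - c.1) / s) ^+ i * ((x.2 - c.2) / s) ^+ j).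

Lemma Rintegral_sum (I : Type) (r : seq I) (D : set (plane R)) (F : I -> plane R -> R) :
  mset D -> (forall i, rintegrable D (F i)) ->
  rintegrable D (fun x => \sum_(i <- r) F i x) /\
  \int[leb]_(x in D) (\sum_(i <- r) F i x) = \sum_(i <- r) \int[leb]_(x in D) F i x.
Proof.
move=> mD iF; elim: r => [|i r [IH1 IH2]].
  split; last by rewrite big_nil; under eq_Rintegral do rewrite big_nil; rewrite Rintegral_cst// mul0r.
  apply: (@eq_rintegrable _ _ (fun=> 0)); first by move=> x; rewrite big_nil.
  exact: integrable0.
split.
  apply: (@eq_rintegrable _ _ (fun x => F i x + \sum_(j <- r) F j x)).
    by move=> x; rewrite big_cons.
  exact: rintegrableD.
rewrite big_cons -IH2 -(RintegralD mD (iF i) IH1).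
by apply: eq_Rintegral => x _; rewrite big_cons.
Qed.

Lemma tens_integrable (F G : R -> R) (a b c d : R) : continuous F -> continuous G ->
  (forall t, ~~ (a <= t <= b) -> F t = 0) -> (forall t, ~~ (c <= t <= d) -> G t = 0) ->
  rintegrable setT (tens F G : plane R -> R).
Proof.
move=> cF cG F0 G0.
apply: (@integrable_cont_supp R setT (`[a, b] `*` `[c, d])) => //.
- by apply: compact_setX; exact: segment_compact.
- exact: continuous_tens.
- move=> x /= /not_andP[h|h]; rewrite /tens.
    by rewrite F0 ?mul0r//; apply/negP => h'; apply: h; rewrite in_itv.
  by rewrite G0 ?mulr0//; apply/negP => h'; apply: h; rewrite in_itv.
Qed.

Section Dual.
Variables (D : 'I_3 -> R -> R) (M : R).
Hypothesis sD : forall i, smooth1 (D i).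
Hypothesis oD : forall i, off1 (D i).
Hypothesis dD : forall i k : 'I_3, moment (D i) k = (i == k)%:R.
Hypothesis bD : forall i t, `|D i t| <= M.
Hypothesis bD' : forall i t, `|derive1 (D i) t| <= M.

Definition dualf c s (i j : 'I_3) : plane R -> R :=
  tens (scl (D i) c.1 s) (scl (D j) c.2 s).

Let M0 : 0 <= M.
Proof. exact: le_trans (bD ord0 0). Qed.

Lemma dualf_smooth c s i j n : Ck n (dualf c s i j).
Proof. by apply: Ck_tens; exact: scl_smooth. Qed.

Lemma dualf_off c s i j x : 0 < s -> ~ boxc c s x -> dualf c s i j x = 0.
Proof.
move=> s0 /not_andP[h|h]; rewrite /dualf /tens.
  by rewrite (scl_off s0 (oD i)) ?mul0r//; apply/negP => h'; apply: h; rewrite /= in_itv.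
by rewrite (scl_off s0 (oD j)) ?mulr0//; apply/negP => h'; apply: h; rewrite /= in_itv.
Qed.

Lemma dualf_test c s i j (U : set (plane R)) : 0 < s -> boxc c s `<=` U ->
  test_fun U (dualf c s i j).
Proof.
move=> s0 sU; exact: (test_fun_tens (scl_smooth _ _ (sD i)) (scl_smooth _ _ (sD j))
  (scl_off s0 (oD i)) (scl_off s0 (oD j)) sU).
Qed.

Lemma dualf_bound c s i j x : `|dualf c s i j x| <= M ^+ 2.
Proof. by rewrite /dualf /tens /scl normrM expr2; apply: ler_pM; rewrite ?bD. Qed.

Lemma dirder_dualf_bound c s i j e x : 0 < s -> `|e.1| <= 1 -> `|e.2| <= 1 ->
  `|dirder e (dualf c s i j) x| <= 2 * M ^+ 2 / s.
Proof.
move=> s0 e1 e2; rewrite /dirder /dualf pd1_tens; last exact: (scl_smooth _ _ (sD i) 1%N).1.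
rewrite pd2_tens; last exact: (scl_smooth _ _ (sD j) 1%N).1.
rewrite !scl_derive// /tens.
have h (a p q : R) : `|a| <= 1 -> `|p| <= M -> `|q| <= M -> `|a * (s^-1 * p * q)| <= M ^+ 2 / s.
  move=> ha hp hq; rewrite !normrM normfV (gtr0_norm s0).
  have si : 0 <= s^-1 by rewrite invr_ge0 ltW.
  rewrite -[leRHS]mul1r; apply: ler_pM => //; first by rewrite !mulr_ge0.
  by rewrite -mulrA mulrC ler_wpM2r// expr2; apply: ler_pM.
apply: (le_trans (ler_normD _ _)).
have h1 := h _ _ _ e1 (bD' i ((x.1 - c.1) / s)) (bD j ((x.2 - c.2) / s)).
have h2 := h _ _ _ e2 (bD' j ((x.2 - c.2) / s)) (bD i ((x.1 - c.1) / s)).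
have -> : 2 * M ^+ 2 / s = M ^+ 2 / s + M ^+ 2 / s by ring.
apply: lerD; first exact: h1.
rewrite (_ : e.2 * _ = e.2 * (s^-1 * derive1 (D j) ((x.2 - c.2) / s) * D i ((x.1 - c.1) / s)));
  first exact: h2.
by rewrite /scl; ring.
Qed.

(** Fubini splits each term into two moments; [s ^+ 2] is the Jacobian of the rescaling. *)
Lemma poly2_dual a c s i j : 0 < s ->
  \int[leb]_x (poly2 a c s x * dualf c s i j x) = s ^+ 2 * a i j.
Proof.
move=> s0.
pose F (k : 'I_3) (D' : R -> R) : R -> R := fun t => D' t * t ^+ k.
have cF k l : continuous (F k (D l)) by exact: continuous_mulX (smooth1_continuous (sD l)).
have oF k l : off1 (F k (D l)) by move=> t ht; rewrite /F oD// mul0r.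
have csF k l b : continuous (scl (F k (D l)) b s).
  rewrite (_ : scl _ _ _ = fun t => scl (D l) b s t * ((t - b) / s) ^+ k)//.
  have c1 : Cn 0 (scl (D l) b s) by exact: (scl_smooth _ _ (sD l)).
  have c2 : Cn 0 (fun t : R => ((t - b) / s) ^+ k).
    have -> : (fun t : R => ((t - b) / s) ^+ k) = (fun t => (s^-1 * t + (- b / s)) ^+ k).
      by apply/funext => t; congr (_ ^+ _); ring.
    by apply: (@Cn_affine R 0 (fun t => t ^+ k)); exact: exprn_continuous.
  exact: (CnM c1 c2).
pose T k l : plane R -> R := tens (scl (F k (D i)) c.1 s) (scl (F l (D j)) c.2 s).
have iT k l : rintegrable setT (T k l).
  exact: (tens_integrable (csF _ _ _) (csF _ _ _) (scl_off s0 (oF k i)) (scl_off s0 (oF l j))).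
have vT k l : \int[leb]_x T k l x = s ^+ 2 * ((i == k)%:R * (j == l)%:R).
  rewrite (@Rintegral_tens R _ _ _ _ _ _ (csF k i c.1) (csF l j c.2)
    (scl_off s0 (oF k i)) (scl_off s0 (oF l j))).
  rewrite (Rintegral_scl _ s0 (cF k i) (oF k i)) (Rintegral_scl _ s0 (cF l j) (oF l j)).
  by rewrite -[X in s * X * _]/(moment (D i) k) -[X in _ * (s * X)]/(moment (D j) l) !dD; ring.
have iA k l : rintegrable setT (fun x => a k l * T k l x) by exact: rintegrableZ.
have vA k l : \int[leb]_x (a k l * T k l x) = a k l * (s ^+ 2 * ((i == k)%:R * (j == l)%:R)).
  by rewrite -vT; exact: (@RintegralZl _ _ _ leb setT (T k l) (a k l) measurableT (iT k l)).
have iS k : rintegrable setT (fun x => \sum_(l < 3) a k l * T k l x).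
  by have [] := @Rintegral_sum _ (index_enum _) setT (fun l x => a k l * T k l x) measurableT (iA k).
transitivity (\int[leb]_x (\sum_(k < 3) \sum_(l < 3) a k l * T k l x)).
  apply: eq_Rintegral => x _; rewrite /poly2 mulr_suml; apply: eq_bigr => k _.
  rewrite mulr_suml; apply: eq_bigr => l _; rewrite /T /dualf /tens /scl /F; ring.
rewrite (@Rintegral_sum _ _ _ _ measurableT iS).2.
rewrite (bigD1 i)//= [X in _ + X]big1 ?addr0; last first.
  move=> k ki; rewrite (@Rintegral_sum _ _ _ _ measurableT (iA k)).2 big1// => l _.
  by rewrite vA eq_sym (negbTE ki) mul0r !mulr0.
rewrite (@Rintegral_sum _ _ _ _ measurableT (iA i)).2 (bigD1 j)//= big1 ?addr0.
  by rewrite vA !eqxx !mulr1 mulrC.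
by move=> l lj; rewrite vA [j == l]eq_sym (negbTE lj) !mulr0.
Qed.

Lemma continuous_poly2 a c s : continuous (poly2 a c s).
Proof.
have cX b k : continuous (fun t : R => ((t - b) / s) ^+ k).
  have -> : (fun t : R => ((t - b) / s) ^+ k) = (fun t => (s^-1 * t + (- b / s)) ^+ k).
    by apply/funext => t; congr (_ ^+ _); ring.
  by apply: (@Cn_affine R 0 (fun t => t ^+ k)); exact: exprn_continuous.
have csum (I : Type) (r : seq I) (F : I -> plane R -> R) :
    (forall i, continuous (F i)) -> continuous (fun x => \sum_(i <- r) F i x).
  move=> cF; elim: r => [|i r IH].
    rewrite (_ : (fun x => _) = cst 0); first exact: cst_continuous.
    by apply/funext => x; rewrite big_nil.
  rewrite (_ : (fun x => _) = fun x => F i x + \sum_(j <- r) F j x); last first.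
    by apply/funext => x; rewrite big_cons.
  by move=> x; apply: (@continuousD _ _ _ (F i) (fun x => \sum_(j <- r) F j x));
    [exact: cF|exact: IH].
apply: (csum _ _ (fun i x => \sum_(j < 3) _)) => i.
apply: (csum _ _ (fun j x => _)) => j.
apply: continuousM_plane; first exact: cst_continuous.
exact: (@continuous_tens _ (fun t => ((t - c.1) / s) ^+ i) (fun t => ((t - c.2) / s) ^+ j)).
Qed.

(** Nine monomials, each of degree at most 2 in either variable, on a box enlarged by [kap]. *)
Lemma poly2_bound a c s x (kap A : R) : 1 <= kap -> 0 < s ->
  boxc c (kap * s) x -> (forall i j, `|a i j| <= A) -> `|poly2 a c s x| <= 9 * (A * kap ^+ 4).
Proof.
move=> k1 s0 /boxcP[x1 x2] aA.
have A0 : 0 <= A by exact: le_trans (aA ord0 ord0).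
have k0 : 0 <= kap by exact: le_trans k1.
have h (y : R) (i : 'I_3) : `|y| <= kap * s -> `|(y / s) ^+ i| <= kap ^+ 2.
  move=> hy; rewrite normrX normrM normfV (gtr0_norm s0).
  have h1 : `|y| / s <= kap by rewrite ler_pdivrMr.
  apply: (@le_trans _ _ (kap ^+ i)).
    by apply: lerXn2r; rewrite ?nnegrE ?mulr_ge0 ?invr_ge0 ?(ltW s0).
  by apply: ler_weXn2l => //; rewrite -ltnS.
have t i j : `|a i j * (((x.1 - c.1) / s) ^+ i * ((x.2 - c.2) / s) ^+ j)| <= A * kap ^+ 4.
  rewrite (normrM (a i j)); apply: ler_pM; [exact: normr_ge0|exact: normr_ge0|exact: aA|].
  rewrite normrM (_ : 4%N = (2 + 2)%N)// exprD.
  by apply: ler_pM; [exact: normr_ge0|exact: normr_ge0|exact: h|exact: h].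
rewrite /poly2; apply: (le_trans (ler_norm_sum _ _ _)).
apply: (@le_trans _ _ (\sum_(i < 3) \sum_(j < 3) (A * kap ^+ 4))).
  apply: ler_sum => i _; apply: (le_trans (ler_norm_sum _ _ _)).
  by apply: ler_sum => j _.
by rewrite !big_ord_recl !big_ord0; lra.
Qed.

(** Cauchy-Schwarz on the square that carries [g]; its area [4 * s ^+ 2] has square root 2s. *)
Lemma pairing_bound K c s f g (a b : R) : 0 < s -> mset K -> boxc c s `<=` K ->
  mfun2 K f -> borel_fun g -> (forall x, ~ boxc c s x -> g x = 0) -> 0 <= b ->
  (forall x, `|g x| <= b) -> (nLp K 2 f <= a%:E)%E ->
  rintegrable K (fun x => f x * g x) /\ `|\int[leb]_(x in K) (f x * g x)| <= a * (2 * b * s).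
Proof.
move=> s0 mK sK mf bg g0 b0 gb fa.
have mQ : mset (boxc c s) := measurable_boxc c s.
have mfQ : mfun2 (boxc c s) f by exact: mfun2S mf.
have faQ : (nLp (boxc c s) 2 f <= a%:E)%E.
  apply: le_trans fa; apply: nLp_le => //; exact: nearW.
have s20 : 0 <= 4 * s ^+ 2 by rewrite mulr_ge0// sqr_ge0.
have := @nLp1_bound R (boxc c s) 2 b (4 * s ^+ 2) a f g _ b0 s20 mQ mfQ (borel_mfun2 bg) _ faQ (fun x _ => gb x).
rewrite (leb2_boxc _ (ltW s0)) lexx => /(_ _ isT) h.
have {}h := h (ltr1n R 2).
have e : b * (4 * s ^+ 2) `^ (1 - 2^-1) = 2 * b * s.
  have -> : 1 - 2^-1 = 2^-1 :> R by field.
  rewrite powR12_sqrt// (_ : 4 * s ^+ 2 = (2 * s) ^+ 2); last by ring.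
  by rewrite sqrtr_sqr gtr0_norm ?mulr_gt0//; ring.
rewrite e in h.
have [i1 i2] := nLp1_integrable mQ (mfun2M mfQ (borel_mfun2 bg)) h.
have z x : ~ boxc c s x -> f x * g x = 0 by move=> /g0 ->; rewrite mulr0.
split; last by rewrite (Rintegral_supp sK z).
exact: integrable_supp mK mQ sK z i1.
Qed.

(** Each coefficient of [P] is [s ^- 2] times its pairing with a dual function, and this pairing is
    that of [f] minus that of [f - P]. Hence the coefficients are at most B = (b + 2 M^2 a)/s, and
    the norm of [P] on [K] is at most 9 B kap^4 times 2 kap s. Small pairings thus control [f]
    itself once [f] is close to some polynomial, whose coefficients need not be known beforehand. *)
Lemma poly2_inverse K c s kap f (P : 'I_3 -> 'I_3 -> R) (a b : R) : 0 < s -> 1 <= kap ->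
  mset K -> boxc c s `<=` K -> K `<=` boxc c (kap * s) -> mfun2 K f ->
  0 <= a -> 0 <= b ->
  (forall i j, `|\int[leb]_(x in K) (f x * dualf c s i j x)| <= b * s) ->
  (nLp K 2 (fun x => f x - poly2 P c s x)%R <= a%:E)%E ->
  (nLp K 2 f <= (a + 18 * kap ^+ 5 * (b + 2 * M ^+ 2 * a))%:E)%E.
Proof.
move=> s0 k1 mK sK Ks mf a0 b0 fb fa.
have k0 : 0 <= kap by exact: le_trans k1.
have cP := @continuous_poly2 P c s; have bP := continuous_borel cP.
have mP : mfun2 K (poly2 P c s) by exact: borel_mfun2.
have mfP : mfun2 K (fun x => f x - poly2 P c s x) by exact: mfun2B.
have bd i j : borel_fun (dualf c s i j) by exact: continuous_borel (Ck_continuous (dualf_smooth c s i j 0)).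
have M20 : 0 <= M ^+ 2 by exact: sqr_ge0.
have hd i j := @pairing_bound K c s _ _ a (M ^+ 2) s0 mK sK mfP (bd i j)
  (fun x => @dualf_off c s i j x s0) M20 (dualf_bound c s i j) fa.
have hP i j : rintegrable K (fun x => poly2 P c s x * dualf c s i j x).
  apply: (@integrable_cont_supp R K (boxc c s)) => //.
  - by apply: compact_setX; exact: segment_compact.
  - by apply: continuousM_plane => //; exact: Ck_continuous (dualf_smooth c s i j 0).
  - by move=> x hx; rewrite dualf_off// mulr0.
have eP i j : \int[leb]_(x in K) (poly2 P c s x * dualf c s i j x) = s ^+ 2 * P i j.
  have z x : ~ boxc c s x -> poly2 P c s x * dualf c s i j x = 0.
    by move=> hx; rewrite dualf_off// mulr0.
  by rewrite -(poly2_dual P c i j s0) (Rintegral_supp sK z) (@Rintegral_supp _ setT _ _ _ z).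
set B := (b + 2 * M ^+ 2 * a) / s.
have PB i j : `|P i j| <= B.
  rewrite /B ler_pdivlMr// -(ler_pM2r s0).
  have -> : `|P i j| * s * s = `|s ^+ 2 * P i j|.
    by rewrite normrM (ger0_norm (sqr_ge0 s)); ring.
  rewrite -eP.
  have -> : \int[leb]_(x in K) (poly2 P c s x * dualf c s i j x) =
    \int[leb]_(x in K) (f x * dualf c s i j x) -
    \int[leb]_(x in K) ((f x - poly2 P c s x) * dualf c s i j x).
    have i1 := (hd i j).1; have i2 := rintegrableD mK i1 (hP i j).
    have i3 : rintegrable K (fun x => f x * dualf c s i j x).
      by apply: eq_rintegrable i2 => x; ring.
    by rewrite -RintegralB//; apply: eq_Rintegral => x _; ring.
  apply: (le_trans (ler_normB _ _)); have := fb i j; have := (hd i j).2.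
  by rewrite mulrDl; lra.
have B0 : 0 <= B by exact: le_trans (PB ord0 ord0).
have hK2 : (leb K <= (4 * (kap * s) ^+ 2)%:E)%E.
  rewrite -(@leb2_boxc _ c (kap * s)); last by rewrite mulr_ge0// (ltW s0).
  by apply: le_measure; rewrite ?inE//; exact: measurable_boxc.
have nP : (nLp K 2 (poly2 P c s) <= (18 * kap ^+ 5 * (b + 2 * M ^+ 2 * a))%:E)%E.
  have := @nLp_bound R K 2 (9 * (B * kap ^+ 4)) _ (poly2 P c s) (ltr0n _ 2) _ mK mP hK2.
  have -> : 9 * (B * kap ^+ 4) * (4 * (kap * s) ^+ 2) `^ 2^-1 =
      18 * kap ^+ 5 * (b + 2 * M ^+ 2 * a).
    rewrite powR12_sqrt; last by rewrite mulr_ge0// sqr_ge0.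
    rewrite (_ : 4 * (kap * s) ^+ 2 = (2 * (kap * s)) ^+ 2); last by ring.
    rewrite sqrtr_sqr ger0_norm ?mulr_ge0 ?(ltW s0)//.
    by rewrite /B; field; rewrite gt_eqF.
  apply; first by apply: mulr_ge0 => //; apply: mulr_ge0 => //; exact: exprn_ge0.
  by apply: nearW => x Kx; apply: (@poly2_bound P c s x kap B) => //; exact: Ks.
have e : nLp K 2 f = nLp K 2 (fun x => (f x - poly2 P c s x) + poly2 P c s x)%R.
  by apply: nLp_eq => // x _; ring.
rewrite e; apply: (le_trans (nLpD (ler1n _ 2) mK mfP mP)).
by rewrite EFinD; apply: leeD.
Qed.

End Dual.

End LocalPolynomials.

(** * Test fields moving a unit of mass across a line *)

Section Transport.
Variable R : realType.
Implicit Types (S A B : R -> R) (m n e x : plane R) (s t l u : R).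
Local Notation mu := (@lebesgue_measure R).
Local Notation leb := (leb2 R).

Lemma derive1_eq0_near (F : R -> R) (c t : R) : {near t, cst c =1 F} -> derive1 F t = 0.
Proof.
move=> h; have := near_eq_is_derive h (is_derive_cst c t 1).
by rewrite derive1E => ?; exact: derive_val.
Qed.

Lemma step_exists l u : l < u -> exists S, [/\ smooth1 S, (forall t, t <= l -> S t = 0),
  (forall t, u <= t -> S t = 1), (forall t, ~~ (l <= t <= u) -> derive1 S t = 0) &
  \int[mu]_t derive1 S t = 1].
Proof.
move=> lu; have d0 : 0 < u - l by rewrite subr_gt0.
pose S t : R := smoothstep ((t - l) / (u - l)).
have sS : smooth1 S by exact: (scl_smooth l (u - l) (smooth_smoothstep R)).
have S0 t : t <= l -> S t = 0.
  by move=> tl; rewrite /S smoothstep0// pmulr_lle0 ?invr_gt0// subr_le0.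
have S1 t : u <= t -> S t = 1.
  by move=> ut; rewrite /S smoothstep1// ler_pdivlMr// mul1r lerB.
have S' t : ~~ (l <= t <= u) -> derive1 S t = 0.
  rewrite negb_and -!ltNge => /orP[h|h].
    apply: (@derive1_eq0_near _ 0); near=> y; rewrite S0//= ltW//.
    by near: y; exact: lt_nbhsl.
  apply: (@derive1_eq0_near _ 1); near=> y; rewrite S1//= ltW//.
  by near: y; exact: lt_nbhsr.
exists S; split => //.
rewrite (Rintegral_off S') /Rintegral (FTC_is_derive lu (smooth1_is_derive sS)).
  by rewrite (S1 u)// (S0 l)// subr0.
exact: smooth1_continuous (smooth1_derive sS).
Unshelve. all: by end_near. Qed.

(** The factor 1/s is the one produced by differentiating a rescaled function, so these are the two
    halves of the divergence of a transport field, each of mass s. *)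
Lemma tens_bump A B m s l1 u1 l2 u2 : 0 < s -> continuous A -> continuous B ->
  -1 <= l1 -> u1 <= 1 -> -1 <= l2 -> u2 <= 1 ->
  (forall t, ~~ (l1 <= t <= u1) -> A t = 0) -> (forall t, ~~ (l2 <= t <= u2) -> B t = 0) ->
  \int[mu]_t A t = 1 -> \int[mu]_t B t = 1 ->
  let X x := s^-1 * tens (scl A m.1 s) (scl B m.2 s) x in
  [/\ continuous X, \int[leb]_x X x = s &
      forall x, X x != 0 -> l1 * s <= x.1 - m.1 <= u1 * s /\ l2 * s <= x.2 - m.2 <= u2 * s].
Proof.
move=> s0 cA cB l11 u11 l21 u21 A0 B0 iA iB X.
have w l u H : -1 <= l -> u <= 1 -> (forall t, ~~ (l <= t <= u) -> H t = 0) -> off1 H.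
  move=> hl hu H0 t ht; apply: H0; apply: contra ht => /andP[h1 h2].
  by rewrite (le_trans hl h1) (le_trans h2 hu).
have oA := w _ _ _ l11 u11 A0; have oB := w _ _ _ l21 u21 B0.
have cscl H c : continuous H -> continuous (scl H c s).
  move=> cH; have -> : scl H c s = fun t => H (s^-1 * t + (- c / s)).
    by apply/funext => t; rewrite /scl; congr H; ring.
  exact: (@Cn_affine R 0 H).
have cT : continuous (tens (scl A m.1 s) (scl B m.2 s)).
  by apply: continuous_tens; exact: cscl.
have iT := tens_integrable (cscl _ m.1 cA) (cscl _ m.2 cB) (scl_off s0 oA) (scl_off s0 oB).
split.
- apply: continuousM_plane => //; exact: cst_continuous.
- rewrite /X (@RintegralZl _ _ _ leb setT _ s^-1 measurableT iT).
  rewrite (Rintegral_tens (cscl _ m.1 cA) (cscl _ m.2 cB) (scl_off s0 oA) (scl_off s0 oB)).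
  rewrite (Rintegral_scl _ s0 cA oA) (Rintegral_scl _ s0 cB oB) iA iB !mulr1 mulrA mulVf ?mul1r//.
  by rewrite gt_eqF.
have sup l u H c t : (forall t, ~~ (l <= t <= u) -> H t = 0) -> scl H c s t != 0 ->
    l * s <= t - c <= u * s.
  move=> H0 ne; have : l <= (t - c) / s <= u.
    by apply: contraNT ne => /H0 h; rewrite /scl h.
  by rewrite ler_pdivlMr// ler_pdivrMr.
move=> x; rewrite /X /tens !mulf_eq0 !negb_or => /and3P[_ h1 h2]; split.
  exact: sup A0 h1.
exact: sup B0 h2.
Qed.

Let box_lin (b y s : R) : 0 < s -> - 1 <= b -> forall c, c <= 1 -> b * s <= y <= c * s -> `|y| <= s.
Proof.
move=> s0 b1 c c1 /andP[h1 h2]; rewrite ler_norml; apply/andP; split.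
  by apply: le_trans h1; rewrite -mulN1r ler_pM2r.
by apply: (le_trans h2); rewrite -[leRHS]mul1r ler_pM2r.
Qed.

Let halfP (y s : R) : - 2^-1 * s <= y <= 2^-1 * s -> `|y| <= s / 2.
Proof. by move=> /andP[h1 h2]; rewrite ler_norml; apply/andP; split; lra. Qed.

(** Decides the side of the line on which a bump lies: the coordinate along the larger component of
    the normal is at least s/2, the other one at most s/2 in absolute value. *)
Let dominated (a b p q s : R) : `|q| <= `|p| -> s / 2 <= a -> `|b| <= s / 2 ->
  0 <= `|p| * a + q * b.
Proof.
move=> qp ha hb; have h1 : `|q * b| <= `|p| * (s / 2) by rewrite normrM; apply: ler_pM.
have h2 : `|p| * (s / 2) <= `|p| * a by rewrite ler_wpM2l.
by move: h1; rewrite ler_norml => /andP[h1 _]; lra.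
Qed.

Let half_low (y s : R) : - 1 * s <= y <= - 2^-1 * s -> s / 2 <= - y.
Proof. by move=> /andP[_ h]; lra. Qed.

Let half_up (y s : R) : 2^-1 * s <= y <= 1 * s -> s / 2 <= y.
Proof. by move=> /andP[h _]; lra. Qed.

Let sg_cases (a : R) : exists2 sg : R, `|sg| = 1 & sg * a = `|a| /\ (sg = 1 \/ sg = -1).
Proof.
have [h|h] := leP 0 a.
  by exists 1; [exact: normr1|split; [rewrite mul1r ger0_norm|left]].
by exists (-1); [rewrite normrN normr1|split; [rewrite mulN1r ltr0_norm|right]].
Qed.

(* In the box of center [m] the field [psi e] carries mass from the side
   [dot n (x - m) <= 0] of the line through [m] to the other side. *)
Lemma transport_exists : exists2 C : R, 0 <= C & forall m n s, 0 < s -> n != 0 ->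
  exists e (psi Fp Fm : plane R -> R),
  [/\ enorm e = 1, (forall U, boxc m s `<=` U -> test_fun U psi),
      forall x, `|psi x| <= C, forall x, `|dirder e psi x| <= C / s &
      forall x, dirder e psi x = Fm x - Fp x] /\
  [/\ continuous Fp, continuous Fm, \int[leb]_x Fp x = s, \int[leb]_x Fm x = s &
      (forall x, Fp x != 0 -> boxc m s x /\ 0 <= dot n (x - m)) /\
      (forall x, Fm x != 0 -> boxc m s x /\ dot n (x - m) <= 0)].
Proof.
have N2 : -1 <= - 2^-1 :> R by lra.
have N2' : -1 < - 2^-1 :> R by lra.
have P2 : 2^-1 <= 1 :> R by lra.
have P2' : 2^-1 < 1 :> R by lra.
have NP : - 2^-1 < 2^-1 :> R by lra.
have N1P2 : -1 <= 2^-1 :> R by lra.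
have N2P1 : - 2^-1 <= 1 :> R by lra.
have [S1 [sS1 S10 S11 S1' iS1]] := step_exists N2'.
have [S2 [sS2 S20 S21 S2' iS2]] := step_exists P2'.
have [S3 [sS3 S30 S31 G0 iG]] := step_exists NP.
set G := derive1 S3 in G0 iG.
(* [H] rises from 0 to 1 on [-1, -1/2] and falls back on [1/2, 1], so its derivative is a unit bump
   minus a unit bump; [G] is a unit bump on [-1/2, 1/2]. The field is H times G, with [H] in the
   coordinate direction where [n] has its larger component. *)
pose H t := S1 t + (- 1) * S2 t.
have sH : smooth1 H by apply: smooth1D => //; exact: smooth1Z.
have sG : smooth1 G by exact: smooth1_derive.
have H' : derive1 H = fun t => derive1 S1 t - derive1 S2 t.
  apply/funext => t.
  have h := is_deriveD (smooth1_is_derive sS1 t) (is_derive_mull (-1) (smooth1_is_derive sS2 t)).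
  by rewrite derive1E (@derive_val _ _ _ _ _ _ _ h); ring.
have oH : off1 H.
  move=> t; rewrite negb_and -!ltNge => /orP[h|h].
    rewrite /H S10 ?S20 ?mulr0 ?addr0//; last exact: ltW.
    by apply: (le_trans (ltW h)).
  rewrite /H S11 ?S21 ?mulr1 ?subrr//; first exact: ltW.
  by apply: (le_trans N2P1 (ltW h)).
have oG : off1 G.
  move=> t ht; apply: G0; apply: contra ht => /andP[h1 h2]; apply/andP; split.
    exact: le_trans N2 h1.
  exact: le_trans h2 P2.
have cS1 := smooth1_continuous (smooth1_derive sS1).
have cS2 := smooth1_continuous (smooth1_derive sS2).
have cG := smooth1_continuous sG.
have [M1 hM1] := off1_bound (smooth1_continuous sH) oH.
have [M2 hM2] := off1_bound cG oG.
have [M3 hM3] := off1_bound (smooth1_continuous (smooth1_derive sH)) (off1_derive oH).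
have M10 : 0 <= M1 by exact: le_trans (hM1 0).
have M20 : 0 <= M2 by exact: le_trans (hM2 0).
have M30 : 0 <= M3 by exact: le_trans (hM3 0).
exists (M1 * M2 + M3 * M2) => [|m n s s0 n0]; first by rewrite addr_ge0// mulr_ge0.
have bnd (a b : R) : `|a| <= M1 \/ `|a| <= M3 -> `|b| <= M2 -> `|a * b| <= M1 * M2 + M3 * M2.
  move=> ha hb; rewrite normrM; apply: (@le_trans _ _ (`|a| * M2)); first by rewrite ler_wpM2l.
  rewrite -mulrDl ler_wpM2r//; case: ha => /le_trans; apply; first by rewrite lerDl.
  by rewrite lerDr.
have sbnd (a b sg : R) : `|sg| = 1 -> `|a| <= M3 -> `|b| <= M2 ->
    `|sg * (s^-1 * a * b)| <= (M1 * M2 + M3 * M2) / s.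
  move=> h1 ha hb; rewrite normrM h1 mul1r -mulrA normrM normfV (gtr0_norm s0) mulrC.
  by rewrite ler_pM2r ?invr_gt0//; apply: bnd => //; right.
(* The sign of the larger component of [n] orients the field; when it is -1 the two bumps exchange
   their roles. *)
have fin e psi X1 X2 sg : sg = 1 \/ sg = -1 -> enorm e = 1 ->
    (forall U, boxc m s `<=` U -> test_fun U psi) ->
    (forall x, `|psi x| <= M1 * M2 + M3 * M2) ->
    (forall x, `|dirder e psi x| <= (M1 * M2 + M3 * M2) / s) ->
    (forall x, dirder e psi x = sg * (X1 x - X2 x)) ->
    continuous X1 -> continuous X2 -> \int[leb]_x X1 x = s -> \int[leb]_x X2 x = s ->
    (forall x, X1 x != 0 -> boxc m s x /\ 0 <= - (sg * dot n (x - m))) ->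
    (forall x, X2 x != 0 -> boxc m s x /\ 0 <= sg * dot n (x - m)) ->
  exists e (psi Fp Fm : plane R -> R),
  [/\ enorm e = 1, (forall U, boxc m s `<=` U -> test_fun U psi),
      forall x, `|psi x| <= M1 * M2 + M3 * M2,
      forall x, `|dirder e psi x| <= (M1 * M2 + M3 * M2) / s &
      forall x, dirder e psi x = Fm x - Fp x] /\
  [/\ continuous Fp, continuous Fm, \int[leb]_x Fp x = s, \int[leb]_x Fm x = s &
      (forall x, Fp x != 0 -> boxc m s x /\ 0 <= dot n (x - m)) /\
      (forall x, Fm x != 0 -> boxc m s x /\ dot n (x - m) <= 0)].
  move=> sgc e1 tp b1 b2 dX c1 c2 i1 i2 k1 k2; case: sgc => sgE.
    exists e, psi, X2, X1; split; split => //.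
      by move=> x; rewrite dX sgE mul1r.
    by split=> x /[dup] hx; [move/k2|move/k1]; rewrite sgE mul1r ?oppr_ge0.
  exists e, psi, X1, X2; split; split => //.
    by move=> x; rewrite dX sgE; ring.
  by split=> x /[dup] hx; [move/k1|move/k2]; rewrite sgE mulN1r ?opprK ?oppr_ge0.
have [n12|n21] := lerP `|n.2| `|n.1|.
- have [sg sg1 [sgn1 sgc]] := sg_cases n.1.
  have [cX1 iX1 X10] := @tens_bump _ _ m s _ _ _ _ s0 cS1 cG (lexx _) N2P1 N2 P2 S1' G0 iS1 iG.
  have [cX2 iX2 X20] := @tens_bump _ _ m s _ _ _ _ s0 cS2 cG N1P2 (lexx _) N2 P2 S2' G0 iS2 iG.
  set X1 := (X in continuous X) in cX1 iX1 X10.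
  set X2 := (X in continuous X) in cX2 iX2 X20.
  pose psi := tens (scl H m.1 s) (scl G m.2 s); pose e : plane R := (sg, 0).
  have dE x : dirder e psi x = sg * (s^-1 * scl (derive1 H) m.1 s x.1 * scl G m.2 s x.2).
    rewrite /dirder /e /= mul0r addr0 /psi pd1_tens; last exact: (scl_smooth _ _ sH 1%N).1.
    by rewrite scl_derive// /tens; ring.
  apply: (fin e psi X1 X2 sg sgc).
  + by rewrite /enorm /dot /= mulr0 addr0 -expr2 sqrtr_sqr.
  + move=> U; exact: (test_fun_tens (scl_smooth _ _ sH) (scl_smooth _ _ sG) (scl_off s0 oH) (scl_off s0 oG)).
  + by move=> x; apply: bnd; [left; exact: hM1|exact: hM2].
  + by move=> x; rewrite dE; apply: sbnd; [|exact: hM3|exact: hM2].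
  + by move=> x; rewrite dE /X1 /X2 /tens /scl H' /=; ring.
  + exact: cX1.
  + exact: cX2.
  + exact: iX1.
  + exact: iX2.
  + move=> x /X10[a1 h2]; split.
      by apply/boxcP; split; [exact: (box_lin s0 (lexx _) N2P1 a1)|exact: (box_lin s0 N2 P2 h2)].
    have := @dominated (- (x.1 - m.1)) (- (x.2 - m.2)) n.1 (sg * n.2).
    rewrite (normrM sg) sg1 mul1r => /(_ s n12) h.
    have -> : - (sg * dot n (x - m)) = `|n.1| * - (x.1 - m.1) + sg * n.2 * - (x.2 - m.2).
      by rewrite -sgn1 /dot /=; ring.
    by apply: h; [exact: half_low a1|rewrite ?normrN; exact: halfP h2].
  + move=> x /X20[a1 h2]; split.
      by apply/boxcP; split; [exact: (box_lin s0 N1P2 (lexx _) a1)|exact: (box_lin s0 N2 P2 h2)].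
    have := @dominated (x.1 - m.1) (x.2 - m.2) n.1 (sg * n.2).
    rewrite (normrM sg) sg1 mul1r => /(_ s n12) h.
    have -> : sg * dot n (x - m) = `|n.1| * (x.1 - m.1) + sg * n.2 * (x.2 - m.2).
      by rewrite -sgn1 /dot /=; ring.
    by apply: h; [exact: half_up a1|rewrite ?normrN; exact: halfP h2].
- have [sg sg1 [sgn2 sgc]] := sg_cases n.2.
  have [cX1 iX1 X10] := @tens_bump _ _ m s _ _ _ _ s0 cG cS1 N2 P2 (lexx _) N2P1 G0 S1' iG iS1.
  have [cX2 iX2 X20] := @tens_bump _ _ m s _ _ _ _ s0 cG cS2 N2 P2 N1P2 (lexx _) G0 S2' iG iS2.
  set X1 := (X in continuous X) in cX1 iX1 X10.
  set X2 := (X in continuous X) in cX2 iX2 X20.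
  pose psi := tens (scl G m.1 s) (scl H m.2 s); pose e : plane R := (0, sg).
  have dE x : dirder e psi x = sg * (s^-1 * scl (derive1 H) m.2 s x.2 * scl G m.1 s x.1).
    rewrite /dirder /e /= mul0r add0r /psi pd2_tens; last exact: (scl_smooth _ _ sH 1%N).1.
    by rewrite scl_derive// /tens; ring.
  apply: (fin e psi X1 X2 sg sgc).
  + by rewrite /enorm /dot /= mulr0 add0r -expr2 sqrtr_sqr.
  + move=> U; exact: (test_fun_tens (scl_smooth _ _ sG) (scl_smooth _ _ sH) (scl_off s0 oG) (scl_off s0 oH)).
  + by move=> x; rewrite /psi /tens mulrC; apply: bnd; [left; exact: hM1|exact: hM2].
  + by move=> x; rewrite dE; apply: sbnd; [|exact: hM3|exact: hM2].
  + by move=> x; rewrite dE /X1 /X2 /tens /scl H' /=; ring.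
  + exact: cX1.
  + exact: cX2.
  + exact: iX1.
  + exact: iX2.
  + move=> x /X10[h2 a1]; split.
      by apply/boxcP; split; [exact: (box_lin s0 N2 P2 h2)|exact: (box_lin s0 (lexx _) N2P1 a1)].
    have := @dominated (- (x.2 - m.2)) (- (x.1 - m.1)) n.2 (sg * n.1).
    rewrite (normrM sg) sg1 mul1r => /(_ s (ltW n21)) h.
    have -> : - (sg * dot n (x - m)) = `|n.2| * - (x.2 - m.2) + sg * n.1 * - (x.1 - m.1).
      by rewrite -sgn2 /dot /=; ring.
    by apply: h; [exact: half_low a1|rewrite ?normrN; exact: halfP h2].
  + move=> x /X20[h2 a1]; split.
      by apply/boxcP; split; [exact: (box_lin s0 N2 P2 h2)|exact: (box_lin s0 N1P2 (lexx _) a1)].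
    have := @dominated (x.2 - m.2) (x.1 - m.1) n.2 (sg * n.1).
    rewrite (normrM sg) sg1 mul1r => /(_ s (ltW n21)) h.
    have -> : sg * dot n (x - m) = `|n.2| * (x.2 - m.2) + sg * n.1 * (x.1 - m.1).
      by rewrite -sgn2 /dot /=; ring.
    by apply: h; [exact: half_up a1|rewrite ?normrN; exact: halfP h2].
Qed.

End Transport.

(** * Triangles *)

Section TriangleGeometry.
Variable R : realType.
Implicit Types (a b c x y m n : plane R) (K : triangle R) (i j : 'I_3).
Local Notation leb := (leb2 R).
Local Notation mset D := (measurable (D : set (mplane R))).

Lemma plane_eq x y : x.1 = y.1 -> x.2 = y.2 -> x = y.
Proof. by case: x => a b; case: y => c d /= -> ->. Qed.

Lemma ordS_neq i : ordS i != i.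
Proof. by case: i => [[|[|[|]]]]. Qed.

Lemma ord_pred_neq i : ord_pred i != i.
Proof. by case: i => [[|[|[|]]]]. Qed.

Lemma ord_pred_ordS i : ord_pred i != ordS i.
Proof. by case: i => [[|[|[|]]]]. Qed.

Lemma ordSS i : ordS (ordS i) = ord_pred i.
Proof. by apply: val_inj; case: i => [[|[|[|]]]]. Qed.

Lemma ord_predP i : ord_pred (ord_pred i) = ordS i.
Proof. by apply: val_inj; case: i => [[|[|[|]]]]. Qed.

Lemma ord3_cases i j : [\/ j = i, j = ordS i | j = ord_pred i].
Proof.
case: i => [[|[|[|]]]] // hi; case: j => [[|[|[|]]]] // hj;
  solve [by constructor 1; exact: val_inj|by constructor 2; exact: val_inj
        |by constructor 3; exact: val_inj].
Qed.

Lemma sum3 (V : nmodType) i (F : 'I_3 -> V) :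
  \sum_(k < 3) F k = F i + F (ordS i) + F (ord_pred i).
Proof.
rewrite (bigD1 i)//= (bigD1 (ordS i)) ?ordS_neq//= (bigD1 (ord_pred i)); last first.
  by rewrite ord_pred_neq ord_pred_ordS.
rewrite /= big1 ?addr0 ?addrA// => k /andP[/andP[k1 k2] k3].
by case: (ord3_cases i k) k1 k2 k3 => ->; rewrite eqxx.
Qed.

(** Twice the area of the triangle, up to sign. *)
Definition det3 a b c : R := dot (a - b) (perp (c - b)).

Lemma det3_rot a b c : det3 b c a = det3 a b c.
Proof. by rewrite /det3 /dot /perp /=; ring. Qed.

(** The gradient of [bary K i], the barycentric coordinate of the vertex [K i], which vanishes on
    the opposite side. *)
Definition bgrad K i : plane R :=
  smul (det3 (K i) (side_src K i) (side_tgt K i))^-1 (perp (side_tgt K i - side_src K i)).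

Definition bary K i x : R := dot (bgrad K i) (x - side_src K i).

Lemma nondegenerate_det K i : Defs.nondegenerate K -> det3 (K i) (side_src K i) (side_tgt K i) != 0.
Proof.
rewrite /Defs.nondegenerate /side_src /side_tgt.
have h0 : K (inord 1) = K (ordS ord0) by congr (K _); apply: val_inj; rewrite /= inordK.
have h1 : K (inord 2) = K (ord_pred ord0) by congr (K _); apply: val_inj; rewrite /= inordK.
have -> : dot (K (inord 1) - K ord0) (perp (K (inord 2) - K ord0)) =
    det3 (K (ordS ord0)) (K ord0) (K (ord_pred ord0)) by rewrite h0 h1.
have -> : det3 (K (ordS ord0)) (K ord0) (K (ord_pred ord0)) =
    - det3 (K ord0) (K (ordS ord0)) (K (ord_pred ord0)).
  by rewrite /det3 /dot /perp /=; ring.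
rewrite oppr_eq0.
case: (ord3_cases ord0 i) => ->//.
  by rewrite ordSS ordSK (det3_rot (K ord0)).
by rewrite ord_predP ord_predK (det3_rot (K (ordS ord0))) (det3_rot (K ord0)).
Qed.

Lemma baryB K i x y : bary K i x - bary K i y = dot (bgrad K i) (x - y).
Proof. by rewrite /bary /dot /=; ring. Qed.

Lemma bary_lerp K i a b (t : R) : bary K i (lerp a b t) = (1 - t) * bary K i a + t * bary K i b.
Proof.
rewrite /bary; move: (bgrad K i) (side_src K i) => g d.
by rewrite /lerp /dot /smul /=; ring.
Qed.

Section Nondegenerate.
Variable K : triangle R.
Hypothesis ndK : Defs.nondegenerate K.

Lemma bary_vertex i : bary K i (K i) = 1.
Proof.
have := nondegenerate_det i ndK.
rewrite /bary /bgrad; set d := det3 _ _ _ => d0.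
have -> : dot (smul d^-1 (perp (side_tgt K i - side_src K i))) (K i - side_src K i) = d^-1 * d.
  by rewrite /d /det3 /dot /smul /perp /=; ring.
by rewrite mulVf.
Qed.

Lemma bary_src i : bary K i (side_src K i) = 0.
Proof. by rewrite /bary subrr /dot /= !mulr0 addr0. Qed.

Lemma bary_tgt i : bary K i (side_tgt K i) = 0.
Proof. by rewrite /bary /bgrad /dot /smul /perp /=; ring. Qed.

Lemma bary_coords x : [/\ \sum_i bary K i x = 1 & x = \sum_i smul (bary K i x) (K i)].
Proof.
have := nondegenerate_det ord0 ndK.
have := nondegenerate_det (ordS ord0) ndK.
have := nondegenerate_det (ord_pred ord0) ndK.
rewrite !(sum3 ord0) /bary /bgrad /side_src /side_tgt.
rewrite ord_predP ordSS ordSK ord_predK.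
set a := K ord0; set b := K (ordS ord0); set c := K (ord_pred ord0).
rewrite (det3_rot a b c) (det3_rot b c a) (det3_rot a b c) => _ _ d0.
have dE : det3 a b c = (a.1 - b.1) * - (c.2 - b.2) + (a.2 - b.2) * (c.1 - b.1).
  by rewrite /det3 /dot /perp.
rewrite dE in d0 *; split.
  by rewrite /dot /smul /perp /=; field.
have fstD (p q : plane R) : (p + q).1 = p.1 + q.1 by [].
have sndD (p q : plane R) : (p + q).2 = p.2 + q.2 by [].
by apply: plane_eq; rewrite ?fstD ?sndD /dot /smul /perp /=; field.
Qed.

Lemma bary_lin (l : 'I_3 -> R) i : \sum_k l k = 1 ->
  bary K i (\sum_k smul (l k) (K k)) = l i.
Proof.
rewrite !(sum3 i) => l1; rewrite /bary.
have e : l i = l i * bary K i (K i) + l (ordS i) * bary K i (side_src K i) +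
   l (ord_pred i) * bary K i (side_tgt K i).
  by rewrite bary_vertex bary_src bary_tgt; ring.
rewrite [RHS]e /bary /side_src /side_tgt.
have -> : l i = 1 - l (ordS i) - l (ord_pred i) by rewrite -l1; ring.
rewrite /dot /smul /=; ring.
Qed.

Lemma triP x : tri K x <-> forall i, 0 <= bary K i x.
Proof.
have [s1 s2] := bary_coords x; split => [[l [l0 l1 ->]] i|h].
  by rewrite bary_lin.
by exists (fun i => bary K i x).
Qed.

Lemma bary_le1 x i : tri K x -> bary K i x <= 1.
Proof.
move=> /triP h; have [<- _] := bary_coords x; rewrite (sum3 i).
by have := h (ordS i); have := h (ord_pred i); lra.
Qed.

Lemma tri_vertex i : tri K (K i).
Proof.
apply/triP => j; have [->|->|->] := ord3_cases i j.
- by rewrite bary_vertex.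
- by rewrite (_ : K i = side_tgt K (ordS i)) ?bary_tgt// /side_tgt ordSK.
- by rewrite (_ : K i = side_src K (ord_pred i)) ?bary_src// /side_src ord_predK.
Qed.

Lemma continuous_bary i : continuous (bary K i).
Proof.
rewrite (_ : bary K i = fun x => dot (bgrad K i) x - dot (bgrad K i) (side_src K i)).
  by move=> x; apply: continuousB; [exact: continuous_dotr|exact: cst_continuous].
by apply/funext => x; rewrite /bary /dot /=; ring.
Qed.

Lemma closed_tri : closed (tri K).
Proof.
have -> : tri K = \bigcap_(i in [set: 'I_3]) [set x | 0 <= bary K i x].
  by apply/seteqP; split => x /=; [move=> /triP h i _; exact: h|move=> h; apply/triP => i; exact: h].
apply: closed_bigI => i _.
exact: (@preimage_closed _ _ (bary K i) [set y | 0 <= y] (fun x _ => @continuous_bary i x) (@closed_ge R 0)).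
Qed.

Lemma measurable_tri : mset (tri K).
Proof. exact: closed_measurable2 closed_tri. Qed.

Lemma bgrad_neq0 i : bgrad K i != 0.
Proof.
apply/eqP => h; have := bary_vertex i; rewrite /bary h /dot /= !mul0r addr0.
by move/eqP; rewrite eq_sym oner_eq0.
Qed.

(** Away from the three lines carrying the sides, the coordinates of a point of the triangle are
    positive, and this is an open condition. The lines are null. *)
Lemma interior_tri_ae : {ae leb, forall x, tri K x -> interior (tri K) x}.
Proof.
pose L i : set (plane R) := [set x | dot (bgrad K i) x = dot (bgrad K i) (side_src K i)].
have nL i : {ae leb, forall x, ~ L i x}.
  have cL : closed (L i).
    rewrite (_ : L i = dot (bgrad K i) @^-1` [set dot (bgrad K i) (side_src K i)]).
      apply: preimage_closed; first by move=> x _; exact: continuous_dotr.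
      exact: closed_eq.
    by [].
  exists (L i); split; [exact: closed_measurable2|exact: line_null (bgrad_neq0 i)|].
  by move=> x /contrapT.
have := ae2_and (nL ord0) (ae2_and (nL (ordS ord0)) (nL (ord_pred ord0))).
apply: ae2W => x [n0 [n1 n2]] /triP tx.
have pos i : 0 < bary K i x.
  rewrite lt_neqAle tx andbT eq_sym; apply/eqP => h.
  have Li : L i x.
    by move: h; rewrite /L /= /bary /dot /= => h; apply/eqP; rewrite -subr_eq0; apply/eqP; rewrite -h; ring.
  by case: (ord3_cases ord0 i) Li => ->.
pose V i : set (plane R) := [set y | 0 < bary K i y].
have oV i : open (V i).
  exact: (open_comp (fun x _ => @continuous_bary i x) (@open_gt R 0)).
pose U := V ord0 `&` (V (ordS ord0) `&` V (ord_pred ord0)).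
have oU : open U by do 2! apply: openI => //.
have Ux : U x by split; [exact: pos|split; exact: pos].
have UK : U `<=` tri K.
  move=> y [y0 [y1 y2]]; apply/triP => i; apply: ltW.
  by case: (ord3_cases ord0 i) => ->.
exact: (filterS UK (open_nbhs_nbhs (conj oU Ux))).
Qed.

Lemma smul_perp_dot (a : R) w x : dot (smul a w) x = a * dot w x.
Proof. by rewrite /dot /smul /=; ring. Qed.

Lemma enorm_smul (a : R) x : enorm (smul a x) = `|a| * enorm x.
Proof.
rewrite /enorm (_ : dot (smul a x) (smul a x) = a ^+ 2 * dot x x); last first.
  by rewrite /dot /smul /=; ring.
by rewrite sqrtrM ?sqr_ge0// sqrtr_sqr.
Qed.

Lemma enorm_gt0 x : x != 0 -> 0 < enorm x.
Proof.
by move=> x0; rewrite lt_neqAle enorm_ge0 andbT eq_sym; apply: contra_neq x0; exact: enorm_eq0.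
Qed.

Lemma enormN x : enorm (- x) = enorm x.
Proof. by rewrite /enorm /dot /= !mulrNN. Qed.

Lemma enormD x y : enorm (x + y) <= enorm x + enorm y.
Proof.
rewrite -(@ler_pXn2r _ 2)// ?nnegrE ?addr_ge0 ?enorm_ge0//.
rewrite sqrrD !enormE /=.
by have := ler_norm (dot x y); have := dot_le x y; rewrite /dot mulr2n; lra.
Qed.

Section Inball.
Variables (c : plane R) (rho : R).
Hypotheses (rho0 : 0 < rho) (inb : forall x, enorm (x - c) <= rho -> tri K x).

(* On the two ends of the diameter along its gradient, a barycentric coordinate
   takes values in [0, 1]. *)
Lemma bgrad_le i : 2 * rho * enorm (bgrad K i) <= 1.
Proof.
have g0 := enorm_gt0 (bgrad_neq0 i); set g := bgrad K i in g0 *.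
pose w := smul (rho / enorm g) g.
have ew : enorm w = rho.
  by rewrite enorm_smul normrM normfV !gtr0_norm// -mulrA mulVf ?mulr1// gt_eqF.
have t1 : tri K (c + w) by apply: inb; rewrite (_ : c + w - c = w) ?ew//; rewrite addrC addKr.
have t2 : tri K (c - w).
  by apply: inb; rewrite (_ : c - w - c = - w) ?enormN ?ew//; rewrite addrC addKr.
have := bary_le1 i t1; have /(triP _)/(_ i) := t2; have := baryB K i (c + w) (c - w).
have -> : dot (bgrad K i) (c + w - (c - w)) = 2 * rho * enorm g.
  transitivity (2 * (rho / enorm g) * enorm g ^+ 2).
    rewrite enormE /w /g /dot /smul /=; ring.
  by rewrite expr2; field; rewrite gt_eqF.
by lra.
Qed.

(** Along side i the barycentric coordinate of its first end point drops from 1 to 0, while its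
    gradient is at most 1/(2 rho). *)
Lemma side_length_ge i : 2 * rho <= enorm (side_tgt K i - side_src K i).
Proof.
have h := baryB K (ordS i) (side_src K i) (side_tgt K i).
have e1 : bary K (ordS i) (side_src K i) = 1 by exact: bary_vertex.
have e2 : bary K (ordS i) (side_tgt K i) = 0.
  by rewrite (_ : side_tgt K i = side_src K (ordS i)) ?bary_src// /side_src /side_tgt ordSS.
rewrite e1 e2 subr0 in h.
have := dot_le (bgrad K (ordS i)) (side_src K i - side_tgt K i).
rewrite -{1}h normr1 -[enorm (side_src K i - _)]enormN opprB => h1.
have h2 := bgrad_le (ordS i); set l := enorm (_ - _) in h1 *.
have l0 : 0 <= l by exact: enorm_ge0.
have g0 : 0 <= enorm (bgrad K (ordS i)) by exact: enorm_ge0.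
have : 2 * rho * 1 <= 2 * rho * (enorm (bgrad K (ordS i)) * l) by rewrite ler_wpM2l// mulr_ge0// ltW.
have : (2 * rho * enorm (bgrad K (ordS i))) * l <= 1 * l by rewrite ler_wpM2r.
by rewrite mulr1 mul1r mulrA; lra.
Qed.

End Inball.

Lemma side_vector_neq0 i : side_tgt K i - side_src K i != 0.
Proof.
apply/eqP => h; have := bgrad_neq0 i; rewrite /bgrad h => /eqP; apply.
by apply: plane_eq; rewrite /smul /perp /= ?oppr0 mulr0.
Qed.

(** The normalised gradient of [bary K i] satisfies the three conditions, so [xget] does not return
    its default 0. *)
Lemma side_normalP i : let n := side_normal K i in
  [/\ enorm n = 1, dot n (side_tgt K i - side_src K i) = 0 & 0 < dot n (K i - side_src K i)].
Proof.
apply: (xgetPex 0 (P := [set n | [/\ enorm n = 1, dot n (side_tgt K i - side_src K i) = 0 &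
                      0 < dot n (K i - side_src K i)]])).
have g0 := enorm_gt0 (bgrad_neq0 i).
exists (smul (enorm (bgrad K i))^-1 (bgrad K i)); split.
- by rewrite enorm_smul normfV gtr0_norm// mulVf// gt_eqF.
- by rewrite smul_perp_dot -baryB bary_src bary_tgt subrr mulr0.
- by rewrite smul_perp_dot -baryB bary_src bary_vertex subr0 mulr1 invr_gt0.
Qed.

Definition midpoint i : plane R := lerp (side_src K i) (side_tgt K i) 2^-1.

(** In the plane the vectors orthogonal to [w] form a line; [par] is the vanishing of the
    determinant of [g] and [n]. *)
Lemma orthogonal_unit (w n g : plane R) : w != 0 -> enorm n = 1 -> dot n w = 0 -> dot g w = 0 ->
  g = smul (dot g n) n.
Proof.
move=> w0 n1 nw gw.
have ww : 0 < w.1 ^+ 2 + w.2 ^+ 2 by rewrite -enormE exprn_gt0// enorm_gt0.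
have nn : n.1 ^+ 2 + n.2 ^+ 2 = 1 by rewrite -enormE n1 expr1n.
have par : g.1 * n.2 - g.2 * n.1 = 0.
  apply/eqP; move: nw gw; rewrite /dot => nw gw.
  have : (g.1 * n.2 - g.2 * n.1) * (w.1 ^+ 2 + w.2 ^+ 2) == 0.
    have -> : (g.1 * n.2 - g.2 * n.1) * (w.1 ^+ 2 + w.2 ^+ 2) =
      (g.1 * w.1 + g.2 * w.2) * (w.1 * n.2 - w.2 * n.1) -
      (n.1 * w.1 + n.2 * w.2) * (w.1 * g.2 - w.2 * g.1) by ring.
    by rewrite nw gw !mul0r subrr.
  by rewrite mulf_eq0 (gt_eqF ww) orbF.
apply: plane_eq; rewrite /smul /dot /=.
  transitivity (g.1 * (n.1 ^+ 2 + n.2 ^+ 2) - n.2 * (g.1 * n.2 - g.2 * n.1)); last by ring.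
  by rewrite nn par; ring.
transitivity (g.2 * (n.1 ^+ 2 + n.2 ^+ 2) + n.1 * (g.1 * n.2 - g.2 * n.1)); last by ring.
by rewrite nn par; ring.
Qed.

(** On the inner side of side i the coordinate i is nonnegative. The two others equal 1/2 at the
    midpoint and change by at most 1/2 over a distance [rho], by [bgrad_le]. *)
Lemma half_disk_tri c (rho : R) i x : 0 < rho ->
  (forall x, enorm (x - c) <= rho -> tri K x) ->
  enorm (x - midpoint i) <= rho -> 0 <= dot (side_normal K i) (x - midpoint i) -> tri K x.
Proof.
move=> rho0 inb xm; set n := side_normal K i => nx.
have [n1 nw nK] := side_normalP i; rewrite -/n in n1 nw nK.
have gE := orthogonal_unit (side_vector_neq0 i) n1 nw.
have g1 : dot (bgrad K i) (side_tgt K i - side_src K i) = 0.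
  by rewrite -baryB bary_src bary_tgt subrr.
have {}gE := gE _ g1; set al := dot (bgrad K i) n in gE.
have al0 : 0 < al.
  have := bary_vertex i; rewrite /bary gE smul_perp_dot => h.
  by rewrite -(pmulr_lgt0 _ nK) h.
have hm j (q : R) : bary K j (midpoint i) = q -> `|bary K j x - q| <= 2^-1.
  move=> <-; rewrite baryB; apply: (le_trans (dot_le _ _)).
  have h1 := bgrad_le rho0 inb j; have g0 : 0 <= enorm (bgrad K j) by exact: enorm_ge0.
  apply: (@le_trans _ _ (enorm (bgrad K j) * rho)); first by rewrite ler_wpM2l.
  by lra.
have mE j : bary K j (midpoint i) = 2^-1 * bary K j (side_src K i) + 2^-1 * bary K j (side_tgt K i).
  by rewrite bary_lerp; congr (_ * _ + _); lra.
apply/triP => j; have [->|->|->] := ord3_cases i j.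
- have -> : bary K i x = al * dot n (x - midpoint i).
    rewrite -smul_perp_dot -gE -baryB mE bary_src bary_tgt; ring.
  by rewrite mulr_ge0// ltW.
- have := hm (ordS i) 2^-1; rewrite mE.
  have -> : bary K (ordS i) (side_src K i) = 1 by exact: bary_vertex.
  have -> : bary K (ordS i) (side_tgt K i) = 0.
    by rewrite (_ : side_tgt K i = side_src K (ordS i)) ?bary_src// /side_src /side_tgt ordSS.
  by rewrite mulr0 addr0 mulr1 => /(_ erefl); rewrite ler_norml => /andP[h _]; lra.
- have := hm (ord_pred i) 2^-1; rewrite mE.
  have -> : bary K (ord_pred i) (side_tgt K i) = 1 by exact: bary_vertex.
  have -> : bary K (ord_pred i) (side_src K i) = 0.
    by rewrite (_ : side_src K i = side_tgt K (ord_pred i)) ?bary_tgt// /side_src /side_tgt ord_predP.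
  by rewrite mulr0 add0r mulr1 => /(_ erefl); rewrite ler_norml => /andP[h _]; lra.
Qed.

Lemma bary_side i x : side K i x -> bary K i x = 0.
Proof.
move=> [t _ <-]; have -> : bary K i (lerp (side_src K i) (side_tgt K i) t) =
    (1 - t) * bary K i (side_src K i) + t * bary K i (side_tgt K i).
  exact: bary_lerp.
by rewrite bary_src bary_tgt; ring.
Qed.

Lemma side_inj i j : side K i = side K j -> i = j.
Proof.
have src k : side K k (side_src K k).
  by exists 0; [rewrite /= in_itv /= lexx ler01|apply: plane_eq; rewrite /lerp /smul /=; ring].
have tgt k : side K k (side_tgt K k).
  by exists 1; [rewrite /= in_itv /= lexx ler01|apply: plane_eq; rewrite /lerp /smul /=; ring].
have one k : bary K k (K k) <> 0 by rewrite bary_vertex; apply/eqP; rewrite oner_eq0.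
move=> e; have [->//|h|h] := ord3_cases i j; case: (one i).
- apply: bary_side; rewrite e h (_ : K i = side_tgt K (ordS i)) // /side_tgt ordSK //.
- apply: bary_side; rewrite e h (_ : K i = side_src K (ord_pred i)) // /side_src ord_predK //.
Qed.

End Nondegenerate.
End TriangleGeometry.

(** * Meshes *)

Section MeshGeometry.
Variable R : realType.
Implicit Types (a b c x y m n w : plane R) (K L : triangle R) (i j : 'I_3) (D : set (plane R)).
Local Notation leb := (leb2 R).
Local Notation mset D := (measurable (D : set (mplane R))).

Lemma continuous_enorm : continuous (@enorm R).
Proof.
move=> x; apply: (@continuous_comp _ _ _ (fun v : plane R => dot v v) (@Num.sqrt R)).
  have c1 : continuous (fun v : plane R => v.1) by move=> v; exact: cvg_fst.
  have c2 : continuous (fun v : plane R => v.2) by move=> v; exact: cvg_snd.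
  exact: (@continuousD _ _ _ (fun v : plane R => v.1 * v.1) (fun v : plane R => v.2 * v.2) x
    (@continuousM_plane R _ _ c1 c1 x) (@continuousM_plane R _ _ c2 c2 x)).
exact: sqrt_continuous.
Qed.

Lemma closure_bounded D (M : R) : (forall x, D x -> enorm x <= M) ->
  forall x, closure D x -> enorm x <= M.
Proof.
move=> DM; have cM : closed [set x : plane R | enorm x <= M].
  exact: (@preimage_closed _ _ (@enorm R) [set y | y <= M] (fun x _ => @continuous_enorm x) (@closed_le R M)).
by move=> x cx; apply: cM; exact: (closureS DM cx).
Qed.

Lemma smul_eq0 (k : R) w : w != 0 -> smul k w = 0 -> k = 0.
Proof.
move=> w0 h; have /eqP := enorm_smul k w; rewrite h (_ : enorm 0 = 0); last first.
  by rewrite /enorm /dot /= !mulr0 addr0 sqrtr0.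
by rewrite eq_sym mulf_eq0 (gt_eqF (enorm_gt0 w0)) orbF normr_eq0 => /eqP.
Qed.

Lemma segment_ends a b : segment a b a /\ segment a b b.
Proof.
split.
  by exists 0; [rewrite /= in_itv /= lexx ler01|apply: plane_eq; rewrite /lerp /smul /=; ring].
by exists 1; [rewrite /= in_itv /= lexx ler01|apply: plane_eq; rewrite /lerp /smul /=; ring].
Qed.

(** The end points are extreme: [a] and [b] are convex combinations of [a'] and [b'], whose
    parameters t and t' on [a, b] lie in [0, 1]; the values 0 and 1 can be reached only if t and t'
    are 0 and 1 in some order. *)
Lemma segment_inj a b a' b' : a != b -> segment a b = segment a' b' ->
  (a' = a /\ b' = b) \/ (a' = b /\ b' = a).
Proof.
move=> ab e; have w0 : b - a != 0 by rewrite subr_eq0 eq_sym.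
have [sa sb] := segment_ends a b; have [sa' sb'] := segment_ends a' b'.
rewrite e in sa sb; rewrite -e in sa' sb'.
case: sa' => t /=; rewrite in_itv /= => /andP[t0 t1] ta.
case: sb' => t' /=; rewrite in_itv /= => /andP[t'0 t'1] tb.
case: sa => u /=; rewrite in_itv /= => /andP[u0 u1] ua.
case: sb => v /=; rewrite in_itv /= => /andP[v0 v1] vb.
have eu : (1 - u) * t + u * t' = 0.
  apply: (smul_eq0 w0); have : lerp a' b' u - a = 0 by rewrite ua subrr.
  rewrite -ta -tb => h; rewrite -[RHS]h.
  by apply: plane_eq; rewrite /lerp /smul /=; ring.
have ev : (1 - v) * t + v * t' = 1.
  apply/eqP; rewrite -subr_eq0; apply/eqP; apply: (smul_eq0 w0).
  have : lerp a' b' v - b = 0 by rewrite vb subrr.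
  rewrite -ta -tb => h; rewrite -[RHS]h.
  by apply: plane_eq; rewrite /lerp /smul /=; ring.
have [t0'|tn0] := eqVneq t 0.
  have t'1' : t' = 1.
    by apply/eqP; rewrite eq_le t'1 /= -ev t0' mulr0 add0r ler_piMl.
  left; rewrite -ta -tb t0' t'1'.
  by split; apply: plane_eq; rewrite /lerp /smul /=; ring.
have u1' : u = 1.
  have h1 : 0 <= (1 - u) * t by rewrite mulr_ge0// subr_ge0.
  have h2 : 0 <= u * t' by rewrite mulr_ge0.
  have /eqP : (1 - u) * t = 0 by lra.
  by rewrite mulf_eq0 (negbTE tn0) orbF subr_eq0 => /eqP.
have t'0' : t' = 0 by move: eu; rewrite u1' subrr mul0r mul1r add0r.
have t1' : t = 1.
  by apply/eqP; rewrite eq_le t1 /= -ev t'0' mulr0 addr0 ler_piMl// lerBlDr lerDl.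
right; rewrite -ta -tb t1' t'0'.
by split; apply: plane_eq; rewrite /lerp /smul /=; ring.
Qed.

Section Diameter.
Variables (K : triangle R) (M : R).
Hypotheses (ndK : Defs.nondegenerate K) (KM : forall x, tri K x -> enorm x <= M).

Let dist_le x y : tri K x -> tri K y -> enorm (x - y) <= 2 * M.
Proof.
move=> /KM hx /KM hy; have := enormD x (- y); rewrite enormN; lra.
Qed.

Lemma enorm_le_hK x y : tri K x -> tri K y -> enorm (x - y) <= hK K.
Proof.
move=> tx ty; apply: ub_le_sup.
  by exists (2 * M) => _ [[p q] [/= tp tq] <-]; exact: dist_le.
by exists (x, y).
Qed.

Lemma hK_le : hK K <= 2 * M.
Proof.
apply: ge_sup; first by exists 0, (K ord0, K ord0) => /=; [split; exact: tri_vertex|rewrite subrr /enorm /dot /= !mulr0 addr0 sqrtr0].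
by move=> _ [[p q] [/= tp tq] <-]; exact: dist_le.
Qed.

Lemma hK_gt0 : 0 < hK K.
Proof.
apply: (@lt_le_trans _ _ (enorm (side_tgt K ord0 - side_src K ord0))).
  exact: enorm_gt0 (side_vector_neq0 ndK _).
by apply: enorm_le_hK; exact: tri_vertex.
Qed.

(** [indiam] is a supremum, so only a disk of diameter larger than half of it is taken; this
    accounts for 4 instead of 2 in the radius. *)
Lemma inscribed_disk (sigma : R) : 1 <= sigma -> hK K <= sigma * indiam K ->
  exists c, forall x, enorm (x - c) <= hK K / (4 * sigma) -> tri K x.
Proof.
move=> s1 hs; have s0 : 0 < sigma by exact: lt_le_trans s1.
have h0 := hK_gt0; have i0 : 0 < indiam K.
  by rewrite -(pmulr_rgt0 _ s0); exact: lt_le_trans hs.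
set E := [set d | exists (c : plane R) (r : R), [/\ 0 <= r, d = 2 * r &
    forall x, enorm (x - c) <= r -> tri K x]] in i0 *.
(* Without a supremum [sup] is 0, which the positivity of [indiam K] excludes. *)
have [hE|/sup_out e] := pselect (has_sup E); last by move: i0; rewrite /indiam e ltxx.
have := @sup_adherent R E (indiam K / 2) _ hE.
rewrite divr_gt0// => /(_ isT)[_ [c [r [r0 -> hr]]]] h.
exists c => x xc; apply: hr; apply: (le_trans xc).
rewrite ler_pdivrMr ?mulr_gt0//.
have : indiam K / 2 < 2 * r by move: h; rewrite -/(indiam K); lra.
move=> h2; apply: (le_trans hs); rewrite mulrCA [leRHS]mulrC.
by rewrite [leRHS](_ : _ = sigma * (4 * r)); [rewrite ler_pM2l//; lra|ring].
Qed.

End Diameter.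

Lemma enorm_box (s : R) c x : boxc c s x -> enorm (x - c) <= 2 * s.
Proof. by move=> /boxcP[h1 h2]; exact: enorm_sub_ball. Qed.

(** The doubled box makes the small one a subset of the interior of the closure, which is contained
    in [D] by [interior_closure_lipschitz]. *)
Lemma boxc_interior D (s : R) c : open D -> lipschitz_boundary D -> 0 < s ->
  (forall x, boxc c (2 * s) x -> closure D x) -> boxc c s `<=` D.
Proof.
move=> oD lD s0 h x /boxcP[x1 x2]; apply: interior_closure_lipschitz => //.
have bx : ball c (2 * s) x.
  by apply/ball_planeP; rewrite distrC [X in _ /\ X < _]distrC; split; lra.
apply: (@filterS _ _ _ (ball c (2 * s))) => [y /ball_planeP[y1 y2]|].
  by apply: h; apply/boxcP; rewrite distrC [X in _ /\ X <= _]distrC !ltW.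
apply: open_nbhs_nbhs; split => //; apply: ball_open; lra.
Qed.

Section Mesh.
Variables (D : set (plane R)) (Th : seq (triangle R)) (M sigma : R).
Hypotheses (oD : open D) (lD : lipschitz_boundary D) (DM : forall x, D x -> enorm x <= M).
Hypotheses (cTh : conforming_mesh D Th) (sigma1 : 1 <= sigma).
Hypothesis regTh : forall K, K \in Th -> hK K <= sigma * indiam K.

Let ndTh K : K \in Th -> Defs.nondegenerate K. Proof. by case: cTh => _ h _ _; exact: h. Qed.

Lemma tri_closure K : K \in Th -> tri K `<=` closure D.
Proof. by move=> KTh x Kx; case: cTh => _ _ -> _; exists K. Qed.

Lemma tri_bounded K : K \in Th -> forall x, tri K x -> enorm x <= M.
Proof. by move=> KTh x /(tri_closure KTh); exact: closure_bounded. Qed.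

Lemma interior_tri_domain K : K \in Th -> interior (tri K) `<=` D.
Proof.
move=> KTh x xi; apply: interior_closure_lipschitz => //.
by apply: filterS xi; exact: tri_closure.
Qed.

Lemma mesh_hK_gt0 K : K \in Th -> 0 < hK K.
Proof. by move=> KTh; exact: hK_gt0 (ndTh KTh) (tri_bounded KTh). Qed.

Lemma mesh_disk K : K \in Th ->
  exists c, forall x, enorm (x - c) <= hK K / (4 * sigma) -> tri K x.
Proof. move=> KTh; exact: (inscribed_disk (ndTh KTh) (@tri_bounded K KTh) sigma1 (regTh KTh)). Qed.

(** The half side is the one of [mesh_side], so that residuals and jumps share the scale. The second
    power of [sigma] leaves room there for the inscribed disk of a neighbour, which may be smaller
    by a factor 2 sigma. *)
Lemma mesh_box K : K \in Th -> let s := hK K / (32 * sigma ^+ 2) in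
  exists c, [/\ boxc c s `<=` tri K, boxc c s `<=` D & tri K `<=` boxc c (32 * sigma ^+ 2 * s)].
Proof.
move=> KTh s; have h0 := mesh_hK_gt0 KTh; have [c hc] := mesh_disk KTh.
have s0 : 0 < sigma by exact: lt_le_trans sigma1.
have s20 : 0 < 32 * sigma ^+ 2 by rewrite mulr_gt0// exprn_gt0.
have sp : 0 < s by rewrite divr_gt0.
have s4 : 4 * s <= hK K / (4 * sigma).
  rewrite /s mulrA ler_pdivrMr// mulrAC ler_pdivlMr ?mulr_gt0//.
  have h1 : hK K * sigma * 16 <= hK K * sigma * (32 * sigma).
    by apply: ler_wpM2l; [rewrite mulr_ge0// ltW|have := sigma1; lra].
  by move: h1; rewrite expr2; lra.
have b2 : boxc c (2 * s) `<=` tri K.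
  move=> x /enorm_box h; apply: hc; apply: (le_trans h); lra.
have tc : tri K c by apply: b2; apply/boxcP; rewrite !subrr normr0; split; lra.
exists c; split.
- by move=> x /boxcP[x1 x2]; apply: b2; apply/boxcP; split; lra.
- by apply: boxc_interior => // x /b2; exact: tri_closure.
- move=> x tx; have := enorm_le_hK (tri_bounded KTh) tx tc.
  have -> : 32 * sigma ^+ 2 * s = hK K by rewrite /s mulrC mulfVK// gt_eqF.
  move=> h; apply/boxcP; split; first exact: le_trans (enorm_ge1 (x - c)) h.
  exact: le_trans (enorm_ge2 (x - c)) h.
Qed.

Lemma bgrad_normal_gt0 K i : Defs.nondegenerate K -> 0 < dot (bgrad K i) (side_normal K i).
Proof.
move=> ndK; have [n1 nw nK] := side_normalP ndK i; set n := side_normal K i in n1 nw nK *.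
have g1 : dot (bgrad K i) (side_tgt K i - side_src K i) = 0.
  by rewrite -baryB bary_src bary_tgt subrr.
have gE := orthogonal_unit (side_vector_neq0 ndK i) n1 nw g1.
have := bary_vertex ndK i; rewrite /bary gE smul_perp_dot => h.
by rewrite -gE -(pmulr_lgt0 _ nK) h.
Qed.

Lemma bary_midpoint K i : bary K i (midpoint K i) = 0.
Proof. by rewrite bary_lerp bary_src bary_tgt !mulr0 addr0. Qed.

(* If the normals agreed, both triangles would contain a half disk around the
   midpoint, and their intersection would not be a common side. *)
Lemma opposite_normals K L i j : K \in Th -> L \in Th -> K != L -> side K i = side L j ->
  midpoint L j = midpoint K i /\ side_normal L j = - side_normal K i.
Proof.
move=> KTh LTh KL e; have ndK := ndTh KTh; have ndL := ndTh LTh.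
have [n1 nw nK] := side_normalP ndK i; set n := side_normal K i in n1 nw nK *.
have [n1' nw' nK'] := side_normalP ndL j; set n' := side_normal L j in n1' nw' nK' *.
have w0 := side_vector_neq0 ndK i.
have sab : side_src K i != side_tgt K i by rewrite eq_sym -subr_eq0.
have cases := segment_inj sab e.
have mE : midpoint L j = midpoint K i.
  rewrite /midpoint; case: cases => -[-> ->] //.
  by apply: plane_eq; rewrite /lerp /smul /=; field.
split=> //; have n'w : dot n' (side_tgt K i - side_src K i) = 0.
  case: cases nw' => -[-> ->] // h; rewrite -oppr0 -h /dot /=; ring.
have nE := orthogonal_unit w0 n1 nw n'w.
have : `|dot n' n| = 1 by have := enorm_smul (dot n' n) n; rewrite -nE n1 n1' mulr1.
have [d0|d0] := leP 0 (dot n' n); last first.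
  move=> h; rewrite nE (_ : dot n' n = -1); last by rewrite -h (ltr0_norm d0) opprK.
  by apply: plane_eq; rewrite /smul /=; ring.
rewrite (ger0_norm d0) => d1; exfalso; have nn : n' = n.
  by rewrite nE d1; apply: plane_eq; rewrite /smul /= mul1r.
have [c hc] := mesh_disk KTh; have [c' hc'] := mesh_disk LTh.
set r := hK K / (4 * sigma) in hc; set r' := hK L / (4 * sigma) in hc'.
have s40 : 0 < 4 * sigma by rewrite mulr_gt0//; exact: lt_le_trans sigma1.
have r0 : 0 < r by rewrite divr_gt0// mesh_hK_gt0.
have r'0 : 0 < r' by rewrite divr_gt0// mesh_hK_gt0.
(* The point [y] at distance [d] from the midpoint along the common normal lies in both half disks,
   but not on the line of the side. *)
pose d := Num.min r r'; have dp : 0 < d by rewrite lt_min r0.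
pose y := midpoint K i + smul d n.
have ym : y - midpoint K i = smul d n by rewrite /y addrC addKr.
have yd : enorm (y - midpoint K i) = d by rewrite ym enorm_smul n1 mulr1 gtr0_norm.
have yn : 0 <= dot n (y - midpoint K i).
  have -> : dot n (y - midpoint K i) = d * enorm n ^+ 2.
    by rewrite ym enormE /dot /smul /=; ring.
  by rewrite mulr_ge0 ?sqr_ge0// ltW.
have Ky : tri K y by apply: (half_disk_tri ndK r0 hc) yn; rewrite yd ge_min lexx.
have Ly : tri L y.
  by apply: (half_disk_tri ndL r'0 hc' (i := j)); rewrite mE ?yd ?ge_min ?lexx ?orbT// -/n' nn.
have KLa : (tri K `&` tri L) (side_src K i).
  split; first exact: tri_vertex.
  by case: cases => -[h1 h2]; [rewrite -h1|rewrite -h2]; exact: tri_vertex.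
have KLb : (tri K `&` tri L) (side_tgt K i).
  split; first exact: tri_vertex.
  by case: cases => -[h1 h2]; [rewrite -h2|rewrite -h1]; exact: tri_vertex.
(* The intersection contains [y] and the two distinct ends of the side, so it is neither empty nor a
   single vertex. If it is a side of [K], this side contains both ends and must be side i, but [y]
   is off its line. *)
have [_ _ _ cf] := cTh; case: (cf K L KTh LTh KL) => [h|[k [l [_ h]]]|[k [l [_ h]]]].
- have : (tri K `&` tri L) y by split.
  by rewrite h.
- move: KLa KLb; rewrite h => /= h1 h2.
  by move: sab; rewrite h1 h2 eqxx.
- have hy : (tri K `&` tri L) y by split.
  rewrite h in hy KLa KLb.
  have ya := bary_side hy; have a0 := bary_side KLa; have b0 := bary_side KLb.
  have ki : k = i.
    have one l' : bary K l' (K l') <> 0 by rewrite bary_vertex//; apply/eqP; rewrite oner_eq0.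
    by case: (ord3_cases i k) => // hk; move: a0 b0; rewrite hk => a0 b0;
      [case: (one (ordS i))|case: (one (ord_pred i))].
  have := baryB K i y (midpoint K i); rewrite -{1}ki ya bary_midpoint subrr ym.
  move=> /esym h0; have := bgrad_normal_gt0 i ndK; rewrite -/n.
  have : d * dot (bgrad K i) n = 0 by rewrite -h0 /dot /smul /=; ring.
  by move/eqP; rewrite mulf_eq0 (gt_eqF dp) /= => /eqP ->; rewrite ltxx.
Qed.

(** A third triangle with the same side would have a normal opposite to both of two opposite
    normals, hence zero. Exactly two terms of the sum survive, with opposite normals. *)
Lemma jump_internal K L i j (q : plane R -> R) : K \in Th -> L \in Th -> L != K ->
  side L j = side K i ->
  enorm (jump Th q (side K i)) = `|P0_value K q - P0_value L q|.
Proof.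
move=> KTh LTh LK e; have uTh : uniq Th by case: cTh.
have KL : K != L by rewrite eq_sym.
have [_ nE] := opposite_normals KTh LTh KL (esym e).
have [n1 _ _] := side_normalP (ndTh KTh) i.
have inner K' k : K' \in Th -> side K' k = side K i ->
    \sum_(j < 3 | `[< side K' j = side K i >]) smul (P0_value K' q) (side_normal K' j) =
    smul (P0_value K' q) (side_normal K' k).
  move=> K'Th ek; apply: big_pred1 => l; apply/asboolP/eqP => [h|->//].
  by apply: (side_inj (ndTh K'Th)); rewrite h ek.
rewrite /jump (bigD1_seq K)//= (inner K i)// -big_filter.
rewrite (bigD1_seq L) ?filter_uniq ?mem_filter ?LK//= (inner L j)//.
rewrite big_seq_cond big1 => [|K']; last first.
  rewrite mem_filter => /andP[/andP[K'K K'Th] K'L]; apply: big_pred0 => k.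
  apply/asboolP => h.
  have KK' : K != K' by rewrite eq_sym.
  have LK' : L != K' by rewrite eq_sym.
  have [_ h1] := opposite_normals KTh K'Th KK' (esym h).
  have [_ h2] := opposite_normals LTh K'Th LK' (etrans e (esym h)).
  have n0 : side_normal K i = 0.
    have : - side_normal K i = side_normal K i by rewrite -h1 h2 nE opprK.
    move=> h3; apply: plane_eq => /=.
      by have := congr1 fst h3; rewrite /=; lra.
    by have := congr1 snd h3; rewrite /=; lra.
  move: n1; rewrite n0 /enorm /dot /= !mulr0 addr0 sqrtr0 => /eqP.
  by rewrite eq_sym oner_eq0.
rewrite addr0 nE (_ : _ + _ = smul (P0_value K q - P0_value L q) (side_normal K i)).
  by rewrite enorm_smul n1 mulr1.
by apply: plane_eq; rewrite /smul /=; ring.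
Qed.

Lemma jump_sqnorm_le (q : plane R -> R) K : K \in Th ->
  hK K * jump_sqnorm Th q K <=
  \sum_(i < 3 | internal Th K i) (hK K * enorm (jump Th q (side K i))) ^+ 2.
Proof.
move=> KTh; have h0 := mesh_hK_gt0 KTh.
rewrite /jump_sqnorm mulr_sumr; apply: ler_sum => i _.
rewrite /side_integral Rintegral_cst; last exact: measurable_itv.
have -> : fine (lebesgue_measure (`[0, 1]%classic : set R)) = 1 :> R.
  by rewrite lebesgue_measure_itv /= lte_fin ltr01 oppr0 addr0.
rewrite mulr1 exprMn expr2 -mulrA ler_pM2l// ler_wpM2r ?sqr_ge0//.
by apply: (enorm_le_hK (tri_bounded KTh)); exact: (tri_vertex (ndTh KTh)).
Qed.

(** All the geometry needed for a jump: the line of the side cuts a square around the midpoint into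
    a part in [K] and a part in the neighbour [L]. The size comparison moves weights 1/h_L to
    [K]. *)
Lemma mesh_side K i : K \in Th -> internal Th K i -> exists L m n, [/\ L \in Th, neighbour Th K L,
    hK K <= 2 * sigma * hK L,
    n != 0 & forall q, enorm (jump Th q (side K i)) = `|P0_value K q - P0_value L q|] /\
    let s := hK K / (32 * sigma ^+ 2) in
    [/\ boxc m s `<=` D, (forall x, boxc m s x -> 0 <= dot n (x - m) -> tri K x) &
        (forall x, boxc m s x -> dot n (x - m) <= 0 -> tri L x)].
Proof.
move=> KTh /asboolP[L [j [LTh LK e]]].
have KL : K != L by rewrite eq_sym.
have [mE nE] := opposite_normals KTh LTh KL (esym e).
have [n1 _ _] := side_normalP (ndTh KTh) i.
have s0 : 0 < sigma by exact: lt_le_trans sigma1.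
have s20 : 0 < 32 * sigma ^+ 2 by rewrite mulr_gt0// exprn_gt0.
have h0 := mesh_hK_gt0 KTh; have h0' := mesh_hK_gt0 LTh.
have [c hc] := mesh_disk KTh; have [c' hc'] := mesh_disk LTh.
set r := hK K / (4 * sigma) in hc; set r' := hK L / (4 * sigma) in hc'.
have s40 : 0 < 4 * sigma by rewrite mulr_gt0//; exact: lt_le_trans sigma1.
have r0 : 0 < r by rewrite divr_gt0// mesh_hK_gt0.
have r'0 : 0 < r' by rewrite divr_gt0// mesh_hK_gt0.
(* The common side is at least as long as the diameter h_K/(2 sigma) of a disk in [K], and at most
   h_L. *)
have hKL : hK K <= 2 * sigma * hK L.
  have := side_length_ge (ndTh KTh) r0 hc i.
  have : enorm (side_tgt K i - side_src K i) <= hK L.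
    have ends : segment (side_src K i) (side_tgt K i) = segment (side_src L j) (side_tgt L j).
      exact: esym e.
    have sab : side_src K i != side_tgt K i.
      by rewrite eq_sym -subr_eq0; exact: side_vector_neq0 (ndTh KTh) _.
    by case: (segment_inj sab ends) => -[<- <-];
      apply: (enorm_le_hK (tri_bounded LTh)); exact: (tri_vertex (ndTh LTh)).
  move=> h1 h2; have : 2 * r <= hK L by exact: le_trans h1.
  by rewrite /r mulrA ler_pdivrMr//; lra.
set s := hK K / _.
have sp : 0 < s by rewrite divr_gt0.
have s4 : 4 * s <= r.
  rewrite /s /r mulrA ler_pdivrMr// mulrAC ler_pdivlMr ?mulr_gt0//.
  have h1 : hK K * sigma * 16 <= hK K * sigma * (32 * sigma).
    by apply: ler_wpM2l; [rewrite mulr_ge0// ltW|have := sigma1; lra].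
  by move: h1; rewrite expr2; lra.
have s4' : 4 * s <= r'.
  rewrite /s /r' mulrA ler_pdivrMr// mulrAC ler_pdivlMr ?mulr_gt0//.
  have h1 : (16 * sigma) * hK K <= 16 * sigma * (2 * sigma * hK L).
    by rewrite ler_pM2l ?mulr_gt0.
  by move: h1; rewrite expr2; lra.
exists L, (midpoint K i), (side_normal K i); split; first split => //.
- apply/orP; right; apply/asboolP; exists i, j; split => //; apply/asboolP.
    by exists L, j.
  by exists K, i.
- by apply/eqP => n0; move: n1; rewrite n0 /enorm /dot /= !mulr0 addr0 sqrtr0 => /eqP; rewrite eq_sym oner_eq0.
- by move=> q; exact: jump_internal e.
have inK x : boxc (midpoint K i) (2 * s) x -> 0 <= dot (side_normal K i) (x - midpoint K i) -> tri K x.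
  by move=> /enorm_box h; apply: (half_disk_tri (ndTh KTh) r0 hc); apply: (le_trans h); lra.
have inL x : boxc (midpoint K i) (2 * s) x -> dot (side_normal K i) (x - midpoint K i) <= 0 -> tri L x.
  move=> /enorm_box h h2; apply: (half_disk_tri (ndTh LTh) r'0 hc' (i := j)); rewrite mE.
    by apply: (le_trans h); lra.
  by rewrite nE; move: h2; rewrite /dot /=; lra.
have sub x : boxc (midpoint K i) s x -> boxc (midpoint K i) (2 * s) x.
  by move=> /boxcP[x1 x2]; apply/boxcP; split; lra.
split.
- apply: boxc_interior => // x bx.
  have [h|h] := lerP 0 (dot (side_normal K i) (x - midpoint K i)).
    by apply: (tri_closure KTh); exact: inK.
  by apply: (tri_closure LTh); apply: inL => //; exact: ltW.
- by move=> x /sub; exact: inK.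
- by move=> x /sub; exact: inL.
Qed.

End Mesh.
End MeshGeometry.

(** * Local estimates *)

Section AffineReplacement.
Variable R : realType.
Implicit Types (c x e g : plane R) (s : R) (K X D : set (plane R)).
Local Notation leb := (leb2 R).
Local Notation mset D := (measurable (D : set (mplane R))).

(** Triangles lie in the closure of the domain, hence in the domain only up to a null set. *)
Lemma nLp_sub_ae X D (q : R) (f : plane R -> R) : 0 < q -> mset X -> mset D ->
  mfun2 X f -> mfun2 D f -> {ae leb, forall x, X x -> D x} -> (nLp X q f <= nLp D q f)%E.
Proof.
move=> q0 mX mD mfX mfD XD.
have e A : nLp A q f = nLp setT q (f \_ A) by rewrite /nLp patch_setT.
rewrite !e; apply: nLp_le => //; [exact: mfun2_patch|exact: mfun2_patch|].
apply: ae2W XD => x h _; rewrite /patch; case: ifPn => [/set_mem Xx|_].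
  by rewrite ifT//; exact/mem_set/h.
by rewrite normr0.
Qed.

Definition aff_coef c s g (b : R) (i j : 'I_3) : R :=
  nth 0 (nth [::] [:: [:: dot g c + b; g.2 * s; 0]; [:: g.1 * s; 0; 0]; [:: 0; 0; 0]] i) j.

Lemma affine_poly2 c s g (b : R) x : 0 < s -> dot g x + b = poly2 (aff_coef c s g b) c s x.
Proof.
move=> s0; rewrite /poly2 !big_ord_recl !big_ord0 /aff_coef /= /bump /= /dot.
by field; rewrite gt_eqF.
Qed.

(** Applied with a component of the constant c, the affine function A and the same component of
    [uh]: this is the polynomial [P], of degree 2. *)
Lemma affine_mul_poly2 c s (k : R) g (b : R) g' (b' : R) : 0 < s ->
  exists P, forall x, k - (dot g x + b) * (dot g' x + b') = poly2 P c s x.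
Proof.
move=> s0; pose l0 := dot g c + b; pose m0 := dot g' c + b'.
pose l1 := g.1 * s; pose l2 := g.2 * s; pose m1 := g'.1 * s; pose m2 := g'.2 * s.
exists (fun i j => nth 0 (nth [::] [:: [:: k - l0 * m0; - (l0 * m2 + l2 * m0); - (l2 * m2)];
  [:: - (l0 * m1 + l1 * m0); - (l1 * m2 + l2 * m1); 0]; [:: - (l1 * m1); 0; 0]] i) j) => x.
rewrite /poly2 !big_ord_recl !big_ord0 /= /bump /= /l0 /l1 /l2 /m0 /m1 /m2 /dot.
by field; rewrite gt_eqF.
Qed.

Section Replacement.
Variables (Dl : 'I_3 -> R -> R) (M : R).
Hypothesis sD : forall i, smooth1 (Dl i).
Hypothesis oD : forall i, off1 (Dl i).
Hypothesis dD : forall i k : 'I_3, moment (Dl i) k = (i == k)%:R.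
Hypothesis bD : forall i t, `|Dl i t| <= M.

(* An affine function with a large coefficient is far from the bounded function
   [h], so that 0 is then a better approximation of [h]. *)
Lemma affine_replacement K c s (kap N r : R) (h : plane R -> R) g (b : R) :
  0 < s -> 1 <= kap -> 1 < r -> 0 <= N -> mset K -> boxc c s `<=` K -> K `<=` boxc c (kap * s) ->
  mfun2 K h -> (forall x, `|h x| <= N) ->
  exists g' b', (forall x, K x ->
      `|dot g' x + b'| <= 9 * ((4 * N * M ^+ 2 + 4 * N * M ^+ 2 * kap ^+ 2) * kap ^+ 4)) /\
    (nLp K r (fun x => dot g' x + b' - h x)%R <= nLp K r (fun x => dot g x + b - h x)%R)%E.
Proof.
move=> s0 k1 r1 N0 mK sK Ks mh hN; set N1 := _ + _.
have r0 : 0 < r by exact: lt_trans r1.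
have k0 : 0 <= kap by exact: le_trans k1.
have M20 : 0 <= M ^+ 2 by exact: sqr_ge0.
have N4 : 0 <= 4 * N * M ^+ 2 by apply: mulr_ge0 => //; exact: mulr_ge0.
have N10 : 0 <= N1 by apply: addr_ge0 => //; apply: mulr_ge0 => //; exact: sqr_ge0.
pose a := aff_coef c s g b.
have [aN|] := pselect (forall i j, `|a i j| <= N1).
  exists g, b; split => // x Kx; rewrite (affine_poly2 c _ _ _ s0).
  by apply: (@poly2_bound R a c s x kap N1) => //; exact: Ks.
(* [N1] is tailored to this case. Pairing [A] with the dual function of a coefficient above [N1] and
   removing the share of [h], at most [4 * N * M ^+ 2 * s ^+ 2], shows that the norm [q] of [A] is
   at least N kap^2 (4 s^2)^(1/r). This bounds the norm of [h] on [K], since kap^(2/r) <= kap^2. *)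
move=> /existsNP[i /existsNP[j /negP]]; rewrite -ltNge => aij.
exists 0, 0; split=> [x _|].
  rewrite (_ : dot 0 x + 0 = 0); last by rewrite /dot /= !mul0r !addr0.
  by rewrite normr0; apply: mulr_ge0 => //; apply: mulr_ge0 => //; exact: exprn_ge0.
set A := fun x => dot g x + b - h x.
have mg : borel_fun (fun x => dot g x + b).
  apply: continuous_borel => x; apply: continuousD; first exact: continuous_dotr.
  exact: cst_continuous.
have mA : mfun2 K A by apply: mfun2B => //; exact: borel_mfun2.
have [->|Afin] := eqVneq (nLp K r A) +oo%E; first exact: leey.
have {Afin} : exists q, nLp K r A = q%:E.
  exists (fine (nLp K r A)); rewrite fineK// ge0_fin_numE ?nLp_ge0//.
  by rewrite ltey.
move=> [q qE]; have mQ := measurable_boxc c s.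
have s20 : 0 < 4 * s ^+ 2 by rewrite mulr_gt0// exprn_gt0.
have KQ : (nLp (boxc c s) r A <= q%:E)%E.
  by rewrite -qE; apply: nLp_le => //; [exact: mfun2S mA|exact: nearW].
pose psi := dualf Dl c s i j.
have cpsi : continuous psi by exact: (Ck_continuous (dualf_smooth sD c s i j 0)).
have bpsi := continuous_borel cpsi.
have lQ : (leb (boxc c s) <= (4 * s ^+ 2)%:E)%E by rewrite leb2_boxc// ltW.
have psiM x : boxc c s x -> `|psi x| <= M ^+ 2 by move=> _; exact: dualf_bound.
have mAQ : mfun2 (boxc c s) A by exact: mfun2S mA.
have mhQ : mfun2 (boxc c s) h by exact: mfun2S mh.
have h1 := nLp1_bound r1 M20 (ltW s20) mQ mAQ (borel_mfun2 bpsi) lQ KQ psiM.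
have [i1 I1] := nLp1_integrable mQ (mfun2M mAQ (borel_mfun2 bpsi)) h1.
have h2 : (nLp (boxc c s) 1 (fun x => h x * psi x)%R <= (N * M ^+ 2 * (4 * s ^+ 2) `^ 1^-1)%:E)%E.
  apply: nLp_bound => //; [by rewrite mulr_ge0|exact: mfun2M mhQ (borel_mfun2 bpsi)|].
  by apply: nearW => x Qx; rewrite normrM; apply: ler_pM => //; exact: psiM.
rewrite invr1 powRr1 ?(ltW s20)// in h2.
have [i2 I2] := nLp1_integrable mQ (mfun2M mhQ (borel_mfun2 bpsi)) h2.
have e : s ^+ 2 * a i j = \int[leb]_(x in boxc c s) (A x * psi x) +
    \int[leb]_(x in boxc c s) (h x * psi x).
  rewrite -RintegralD// -(poly2_dual sD oD dD a c i j s0).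
  rewrite (@Rintegral_supp _ setT (boxc c s))//.
    by apply: eq_Rintegral => x _; rewrite /a -(affine_poly2 c g b x s0) -/psi /A -mulrDl subrK.
  by move=> x hx; rewrite dualf_off ?mulr0.
have aE : s ^+ 2 * `|a i j| <= q * (M ^+ 2 * (4 * s ^+ 2) `^ (1 - r^-1)) + N * M ^+ 2 * (4 * s ^+ 2).
  rewrite -{1}(ger0_norm (sqr_ge0 s)) -normrM e.
  by apply: (le_trans (ler_normD _ _)); apply: lerD.
have {}aij : s ^+ 2 * N1 < s ^+ 2 * `|a i j| by rewrite ltr_pM2l// exprn_gt0.
set y := 4 * s ^+ 2 in s20 aE.
have key : N * kap ^+ 2 * y * M ^+ 2 < q * y `^ (1 - r^-1) * M ^+ 2.
  have := lt_le_trans aij aE; rewrite /N1 /y; lra.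
(* The strict inequality excludes [M ^+ 2 = 0], so this factor cancels. *)
have {}key : N * kap ^+ 2 * y <= q * y `^ (1 - r^-1).
  have [M2|/eqP M2] := ltP 0 (M ^+ 2); first by move: key; rewrite ltr_pM2r// => /ltW.
  by move: key; rewrite (_ : M ^+ 2 = 0) ?mulr0 ?ltxx//; apply/eqP; rewrite eq_le M20 andbT; exact/eqP.
have {}key : N * kap ^+ 2 * y `^ r^-1 <= q.
  rewrite -(ler_pM2r (powR_gt0 (1 - r^-1) s20)); apply: le_trans key.
  have ye : y `^ r^-1 * y `^ (1 - r^-1) = y.
    by rewrite -powRD; [rewrite addrC subrK powRr1// ltW|rewrite (gt_eqF s20) implybT].
  by rewrite -(mulrA _ (y `^ r^-1)) ye.
rewrite qE; apply: (@le_trans _ _ (N * (4 * (kap * s) ^+ 2) `^ r^-1)%:E).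
  apply: nLp_bound => //.
  - apply: mfun2B => //; apply: borel_mfun2; rewrite (_ : (fun x => _) = cst 0).
      exact: measurable_cst.
    by apply/funext => x; rewrite /dot /= !mul0r !addr0.
  - rewrite -(@leb2_boxc _ c (kap * s)); last by rewrite mulr_ge0// (ltW s0).
    by apply: le_measure; rewrite ?inE//; exact: measurable_boxc.
  - by apply: nearW => x _; rewrite /dot /= !mul0r !addr0 sub0r normrN.
rewrite lee_fin; apply: le_trans key; rewrite -mulrA ler_wpM2l//.
have -> : 4 * (kap * s) ^+ 2 = kap ^+ 2 * y by rewrite /y; ring.
rewrite powRM ?sqr_ge0 ?(ltW s20)// ler_wpM2r ?powR_ge0//.
have k21 : 1 <= kap ^+ 2 by rewrite exprn_ege1.
rewrite -[leRHS]powRr1 ?sqr_ge0//; apply: ler_powR => //.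
by rewrite invf_le1// ltW.
Qed.

End Replacement.
End AffineReplacement.

(** * Error identity, residual and jump on a square *)

Section LocalEstimates.
Variable R : realType.
Implicit Types (c x e g : plane R) (s : R) (K L X Q : set (plane R)).
Local Notation leb := (leb2 R).
Local Notation mset D := (measurable (D : set (mplane R))).

Lemma nLp_cover Q K L (q : R) (f : plane R -> R) : 1 <= q -> mset Q -> mset K -> mset L ->
  mfun2 Q f -> mfun2 K f -> mfun2 L f -> Q `<=` K `|` L ->
  (nLp Q q f <= nLp K q f + nLp L q f)%E.
Proof.
move=> q1 mQ mK mL fQ fK fL QKL; have q0 : 0 < q by exact: lt_le_trans q1.
have e A : nLp A q f = nLp setT q (fun x => `|(f \_ A) x|).
  by rewrite nLp_norm// /nLp patch_setT.
have mP A : mset A -> mfun2 A f -> mfun2 setT (fun x => `|(f \_ A) x|).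
  by move=> mA fA; apply: mfun2_norm; exact: mfun2_patch.
rewrite !e; apply: le_trans (nLpD q1 measurableT (mP _ mK fK) (mP _ mL fL)).
apply: nLp_le => //; [exact: mP|by apply: mfun2D; exact: mP|].
apply: nearW => x _; rewrite normr_id [leRHS]ger0_norm ?addr_ge0// /patch.
case: ifPn => [/set_mem/QKL[h|h]|_]; last by rewrite normr0 addr_ge0.
  by rewrite (mem_set h) lerDl.
by rewrite (mem_set h) lerDr.
Qed.

Lemma test_fun_off Q psi e : test_fun Q psi ->
  (forall x, ~ Q x -> psi x = 0) /\ (forall x, ~ Q x -> dirder e psi x = 0).
Proof.
move=> tp; split=> x nQ; first by case: tp => _ [A [_ AQ ->]]// /AQ.
by have [A [_ AQ _ ->]] := dirder_test e tp => // /AQ.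
Qed.

Lemma test_funS Q D psi : Q `<=` D -> test_fun Q psi -> test_fun D psi.
Proof. by move=> QD [h [A [cA AQ A0]]]; split => //; exists A; split => // x /AQ/QD. Qed.

Lemma test_fun_borel Q psi e : test_fun Q psi -> borel_fun psi /\ borel_fun (dirder e psi).
Proof.
move=> tp; split; first exact: continuous_borel (test_fun_continuous tp).
exact: continuous_borel (@dirder_continuous R Q e psi tp).
Qed.

Lemma integral_dirder_eq0 Q psi e : mset Q -> test_fun Q psi ->
  rintegrable Q (dirder e psi) /\ \int[leb]_(x in Q) dirder e psi x = 0.
Proof.
move=> mQ tp; have [psi0 dir0] := test_fun_off e tp.
have [M _ hM] := test_fun_box0 tp.
have [i1 I1] := integral_pd1_eq0 (tp.1 1%N) hM.
have [i2 I2] := integral_pd2_eq0 (tp.1 1%N) hM.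
have [A [cA AQ cd d0]] := dirder_test e tp.
split; first exact: integrable_cont_supp mQ cA AQ cd d0.
rewrite -(@Rintegral_supp _ setT Q)//.
by rewrite /dirder Rintegral_lin// I1 I2 !mulr0 addr0.
Qed.

Variables (D : set (plane R)) (nu : R -> R) (N : R).
Variables (f u uh : plane R -> plane R) (pr ph T Th : plane R -> R).
Hypotheses (oD : open D) (cnu : continuous nu) (nuN : forall t, `|nu t| <= N).
Hypotheses (Lf : Lpv D 2 f) (Lu : Lpv D 2 u) (Luh : Lpv D 2 uh).
Hypotheses (Lpr : Lp D 2 pr) (bph : borel_fun ph) (bT : borel_fun T).
Hypothesis mom : forall v, Hdiv0 D v ->
  \int[leb]_(x in D) (nu (T x) * dot (u x) (v x) - pr x * wdiv D v x) =
  \int[leb]_(x in D) dot (f x) (v x).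

Definition flux_error e x : R := dot (smul (nu (T x)) (u x) - smul (nu (Th x)) (uh x)) e.
(** The gradient of [ph] is left out, as it vanishes inside each triangle. *)
Definition dir_residual e x : R := dot (f x - smul (nu (Th x)) (uh x)) e.

Let N0 : 0 <= N. Proof. exact: le_trans (nuN 0). Qed.

Let b1 (v : plane R -> plane R) : Lpv D 2 v -> borel_fun (fun x => (v x).1).
Proof. by case=> -[]. Qed.

Let b2 (v : plane R -> plane R) : Lpv D 2 v -> borel_fun (fun x => (v x).2).
Proof. by case=> _ []. Qed.

Lemma mfun2_dot X (v : plane R -> plane R) e : mfun2 X (fun x => (v x).1) ->
  mfun2 X (fun x => (v x).2) -> mfun2 X (fun x => dot (v x) e).
Proof.
by move=> m1 m2; rewrite /dot; apply: mfun2D; apply: mfun2M => //; exact: mfun2_cst.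
Qed.

Lemma mfun2_smul X (a : plane R -> R) (v : plane R -> plane R) : mfun2 X a ->
  mfun2 X (fun x => (v x).1) -> mfun2 X (fun x => (v x).2) ->
  mfun2 X (fun x => (smul (a x) (v x)).1) /\ mfun2 X (fun x => (smul (a x) (v x)).2).
Proof. by move=> ma m1 m2; rewrite /smul; split; apply: mfun2M. Qed.

Let mu1 X := borel_mfun2 (D := X) (b1 Lu).
Let mu2 X := borel_mfun2 (D := X) (b2 Lu).
Let muh1 X := borel_mfun2 (D := X) (b1 Luh).
Let muh2 X := borel_mfun2 (D := X) (b2 Luh).
Let mf1 X := borel_mfun2 (D := X) (b1 Lf).
Let mf2 X := borel_mfun2 (D := X) (b2 Lf).
Let mnuT X : mfun2 X (fun x => nu (T x)).
Proof. by apply: mfun2_comp => //; exact: borel_mfun2. Qed.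

Lemma mfun2_flux_error X e : mfun2 X Th -> mfun2 X (flux_error e).
Proof.
move=> mTh; have mnuTh : mfun2 X (fun x => nu (Th x)) by exact: mfun2_comp.
have [h1 h2] := mfun2_smul (@mnuT X) (@mu1 X) (@mu2 X).
have [h3 h4] := mfun2_smul mnuTh (@muh1 X) (@muh2 X).
by apply: (@mfun2_dot X (fun x => _ - _)); apply: mfun2B.
Qed.

Lemma mfun2_dir_residual X e : mfun2 X Th -> mfun2 X (dir_residual e).
Proof.
move=> mTh; have mnuTh : mfun2 X (fun x => nu (Th x)) by exact: mfun2_comp.
have [h3 h4] := mfun2_smul mnuTh (@muh1 X) (@muh2 X).
by apply: (@mfun2_dot X (fun x => _ - _)); apply: mfun2B.
Qed.

Lemma nLp_dot_le X (a : plane R -> R) (v : plane R -> plane R) e (w : R) : enorm e = 1 -> mset X ->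
  mfun2 X a -> mfun2 X (fun x => (v x).1) -> mfun2 X (fun x => (v x).2) ->
  (nLp X 2 (fun x => a x * enorm (v x))%R <= w%:E)%E ->
  (nLp X 2 (fun x => a x * dot (v x) e)%R <= w%:E)%E.
Proof.
move=> e1 mX ma m1 m2; apply: le_trans; apply: nLp_le => //.
- by apply: mfun2M => //; exact: mfun2_dot.
- by apply: mfun2M => //; exact: mfun2_enorm.
- apply: nearW => x _; rewrite !normrM (ger0_norm (enorm_ge0 _)) ler_wpM2l//.
  by have := dot_le (v x) e; rewrite e1 mulr1.
Qed.

Lemma nLp_dot_bounded X (a : plane R -> R) (v : plane R -> plane R) e (A w : R) :
  enorm e = 1 -> mset X -> 0 <= A ->
  mfun2 X a -> mfun2 X (fun x => (v x).1) -> mfun2 X (fun x => (v x).2) ->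
  (forall x, X x -> `|a x| <= A) -> (nLpv X 2 v <= w%:E)%E ->
  (nLp X 2 (fun x => a x * dot (v x) e)%R <= (A * w)%:E)%E.
Proof.
move=> e1 mX A0 ma m1 m2 aA vw.
apply: (@le_trans _ _ (A%:E * nLpv X 2 v)%E); last by rewrite EFinM lee_wpmul2l.
apply: nLp_leZ => //; [by apply: mfun2M => //; exact: mfun2_dot|exact: mfun2_enorm|].
apply: nearW => x Xx; rewrite normrM (ger0_norm (enorm_ge0 _)); apply: ler_pM => //.
  exact: aA.
by have := dot_le (v x) e; rewrite e1 mulr1.
Qed.

Let meu1 X : mfun2 X (fun x => (u x - uh x).1). Proof. exact: (mfun2B (@mu1 X) (@muh1 X)). Qed.
Let meu2 X : mfun2 X (fun x => (u x - uh x).2). Proof. exact: (mfun2B (@mu2 X) (@muh2 X)). Qed.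

(** In the splitting (nu(T) - nu(T_h)) u + nu(T_h) (u - u_h) the velocity error meets only the
    bounded factor nu(T_h), and the difference of viscosities meets [u], whose norm in L^p' can be
    controlled. *)
Lemma nLp_flux_error X e (w Eu : R) : enorm e = 1 -> mset X -> mfun2 X Th ->
  (nLp X 2 (fun x => (nu (T x) - nu (Th x)) * enorm (u x))%R <= w%:E)%E ->
  (nLpv X 2 (fun x => u x - uh x)%R <= Eu%:E)%E ->
  (nLp X 2 (flux_error e) <= (w + N * Eu)%:E)%E.
Proof.
move=> e1 mX mTh hw hEu; have mnuTh : mfun2 X (fun x => nu (Th x)) by exact: mfun2_comp.
have mB : mfun2 X (fun x => nu (T x) - nu (Th x)) by apply: mfun2B.
rewrite (_ : flux_error e = fun x => (nu (T x) - nu (Th x)) * dot (u x) e +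
   nu (Th x) * dot (u x - uh x) e); last first.
  by apply/funext => x; rewrite /flux_error /dot /smul /=; ring.
apply: (le_trans (nLpD (ler1n _ 2) mX _ _)).
- by apply: mfun2M => //; apply: mfun2_dot; [exact: mu1|exact: mu2].
- by apply: mfun2M => //; apply: (@mfun2_dot X (fun x => _ - _)); [exact: meu1|exact: meu2].
rewrite EFinD; apply: leeD.
  by apply: nLp_dot_le.
by apply: nLp_dot_bounded.
Qed.

(** The error identity: by the momentum equation, the left-hand side is the pairing of the flux
    error with [psi] minus that of the pressure error with [dirder e psi]. The derivative costs 1/s
    and Cauchy-Schwarz returns s, so the pressure error carries no power of s. *)
Lemma test_bound c s psi e (B0 B1 Ep w : R) : 0 < s -> boxc c s `<=` D ->
  test_fun (boxc c s) psi -> 0 <= B0 -> 0 <= B1 ->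
  (forall x, `|psi x| <= B0) -> (forall x, `|dirder e psi x| <= B1 / s) ->
  mfun2 (boxc c s) Th -> (nLp (boxc c s) 2 (fun x => pr x - ph x)%R <= Ep%:E)%E ->
  (nLp (boxc c s) 2 (flux_error e) <= w%:E)%E ->
  `|\int[leb]_(x in boxc c s) (ph x * dirder e psi x) +
    \int[leb]_(x in boxc c s) (dir_residual e x * psi x)| <= 2 * B1 * Ep + 2 * B0 * w * s.
Proof.
move=> s0 QD tQ B00 B10 pB dB mTh hEp hw.
set Q := boxc c s in QD tQ mTh hEp hw *; have mQ : mset Q := measurable_boxc c s.
have mD := open_measurable2 oD; have tp := test_funS QD tQ.
have [psi0 dir0] := test_fun_off e tQ; have [bpsi bdir] := test_fun_borel e tQ.
have bpr : borel_fun pr by case: Lpr.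
have mpp : mfun2 Q (fun x => pr x - ph x) by apply: mfun2B; exact: borel_mfun2.
have QQ : Q `<=` Q by [].
have B1s : 0 <= B1 / s by rewrite divr_ge0// ltW.
have [i1 I1] := pairing_bound s0 mQ QQ mpp bdir dir0 B1s dB hEp.
have [i2 I2] := pairing_bound s0 mQ QQ (mfun2_flux_error e mTh) bpsi psi0 B00 pB hw.
have Ldir := dirder_Lp e (ltr0n R 2) mD tp.
have ip := rintegrableS mD mQ QD (Lp2_integrableM mD Lpr Ldir).
have iph : rintegrable Q (fun x => ph x * dirder e psi x).
  by apply: (eq_rintegrable _ (rintegrableB mQ ip i1)) => x; ring.
have Lpsi : Lp D 2 psi by exact: test_fun_Lp.
have Lg : Lp D 2 (fun x => dot (f x - smul (nu (T x)) (u x)) e).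
  have Lue := Lpv_dot e (ler1n _ 2) mD Lu; have Lfe := Lpv_dot e (ler1n _ 2) mD Lf.
  have Lnu : Lp D 2 (fun x => nu (T x) * dot (u x) e).
    apply: (@Lp_le R D 2 N _ (fun x => dot (u x) e)) => //.
      apply: measurable_funM; first exact: (@mnuT setT).
      by case: Lue.
    by move=> x; rewrite normrM ler_wpM2r.
  have := LpD (ler1n _ 2) mD Lfe (LpZ (-1) (ltr0n R 2) mD Lnu).
  by rewrite (_ : (fun x => _ + _) = (fun x => dot (f x - smul (nu (T x)) (u x)) e))//;
    apply/funext => x; rewrite /dot /smul /=; ring.
have ig := rintegrableS mD mQ QD (Lp2_integrableM mD Lg Lpsi).
have := momentum_test oD cnu nuN Lf Lu Lpr bT mom e tp.
rewrite (@Rintegral_supp _ D Q)//; last by move=> x /psi0 ->; rewrite mulr0.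
rewrite (@Rintegral_supp _ D Q (fun x => pr x * _))//; last by move=> x /dir0 ->; rewrite mulr0.
move=> m.
have eR : \int[leb]_(x in Q) (dir_residual e x * psi x) =
    \int[leb]_(x in Q) (dot (f x - smul (nu (T x)) (u x)) e * psi x) +
    \int[leb]_(x in Q) (flux_error e x * psi x).
  rewrite -RintegralD//; apply: eq_Rintegral => x _.
  by rewrite /dir_residual /flux_error /dot /smul /=; ring.
have eP : \int[leb]_(x in Q) (pr x * dirder e psi x) =
    \int[leb]_(x in Q) ((pr x - ph x) * dirder e psi x) +
    \int[leb]_(x in Q) (ph x * dirder e psi x).
  by rewrite -RintegralD//; apply: eq_Rintegral => x _; ring.
rewrite eR m eP; set P1 := \int[leb]_(x in Q) ((pr x - ph x) * _) in I1 *.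
set P2 := \int[leb]_(x in Q) (ph x * _); set P3 := \int[leb]_(x in Q) (flux_error e x * _) in I2 *.
rewrite (_ : P2 + _ = P3 - P1); last by ring.
apply: (le_trans (ler_normB _ _)); rewrite addrC; apply: lerD.
  apply: (le_trans I1); rewrite le_eqVlt; apply/orP; left; apply/eqP.
  by field; rewrite gt_eqF.
by apply: (le_trans I2); rewrite le_eqVlt; apply/orP; left; apply/eqP; ring.
Qed.

Section ResidualBound.
Variables (Dl : 'I_3 -> R -> R) (M : R).
Hypothesis sD : forall i, smooth1 (Dl i).
Hypothesis oDl : forall i, off1 (Dl i).
Hypothesis dD : forall i k : 'I_3, moment (Dl i) k = (i == k)%:R.
Hypothesis bD : forall i t, `|Dl i t| <= M.
Hypothesis bD' : forall i t, `|derive1 (Dl i) t| <= M.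

(** On a square inside [K] the constant pressure [pK] pairs to 0 with a derivative, so [test_bound]
    controls the pairings of the residual with the dual functions. [A] is the distance of the
    residual to the polynomial, and [poly2_inverse] concludes. *)
Lemma residual_bound K c s (kap a pK C0 b' F wA w Eu Ep A : R) b g' c0 e : 0 < s -> 1 <= kap ->
  mset K -> boxc c s `<=` K -> boxc c s `<=` D -> K `<=` boxc c (kap * s) -> enorm e = 1 ->
  mfun2 K Th -> {ae leb, forall x, K x -> ph x = pK} ->
  {ae leb, forall x, K x -> uh x = smul a x + b} ->
  0 <= C0 -> (forall x, K x -> `|dot g' x + b'| <= C0) ->
  0 <= F -> 0 <= wA -> 0 <= w -> 0 <= Eu -> 0 <= Ep ->
  (nLpv K 2 (fun x => f x - c0)%R <= F%:E)%E ->
  (nLp K 2 (fun x => (dot g' x + b' - nu (T x)) * enorm (u x))%R <= wA%:E)%E ->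
  (nLp K 2 (fun x => (nu (T x) - nu (Th x)) * enorm (u x))%R <= w%:E)%E ->
  (nLpv K 2 (fun x => u x - uh x)%R <= Eu%:E)%E ->
  (nLp K 2 (fun x => pr x - ph x)%R <= Ep%:E)%E ->
  A = F + wA + w + (C0 + N) * Eu ->
  (nLp K 2 (dir_residual e) <= (A + 18 * kap ^+ 5 *
    (4 * M ^+ 2 * Ep / s + 2 * M ^+ 2 * (w + N * Eu) + 2 * M ^+ 2 * A))%:E)%E.
Proof.
move=> s0 k1 mK sK sDo Ks e1 mTh hph huh C00 hC0 F0 wA0 w0 Eu0 Ep0 hF hwA hw hEu hEp AE.
have M20 : 0 <= M ^+ 2 by exact: sqr_ge0.
have A0 : 0 <= A by rewrite AE !addr_ge0// mulr_ge0// addr_ge0.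
have mQ : mset (boxc c s) := measurable_boxc c s.
have [P hP] := affine_mul_poly2 c (dot c0 e) g' b' (smul a e) (dot b e) s0.
have mR := mfun2_dir_residual e mTh.
have mnuTh : mfun2 K (fun x => nu (Th x)) by exact: mfun2_comp.
have mA : mfun2 K (fun x => dot g' x + b').
  apply: borel_mfun2; apply: continuous_borel => x.
  by apply: continuousD; [exact: continuous_dotr|exact: cst_continuous].
have mP : mfun2 K (poly2 P c s) by exact: borel_mfun2 (continuous_borel (@continuous_poly2 R P c s)).
have mfc1 : mfun2 K (fun x => (f x - c0).1) by apply: mfun2B => //; exact: mfun2_cst.
have mfc2 : mfun2 K (fun x => (f x - c0).2) by apply: mfun2B => //; exact: mfun2_cst.
apply: (@poly2_inverse R Dl M sD oDl dD bD K c s kap (dir_residual e) P) => //.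
- have t1 : 0 <= 4 * M ^+ 2 * Ep by apply: mulr_ge0 => //; exact: mulr_ge0.
  have t2 : 0 <= w + N * Eu by rewrite addr_ge0// mulr_ge0.
  apply: addr_ge0; first exact: divr_ge0 t1 (ltW s0).
  by apply: mulr_ge0 => //; exact: mulr_ge0.
- move=> i j; set psi := dualf Dl c s i j.
  have tQ : test_fun (boxc c s) psi by exact: dualf_test.
  have [psi0 dir0] := test_fun_off e tQ; have [bpsi bdir] := test_fun_borel e tQ.
  have [iz Iz] := integral_dirder_eq0 e mQ tQ.
  have e11 : `|e.1| <= 1 by rewrite -e1 enorm_ge1.
  have e22 : `|e.2| <= 1 by rewrite -e1 enorm_ge2.
  have dB x := @dirder_dualf_bound R Dl M sD bD bD' c s i j e x s0 e11 e22.
  have mThQ : mfun2 (boxc c s) Th by exact: mfun2S mTh.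
  have bpr : borel_fun pr by case: Lpr.
  have hEpQ : (nLp (boxc c s) 2 (fun x => pr x - ph x)%R <= Ep%:E)%E.
    apply: le_trans hEp; apply: nLp_le => //; last exact: nearW.
      by apply: mfun2B; exact: borel_mfun2.
    by apply: mfun2B; exact: borel_mfun2.
  have hWQ : (nLp (boxc c s) 2 (flux_error e) <= (w + N * Eu)%:E)%E.
    apply: le_trans (nLp_flux_error e1 mK mTh hw hEu); apply: nLp_le => //; last exact: nearW.
      exact: mfun2_flux_error.
    exact: mfun2_flux_error.
  have B10 : 0 <= 2 * M ^+ 2 by rewrite mulr_ge0.
  have := test_bound s0 sDo tQ M20 B10 (dualf_bound bD c s i j) dB mThQ hEpQ hWQ.
  rewrite (@Rintegral_ae_eq R _ (fun x => ph x * _) (fun x => pK * dirder e psi x))//.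
  + rewrite (@RintegralZl _ _ _ leb (boxc c s) _ pK mQ iz) Iz mulr0 add0r.
    rewrite -(@Rintegral_supp _ K)//; last by move=> x /psi0 ->; rewrite mulr0.
    move=> /le_trans; apply; rewrite le_eqVlt; apply/orP; left; apply/eqP.
    by field; rewrite gt_eqF.
  + by apply: mfun2M; exact: borel_mfun2.
  + by apply: mfun2M; [exact: mfun2_cst|exact: borel_mfun2].
  + by apply: ae2W hph => x h /sK/h ->.
have mAT : mfun2 K (fun x => dot g' x + b' - nu (T x)) by apply: mfun2B.
have mTTh : mfun2 K (fun x => nu (T x) - nu (Th x)) by apply: mfun2B.
have mATh : mfun2 K (fun x => - (dot g' x + b' - nu (Th x))).
  apply: (@mfun2_comp _ _ _ (@GRing.opp R)); first exact: opp_continuous.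
  exact: mfun2B.
have m1 : mfun2 K (fun x => 1 * dot (f x - c0) e).
  by apply: mfun2M; [exact: mfun2_cst|exact: (@mfun2_dot K (fun x => f x - c0))].
have m2 : mfun2 K (fun x => (dot g' x + b' - nu (T x)) * dot (u x) e).
  by apply: mfun2M => //; exact: mfun2_dot.
have m3 : mfun2 K (fun x => (nu (T x) - nu (Th x)) * dot (u x) e).
  by apply: mfun2M => //; exact: mfun2_dot.
have m4 : mfun2 K (fun x => - (dot g' x + b' - nu (Th x)) * dot (u x - uh x) e).
  by apply: mfun2M => //; exact: (@mfun2_dot K (fun x => u x - uh x)).
rewrite (@nLp_ae_eq R K 2 _ (fun x => 1 * dot (f x - c0) e +
  (dot g' x + b' - nu (T x)) * dot (u x) e + (nu (T x) - nu (Th x)) * dot (u x) e +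
  - (dot g' x + b' - nu (Th x)) * dot (u x - uh x) e))//; last 3 first.
- exact: mfun2B.
- by do 3! apply: mfun2D => //.
- apply: ae2W huh => x h Kx; rewrite -hP /dir_residual.
  have -> : dot (smul a e) x + dot b e = dot (uh x) e.
    by rewrite h// /dot /smul /=; ring.
  by rewrite /dot /smul /=; ring.
have n1 : (nLp K 2 (fun x => 1 * dot (f x - c0) e)%R <= F%:E)%E.
  rewrite -[F]mul1r; apply: (@nLp_dot_bounded K (fun=> 1) (fun x => f x - c0)) => //.
    exact: mfun2_cst.
  by move=> x _; rewrite normr1.
have n2 : (nLp K 2 (fun x => (dot g' x + b' - nu (T x)) * dot (u x) e)%R <= wA%:E)%E.
  exact: nLp_dot_le.
have n3 : (nLp K 2 (fun x => (nu (T x) - nu (Th x)) * dot (u x) e)%R <= w%:E)%E.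
  exact: nLp_dot_le.
have n4 : (nLp K 2 (fun x => - (dot g' x + b' - nu (Th x)) * dot (u x - uh x) e)%R
    <= ((C0 + N) * Eu)%:E)%E.
  apply: (@nLp_dot_bounded K _ (fun x => u x - uh x)) => //; first exact: addr_ge0.
  move=> x Kx; rewrite normrN; apply: (le_trans (ler_normB _ _)); apply: lerD => //.
  exact: hC0.
have q1 : 1 <= 2 :> R by exact: ler1n.
rewrite AE; apply: (le_trans (nLpD q1 mK (mfun2D (mfun2D m1 m2) m3) m4)); rewrite EFinD; apply: leeD => //.
apply: (le_trans (nLpD q1 mK (mfun2D m1 m2) m3)); rewrite EFinD; apply: leeD => //.
by apply: (le_trans (nLpD q1 mK m1 m2)); rewrite EFinD; apply: leeD.
Qed.

End ResidualBound.

(** The divergence [Fm - Fp] has its two parts of mass s in different triangles, so [ph] pairs with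
    it to (qL - qK) s. [test_bound] controls this pairing up to the residuals on the two
    triangles. *)
Lemma jump_bound K L X m n s (C qK qL r w Ep : R) e psi Fp Fm : 0 < s -> 0 <= C ->
  mset K -> mset L -> mset X -> boxc m s `<=` D -> boxc m s `<=` X ->
  (forall x, boxc m s x -> 0 <= dot n (x - m) -> K x) ->
  (forall x, boxc m s x -> dot n (x - m) <= 0 -> L x) ->
  [/\ enorm e = 1, (forall U, boxc m s `<=` U -> test_fun U psi),
      forall x, `|psi x| <= C, forall x, `|dirder e psi x| <= C / s &
      forall x, dirder e psi x = Fm x - Fp x] ->
  [/\ continuous Fp, continuous Fm, \int[leb]_x Fp x = s, \int[leb]_x Fm x = s &
      (forall x, Fp x != 0 -> boxc m s x /\ 0 <= dot n (x - m)) /\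
      (forall x, Fm x != 0 -> boxc m s x /\ dot n (x - m) <= 0)] ->
  mfun2 K Th -> mfun2 L Th -> mfun2 X Th ->
  {ae leb, forall x, K x -> ph x = qK} -> {ae leb, forall x, L x -> ph x = qL} ->
  (nLp X 2 (fun x => pr x - ph x)%R <= Ep%:E)%E ->
  (nLp X 2 (flux_error e) <= w%:E)%E ->
  (nLp K 2 (dir_residual e) + nLp L 2 (dir_residual e) <= r%:E)%E ->
  `|qK - qL| * s <= 2 * C * Ep + 2 * C * w * s + 2 * C * r * s.
Proof.
move=> s0 C0 mK mL mX QD QX QK QL [e1 tpsi pC dC dE] [cFp cFm iFp iFm [Fp0 Fm0]].
move=> mThK mThL mThX hK hL hEp hw hr.
set Q := boxc m s in QD QX QK QL tpsi Fp0 Fm0; have mQ : mset Q := measurable_boxc m s.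
have tQ : test_fun Q psi by exact: tpsi.
have [psi0 dir0] := test_fun_off e tQ; have [bpsi bdir] := test_fun_borel e tQ.
have mThQ : mfun2 Q Th by exact: mfun2S mThX.
have bpr : borel_fun pr by case: Lpr.
have hEpQ : (nLp Q 2 (fun x => pr x - ph x)%R <= Ep%:E)%E.
  apply: le_trans hEp; apply: nLp_le => //; last exact: nearW.
    by apply: mfun2B; exact: borel_mfun2.
  by apply: mfun2B; exact: borel_mfun2.
have hwQ : (nLp Q 2 (flux_error e) <= w%:E)%E.
  apply: le_trans hw; apply: nLp_le => //; last exact: nearW.
    exact: mfun2_flux_error.
  exact: mfun2_flux_error.
have QKL : Q `<=` K `|` L.
  move=> x Qx; have [h|h] := leP 0 (dot n (x - m)); first by left; exact: QK.
  by right; apply: QL => //; exact: ltW.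
have hrQ : (nLp Q 2 (dir_residual e) <= r%:E)%E.
  apply: le_trans hr; apply: nLp_cover => //; try exact: mfun2_dir_residual.
  exact: ler1n.
have QQ : Q `<=` Q by [].
have [_ Ir] := pairing_bound s0 mQ QQ (mfun2_dir_residual e mThQ) bpsi psi0 C0 pC hrQ.
have := test_bound s0 QD tQ C0 C0 pC dC mThQ hEpQ hwQ.
have cQ : compact Q by apply: compact_setX; exact: segment_compact.
have F0 (F : plane R -> R) : (forall x, F x != 0 -> Q x) -> forall x, ~ Q x -> F x = 0.
  by move=> h x nQ; apply/eqP; apply: contrapT => /negP /h.
have Fp0' := @F0 Fp (fun x h => (Fp0 x h).1); have Fm0' := @F0 Fm (fun x h => (Fm0 x h).1).
have iFpQ : rintegrable Q Fp := integrable_cont_supp mQ cQ QQ cFp Fp0'.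
have iFmQ : rintegrable Q Fm := integrable_cont_supp mQ cQ QQ cFm Fm0'.
have -> : \int[leb]_(x in Q) (ph x * dirder e psi x) = (qL - qK) * s.
  rewrite (@Rintegral_ae_eq R Q _ (fun x => qL * Fm x + (- qK) * Fp x))//; first last.
  - apply: ae2W (ae2_and hK hL) => x [h1 h2] Qx; rewrite dE.
    (* Where both parts are nonzero the point lies in both triangles, and there [ph] equals both
       constants. *)
    have [->|/Fp0[_ p]] := eqVneq (Fp x) 0; have [->|/Fm0[_ p']] := eqVneq (Fm x) 0.
    + by ring.
    + by rewrite h2 ?subr0 ?mulr0 ?addr0//; exact: QL.
    + by rewrite h1 ?mulr0 ?sub0r ?add0r ?mulrN ?mulNr//; exact: QK.
    + have q1 := h1 (QK _ Qx p); have q2 := h2 (QL _ Qx p').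
      by rewrite -q1 -q2; ring.
  - apply: mfun2D; apply: mfun2M; try exact: mfun2_cst.
      exact: borel_mfun2 (continuous_borel cFm).
    exact: borel_mfun2 (continuous_borel cFp).
  - by apply: mfun2M; exact: borel_mfun2.
  rewrite Rintegral_lin// -(@Rintegral_supp _ setT Q Fm)// -(@Rintegral_supp _ setT Q Fp)//.
  by rewrite iFp iFm; ring.
set I := \int[leb]_(x in Q) _ in Ir *; move=> h.
have -> : `|qK - qL| * s = `|(qL - qK) * s + I - I|.
  by rewrite addrK normrM distrC (gtr0_norm s0).
by apply: (le_trans (ler_normB _ _)); lra.
Qed.

End LocalEstimates.

(** * Weights by the velocity and infinite norms *)

Section NormTools.
Variable R : realType.
Implicit Types (c x e g : plane R) (s : R) (K L X Q : set (plane R)) (h : plane R -> R).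
Local Notation leb := (leb2 R).
Local Notation mset D := (measurable (D : set (mplane R))).

Lemma nLp_eq0 X (q : R) h : 0 < q -> mset X -> mfun2 X h -> (forall x, h x = 0) ->
  nLp X q h = 0%E.
Proof.
move=> q0 mX mh h0; apply/eqP; rewrite eq_le nLp_ge0 andbT.
rewrite -[leRHS](mul0e (nLp X q h)); apply: nLp_leZ => //.
by apply: nearW => x _; rewrite h0 normr0 mulr0.
Qed.

Lemma mul_add_le (a S : R) (x y : \bar R) : 0 < a -> (0 <= x)%E -> (0 <= y)%E ->
  (a%:E * (x + y) <= S%:E)%E -> (x <= (S / a)%:E)%E /\ (y <= (S / a)%:E)%E.
Proof.
move=> a0 x0 y0; rewrite muleC -lee_pdivlMr// => h.
by split; apply: (le_trans _ h); [rewrite leeDl|rewrite leeDr].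
Qed.

(** The norms are extended-valued. If one of [x1], [x2], [x4], [x5] is infinite so is the right-hand
    side, and the estimate is needed only for real values. *)
Lemma ereal_bound (a C : R) (x1 x2 x3 x4 x5 y : \bar R) : 0 < a -> 0 < C ->
  (0 <= x1)%E -> (0 <= x2)%E -> (0 <= x3)%E -> (0 <= x4)%E -> (0 <= x5)%E ->
  (forall e1 e2 e4 e5 : R, x1 = e1%:E -> x2 = e2%:E -> x4 = e4%:E -> x5 = e5%:E ->
    (y <= (C * (a * (e1 + e2) + e4 + e5))%:E)%E) ->
  (y <= C%:E * (a%:E * (x1 + x2 + x3) + x4 + x5))%E.
Proof.
move=> a0 C0 h1 h2 h3 h4 h5 h.
have [hfin|] := boolP [&& x1 != +oo%E, x2 != +oo%E, x4 != +oo%E & x5 != +oo%E].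
  case/and4P: hfin => f1 f2 f4 f5.
  have fin (x : \bar R) : (0 <= x)%E -> x != +oo%E -> x = (fine x)%:E.
    by move=> x0 xf; rewrite fineK// ge0_fin_numE// ltey.
  apply: (le_trans (h _ _ _ _ (fin _ h1 f1) (fin _ h2 f2) (fin _ h4 f4) (fin _ h5 f5))).
  rewrite EFinM; apply: lee_wpmul2l; first by rewrite lee_fin ltW.
  rewrite !EFinD EFinM -!fin//; apply: leeD => //; apply: leeD => //.
  by apply: lee_wpmul2l; [rewrite lee_fin ltW|rewrite EFinD -!fin// leeDl].
move=> hinf; suff -> : (C%:E * (a%:E * (x1 + x2 + x3) + x4 + x5) = +oo)%E by exact: leey.
have big (b : R) (x : \bar R) : 0 < b -> x = +oo%E -> (b%:E * x = +oo)%E.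
  by move=> b0 ->; rewrite gt0_muley.
have adl (x z : \bar R) : (0 <= z)%E -> x = +oo%E -> (x + z = +oo)%E.
  by move=> z0 ->; rewrite addye// gt_eqF// (lt_le_trans _ z0)// ltNy0.
have adr (x z : \bar R) : (0 <= x)%E -> z = +oo%E -> (x + z = +oo)%E.
  by move=> x0 zE; rewrite addeC adl.
have ax : (0 <= a%:E * (x1 + x2 + x3))%E by rewrite mule_ge0 ?lee_fin ?(ltW a0)// !adde_ge0.
apply: (big _ _ C0); move: hinf; rewrite !negb_and !negbK => /or4P[] /eqP xE.
- by rewrite (adl _ _ h5)// (adl _ _ h4)// (big _ _ a0)// (adl _ _ h3)// (adl _ _ h2).
- by rewrite (adl _ _ h5)// (adl _ _ h4)// (big _ _ a0)// (adl _ _ h3)// (adr _ _ h1).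
- by rewrite (adl _ _ h5)// (adr _ _ ax).
- by rewrite (adr _ _ (adde_ge0 ax h4)).
Qed.

Variables (nu : R -> R) (N CL Mu r p' : R).
Hypotheses (cnu : continuous nu) (nuN : forall t, `|nu t| <= N).
Hypothesis nuL : forall s t, `|nu s - nu t| <= CL * `|s - t|.
Hypotheses (r2 : 2 < r) (p2 : 2 < p') (rp : r^-1 + p'^-1 = 2^-1) (Mu0 : 0 <= Mu).

Lemma nu_const : ~ 0 < CL -> forall s t, nu s = nu t.
Proof.
move=> /negP; rewrite -leNgt => CL0 s t; apply/eqP; rewrite -subr_eq0 -normr_le0.
by apply: (le_trans (nuL s t)); rewrite mulr_le0_ge0.
Qed.

Lemma nLp_weight X h (v : plane R -> plane R) (w : R) : mset X -> mfun2 X h ->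
  mfun2 X (fun x => (v x).1) -> mfun2 X (fun x => (v x).2) -> 
  (nLpv X p' v <= Mu%:E)%E -> (nLp X r h <= w%:E)%E ->
  (nLp X 2 (fun x => h x * enorm (v x))%R <= (Mu * w)%:E)%E.
Proof.
move=> mX mh m1 m2 vM hw.
apply: (le_trans (nLp_hoelder2 r2 p2 rp mX mh (mfun2_enorm m1 m2))).
by rewrite mulrC EFinM; apply: lee_pmul; rewrite ?nLp_ge0.
Qed.

(** The bound on the velocity is available only for CL > 0; otherwise [nu] is constant and the
    weighted difference is 0. *)
Lemma nu_weight X h1 h2 (v : plane R -> plane R) (w : R) : mset X -> mfun2 X h1 -> mfun2 X h2 ->
  mfun2 X (fun x => (v x).1) -> mfun2 X (fun x => (v x).2) -> 0 <= w ->
  (0 < CL -> (nLpv X p' v <= Mu%:E)%E) -> (nLp X r (fun x => h1 x - h2 x)%R <= w%:E)%E ->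
  (nLp X 2 (fun x => (nu (h1 x) - nu (h2 x)) * enorm (v x))%R <= (`|CL| * Mu * w)%:E)%E.
Proof.
move=> mX mh1 mh2 m1 m2 w0 vM hw.
have mn : mfun2 X (fun x => nu (h1 x) - nu (h2 x)) by apply: mfun2B; exact: mfun2_comp.
have me := mfun2_enorm m1 m2.
have [CL0|CL0] := pselect (0 < CL); last first.
  rewrite nLp_eq0//; first by rewrite lee_fin !mulr_ge0.
    exact: mfun2M.
  by move=> x; rewrite (nu_const CL0 (h1 x) (h2 x)) subrr mul0r.
rewrite (_ : `|CL| * Mu * w = Mu * (CL * w)); last by rewrite gtr0_norm//; ring.
apply: nLp_weight => //; first exact: vM.
apply: (@le_trans _ _ (CL%:E * nLp X r (fun x => h1 x - h2 x)%R)%E).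
  apply: nLp_leZ => //; [by have := r2; lra|exact: ltW|exact: mfun2B|].
  by apply: nearW => x _; exact: nuL.
by rewrite EFinM lee_wpmul2l// lee_fin ltW.
Qed.

Variables (Dl : 'I_3 -> R -> R) (M : R).
Hypothesis sD : forall i, smooth1 (Dl i).
Hypothesis oD : forall i, off1 (Dl i).
Hypothesis dD : forall i k : 'I_3, moment (Dl i) k = (i == k)%:R.
Hypothesis bD : forall i t, `|Dl i t| <= M.

(** The bound of [affine_replacement], plus [N] for the case of a constant [nu]. *)
Definition affine_cst (kap : R) : R :=
  9 * ((4 * N * M ^+ 2 + 4 * N * M ^+ 2 * kap ^+ 2) * kap ^+ 4) + N.

(** For CL > 0 the replacement does not increase the L^r distance, and the Hoelder inequality
    applies. Otherwise [nu] is itself an affine approximation, with error 0. *)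
Lemma nu_affine K c s (kap : R) h (v : plane R -> plane R) g (b w : R) :
  0 < s -> 1 <= kap -> mset K -> boxc c s `<=` K -> K `<=` boxc c (kap * s) ->
  mfun2 K h -> mfun2 K (fun x => (v x).1) -> mfun2 K (fun x => (v x).2) -> 0 <= w ->
  (0 < CL -> (nLpv K p' v <= Mu%:E)%E) ->
  (nLp K r (fun x => dot g x + b - nu (h x))%R <= w%:E)%E ->
  exists g' b', (forall x, K x -> `|dot g' x + b'| <= affine_cst kap) /\
    (nLp K 2 (fun x => (dot g' x + b' - nu (h x)) * enorm (v x))%R <= (Mu * w)%:E)%E.
Proof.
move=> s0 k1 mK sK Ks mh m1 m2 w0 vM hw.
have N0 : 0 <= N by exact: le_trans (nuN 0).
have k0 : 0 <= kap by exact: le_trans k1.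
have M20 : 0 <= M ^+ 2 by exact: sqr_ge0.
have N4 : 0 <= 4 * N * M ^+ 2 by apply: mulr_ge0 => //; exact: mulr_ge0.
have mn : mfun2 K (fun x => nu (h x)) by exact: mfun2_comp.
have maff g' b' : mfun2 K (fun x => dot g' x + b').
  apply: borel_mfun2; apply: continuous_borel => x.
  by apply: continuousD; [exact: continuous_dotr|exact: cst_continuous].
have [CL0|CL0] := pselect (0 < CL).
  have r1 : 1 < r by have := r2; lra.
  have [g' [b' [h1 h2]]] := affine_replacement sD oD dD bD g b s0 k1 r1 N0 mK sK Ks mn (fun x => nuN _).
  exists g', b'; split; first by move=> x /h1 /le_trans; apply; rewrite lerDl.
  apply: nLp_weight => //; [by apply: mfun2B|exact: vM|exact: le_trans h2 hw].
exists 0, (nu 0); split.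
  move=> x _; rewrite (_ : dot 0 x + nu 0 = nu 0); last by rewrite /dot /= !mul0r !add0r.
  apply: (le_trans (nuN 0)); rewrite lerDr; apply: mulr_ge0 => //; apply: mulr_ge0.
    by apply: addr_ge0 => //; apply: mulr_ge0 => //; exact: sqr_ge0.
  exact: exprn_ge0.
rewrite nLp_eq0//; first by rewrite lee_fin mulr_ge0.
  by apply: mfun2M; [apply: mfun2B|exact: mfun2_enorm].
move=> x; rewrite (nu_const CL0 (h x) 0) (_ : dot 0 x + nu 0 = nu 0) ?subrr ?mul0r//.
by rewrite /dot /= !mul0r !add0r.
Qed.

End NormTools.

(** * Patches as finite unions of triangles *)

Section FiniteUnion.
Variable R : realType.
Local Notation leb := (leb2 R).
Local Notation mset D := (measurable (D : set (mplane R))).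

(** A list allows induction, so that measurability and inclusion up to null sets pass from the
    triangles to a patch. *)
Definition tri_union (s : seq (triangle R)) : set (plane R) :=
  [set x | exists2 K, K \in s & tri K x].

Lemma tri_union_cons K s : tri_union (K :: s) = tri K `|` tri_union s.
Proof.
apply/seteqP; split => x /=.
  by move=> [L]; rewrite inE => /orP[/eqP ->|Ls] Lx; [left|right; exists L].
by move=> [Kx|[L Ls Lx]]; [exists K; rewrite ?mem_head|exists L; rewrite ?inE ?Ls ?orbT].
Qed.

Lemma tri_union_tools s (f : plane R -> R) (D : set (plane R)) :
  (forall K, K \in s -> [/\ mset (tri K), mfun2 (tri K) f & {ae leb, forall x, tri K x -> D x}]) ->
  [/\ mset (tri_union s), mfun2 (tri_union s) f & {ae leb, forall x, tri_union s x -> D x}].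
Proof.
elim: s => [_|K s IH h].
  have -> : tri_union [::] = set0 by apply/seteqP; split => x //= [].
  split; [exact: measurable0|exact: measurable_fun_set0|by apply: nearW].
rewrite tri_union_cons; have [|m1 m2 m3] := IH; first by move=> L Ls; apply: h; rewrite inE Ls orbT.
have [k1 k2 k3] := h K (mem_head _ _); split.
- exact: measurableU.
- by apply/(measurable_funU _ k1 m1).
- by apply: ae2W (ae2_and k3 m3) => x [h1 h2] [/h1|/h2].
Qed.

Lemma patch_union Th K : patch_set Th K = tri_union [seq L <- Th | neighbour Th K L].
Proof.
apply/seteqP; split => x /=.
  by move=> [L /= [LTh nL] Lx]; exists L; rewrite ?mem_filter ?nL.
by move=> [L]; rewrite mem_filter => /andP[nL LTh] Lx; exists L.
Qed.

End FiniteUnion.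

(** * The indicator on one triangle *)

Section Assembly.
Variable R : realType.
Implicit Types (c x e g n m : plane R) (K L : triangle R).
Local Notation leb := (leb2 R).
Local Notation mset D := (measurable (D : set (mplane R))).

Lemma sqr_sum_le (I : Type) (s : seq I) (P : pred I) (J : I -> R) : (forall i, 0 <= J i) ->
  \sum_(i <- s | P i) J i ^+ 2 <= (\sum_(i <- s | P i) J i) ^+ 2.
Proof.
move=> J0; elim: s => [|i s IH]; first by rewrite !big_nil expr0n.
rewrite !big_cons; case: ifP => // _.
have S0 : 0 <= \sum_(j <- s | P j) J j by exact: sumr_ge0.
rewrite sqrrD -addrA lerD2l; apply: (le_trans IH); rewrite lerDr mulrn_wge0//.
exact: mulr_ge0.
Qed.

Variables (D : set (plane R)) (Th : seq (triangle R)) (M0 sigma : R).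
Hypotheses (oD : open D) (lD : lipschitz_boundary D) (DM : forall x, D x -> enorm x <= M0).
Hypotheses (cTh : conforming_mesh D Th) (sigma1 : 1 <= sigma).
Hypothesis regTh : forall K, K \in Th -> hK K <= sigma * indiam K.
Variables (nu : R -> R) (N CL Mu r p' : R).
Hypotheses (cnu : continuous nu) (nuN : forall t, `|nu t| <= N).
Hypothesis nuL : forall s t, `|nu s - nu t| <= CL * `|s - t|.
Hypotheses (r2 : 2 < r) (p2 : 2 < p') (rp : r^-1 + p'^-1 = 2^-1) (Mu0 : 0 <= Mu).
Variables (Dl : 'I_3 -> R -> R) (M : R).
Hypothesis sD : forall i, smooth1 (Dl i).
Hypothesis oDl : forall i, off1 (Dl i).
Hypothesis dD : forall i k : 'I_3, moment (Dl i) k = (i == k)%:R.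
Hypothesis bD : forall i t, `|Dl i t| <= M.
Hypothesis bD' : forall i t, `|derive1 (Dl i) t| <= M.
Variables (f u uh : plane R -> plane R) (pr ph T Tk : plane R -> R).
Hypotheses (Lf : Lpv D 2 f) (Lu : Lpv D 2 u) (Luh : Lpv D 2 uh).
Hypotheses (Lpr : Lp D 2 pr) (bph : borel_fun ph) (bT : borel_fun T).
Hypothesis mom : forall v, Hdiv0 D v ->
  \int[leb]_(x in D) (nu (T x) * dot (u x) (v x) - pr x * wdiv D v x) =
  \int[leb]_(x in D) dot (f x) (v x).
Hypothesis hX : forall K, K \in Th -> exists (a : R) (b : plane R),
  {ae leb, forall x, tri K x -> uh x = smul a x + b}.
Hypothesis hQ : forall K, K \in Th -> exists c : R, P0_on K ph c.
Hypothesis hV : forall K, K \in Th -> exists (a : plane R) (b : R),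
  forall x, tri K x -> Tk x = dot a x + b.
Hypothesis uM : 0 < CL -> (nLpv D p' u <= Mu%:E)%E.

Let N0 : 0 <= N. Proof. exact: le_trans (nuN 0). Qed.

Let ndTh K : K \in Th -> Defs.nondegenerate K. Proof. by case: cTh => _ h _ _; exact: h. Qed.

Let kap : R := 32 * sigma ^+ 2.

Let kap1 : 1 <= kap.
Proof.
have h : 1 <= sigma ^+ 2 by rewrite exprn_ege1.
by rewrite /kap; lra.
Qed.

Let kap0 : 0 < kap. Proof. exact: lt_le_trans kap1. Qed.

Let h0 K : K \in Th -> 0 < hK K. Proof. exact: (mesh_hK_gt0 DM cTh). Qed.

Lemma mesh_tri K : K \in Th -> [/\ mset (tri K), mfun2 (tri K) Tk &
  {ae leb, forall x, tri K x -> D x}].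
Proof.
move=> KTh; have ndK := ndTh KTh; have mK := measurable_tri ndK; split => //.
  have [a [b hab]] := hV KTh.
  apply: (@eq_measurable_fun _ _ _ _ _ (fun x => dot a x + b)).
    by move=> x /set_mem /hab.
  apply: borel_mfun2; apply: continuous_borel => x.
  by apply: continuousD; [exact: continuous_dotr|exact: cst_continuous].
by apply: ae2W (interior_tri_ae ndK) => x h /h; apply: (interior_tri_domain oD lD cTh KTh).
Qed.

Lemma P0_valueP K : K \in Th -> P0_on K ph (P0_value K ph).
Proof.
by move=> /hQ[c hc]; exact: (@xgetPex _ 0 [set c | P0_on K ph c] (ex_intro _ c hc)).
Qed.

Let bu1 : borel_fun (fun x => (u x).1). Proof. by case: Lu => -[]. Qed.
Let bu2 : borel_fun (fun x => (u x).2). Proof. by case: Lu => _ []. Qed.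

Lemma nLpv_u_le X : mset X -> {ae leb, forall x, X x -> D x} ->
  0 < CL -> (nLpv X p' u <= Mu%:E)%E.
Proof.
move=> mX XD /uM; apply: le_trans; have mD := open_measurable2 oD.
have p0 : 0 < p' by exact: lt_trans p2.
by apply: nLp_sub_ae => //; apply: mfun2_enorm; exact: borel_mfun2.
Qed.

Let Lw : R := `|CL| * Mu.
Let Lw0 : 0 <= Lw. Proof. exact: mulr_ge0. Qed.
Let C0 : R := affine_cst N M kap.
Let M2 : R := M ^+ 2.
Let M20 : 0 <= M2. Proof. exact: sqr_ge0. Qed.

Let C00 : 0 <= C0.
Proof.
apply: addr_ge0 => //; apply: mulr_ge0 => //; apply: mulr_ge0; last exact: exprn_ge0 (ltW kap0).
have h : 0 <= 4 * N * M ^+ 2 by apply: mulr_ge0 => //; exact: mulr_ge0.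
by apply: addr_ge0 => //; apply: mulr_ge0 => //; exact: sqr_ge0.
Qed.

(** The constant of [linear_bound], obtained from [residual_bound] by estimating each of the four
    data by their sum; 36 and 72 are 18 times 2 and 18 times 4. *)
Definition residual_cst : R :=
  (1 + Mu + Lw + C0 + N) * (1 + 36 * (kap ^+ 5 * M2)) + 72 * (kap ^+ 5 * M2) * kap +
  36 * (kap ^+ 5 * M2) * (Lw + N).

Let linear_bound (a0 c0 l0 n0 q0 k0 t z x y : R) : 0 <= a0 -> 0 <= c0 -> 0 <= l0 -> 0 <= n0 ->
  0 <= q0 -> 0 <= k0 -> 0 <= t -> 0 <= z -> 0 <= x -> 0 <= y ->
  (z + a0 * z + l0 * x + (c0 + n0) * y) + 18 * q0 * (4 * (k0 * t)) +
    18 * q0 * (2 * (l0 * x + n0 * y)) + 18 * q0 * (2 * (z + a0 * z + l0 * x + (c0 + n0) * y)) <=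
  ((1 + a0 + l0 + c0 + n0) * (1 + 36 * q0) + 72 * q0 * k0 + 36 * q0 * (l0 + n0)) * (t + z + x + y).
Proof.
move=> a00 c00 l00 n00 q00 k00 t0 z0 x0 y0; set Y := t + z + x + y.
have tY : t <= Y by rewrite /Y; lra.
have zY : z <= Y by rewrite /Y; lra.
have xY : x <= Y by rewrite /Y; lra.
have yY : y <= Y by rewrite /Y; lra.
have h1 := ler_wpM2l a00 zY; have h2 := ler_wpM2l l00 xY.
have h3 := ler_wpM2l (addr_ge0 c00 n00) yY; have h4 := ler_wpM2l n00 yY.
set A := z + a0 * z + l0 * x + (c0 + n0) * y.
have AY : A <= (1 + a0 + l0 + c0 + n0) * Y by rewrite /A; lra.
have q1 : 0 <= 1 + 36 * q0 by lra.
have h5 := ler_wpM2r q1 AY.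
have h6 := ler_wpM2l (mulr_ge0 q00 k00) tY.
have h7 : l0 * x + n0 * y <= (l0 + n0) * Y by lra.
have h8 := ler_wpM2l q00 h7.
by lra.
Qed.

Lemma residual_cst_ge0 : 0 <= residual_cst.
Proof.
have k5 : 0 <= kap ^+ 5 * M2 by apply: mulr_ge0 => //; exact: exprn_ge0 (ltW kap0).
have := @linear_bound Mu C0 Lw N (kap ^+ 5 * M2) kap 1 0 0 0 Mu0 C00 Lw0 N0 k5 (ltW kap0)
  ler01 (lexx 0) (lexx 0) (lexx 0).
rewrite !(mulr0, addr0, add0r, mulr1); apply: le_trans.
by apply: mulr_ge0; [exact: mulr_ge0|apply: mulr_ge0 => //; exact: ltW kap0].
Qed.

Lemma tri_residual K (ET Eu Ep S b : R) g c0 e : K \in Th -> enorm e = 1 ->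
  0 <= ET -> 0 <= Eu -> 0 <= Ep -> 0 <= S ->
  (nLp (tri K) r (fun x => T x - Tk x)%R <= ET%:E)%E ->
  (nLpv (tri K) 2 (fun x => u x - uh x)%R <= Eu%:E)%E ->
  (nLp (tri K) 2 (fun x => pr x - ph x)%R <= Ep%:E)%E ->
  (nLp (tri K) r (fun x => dot g x + b - nu (T x))%R <= (S / hK K)%:E)%E ->
  (nLpv (tri K) 2 (fun x => f x - c0)%R <= (S / hK K)%:E)%E ->
  (nLp (tri K) 2 (dir_residual nu f uh Tk e) <=
    (residual_cst * (Ep / hK K + S / hK K + ET + Eu))%:E)%E.
Proof.
move=> KTh e1 ET0 Eu0 Ep0 S0 hET hEu hEp hA hF.
have [mK mTk KD] := mesh_tri KTh; have hp := h0 KTh.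
have [c [sK sDo Ks]] := mesh_box oD lD DM cTh sigma1 regTh KTh.
set s := hK K / _ in sK sDo Ks; have sp : 0 < s by rewrite divr_gt0.
rewrite -/kap in Ks.
have [a [b0 huh]] := hX KTh; have [pK hph] := hQ KTh.
have mT : mfun2 (tri K) T by exact: borel_mfun2.
have mu1 := borel_mfun2 (D := tri K) bu1; have mu2 := borel_mfun2 (D := tri K) bu2.
have uK := nLpv_u_le mK KD.
have z0 : 0 <= S / hK K by rewrite divr_ge0// ltW.
have t0 : 0 <= Ep / hK K by rewrite divr_ge0// ltW.
have [g' [b' [hC0 hw]]] := nu_affine cnu nuN nuL r2 p2 rp Mu0 sD oDl dD bD sp kap1 mK sK Ks mT
  mu1 mu2 z0 uK hA.
have hW := nu_weight cnu nuL r2 p2 rp Mu0 mK mT mTk mu1 mu2 ET0 uK hET.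
have w0 : 0 <= Lw * ET by exact: mulr_ge0.
have wA0 : 0 <= Mu * (S / hK K) by exact: mulr_ge0.
have := residual_bound oD cnu nuN Lf Lu Luh Lpr bph bT mom sD oDl dD bD bD' sp kap1 mK sK sDo Ks
  e1 mTk hph huh C00 hC0 z0 wA0 w0 Eu0 Ep0 hF hw hW hEu hEp erefl.
move=> /le_trans; apply; rewrite lee_fin.
have k5 : 0 <= kap ^+ 5 * M2 by apply: mulr_ge0 => //; exact: exprn_ge0 (ltW kap0).
have := @linear_bound Mu C0 Lw N (kap ^+ 5 * M2) kap (Ep / hK K) (S / hK K) ET Eu Mu0 C00 Lw0 N0 k5
  (ltW kap0) t0 z0 ET0 Eu0.
apply: le_trans; rewrite le_eqVlt; apply/orP; left; apply/eqP.
have -> : 4 * M ^+ 2 * Ep / s = 4 * M2 * (kap * (Ep / hK K)).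
  by rewrite /s -/kap /M2; field; rewrite !gt_eqF.
by rewrite /M2; ring.
Qed.

Variable Ct : R.
Hypothesis Ct0 : 0 <= Ct.
Hypothesis transport : forall m n s, 0 < s -> n != 0 ->
  exists e (psi Fp Fm : plane R -> R),
  [/\ enorm e = 1, (forall U, boxc m s `<=` U -> test_fun U psi),
      forall x, `|psi x| <= Ct, forall x, `|dirder e psi x| <= Ct / s &
      forall x, dirder e psi x = Fm x - Fp x] /\
  [/\ continuous Fp, continuous Fm, \int[leb]_x Fp x = s, \int[leb]_x Fm x = s &
      (forall x, Fp x != 0 -> boxc m s x /\ 0 <= dot n (x - m)) /\
      (forall x, Fm x != 0 -> boxc m s x /\ dot n (x - m) <= 0)].

(** The summands come from the pressure error, the flux error, and the residuals on the two
    triangles of a side, where 2 sigma bounds h_K/h_L. *)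
Definition jump_cst : R := 2 * Ct * (kap + Lw + N + residual_cst * (2 + 2 * sigma)).

Lemma jump_cst_ge0 : 0 <= jump_cst.
Proof.
have C1 := residual_cst_ge0; have s1 := sigma1; have k0 := kap0; have l0 := Lw0; have n0 := N0.
apply: mulr_ge0; first exact: mulr_ge0.
by rewrite !addr_ge0// ?(ltW k0)// mulr_ge0//; lra.
Qed.

Section Patch.
Variables (K : triangle R) (ET Eu Ep S : R).
Hypothesis KTh : K \in Th.
Hypotheses (ET0 : 0 <= ET) (Eu0 : 0 <= Eu) (Ep0 : 0 <= Ep) (S0 : 0 <= S).
Local Notation NK := (patch_set Th K).
Hypothesis hET : (nLp NK r (fun x => T x - Tk x)%R <= ET%:E)%E.
Hypothesis hEu : (nLpv NK 2 (fun x => u x - uh x)%R <= Eu%:E)%E.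
Hypothesis hEp : (nLp NK 2 (fun x => pr x - ph x)%R <= Ep%:E)%E.
Hypothesis hS : forall L, L \in Th -> neighbour Th K L -> exists g (b : R) c0,
  (nLp (tri L) r (fun x => dot g x + b - nu (T x))%R <= (S / hK L)%:E)%E /\
  (nLpv (tri L) 2 (fun x => f x - c0)%R <= (S / hK L)%:E)%E.

Let NK_tools : [/\ mset NK, mfun2 NK Tk & {ae leb, forall x, NK x -> D x}].
Proof.
rewrite patch_union; apply: tri_union_tools => L; rewrite mem_filter => /andP[_ LTh].
exact: mesh_tri.
Qed.

Let bpr : borel_fun pr. Proof. by case: Lpr. Qed.
Let buh1 : borel_fun (fun x => (uh x).1). Proof. by case: Luh => -[]. Qed.
Let buh2 : borel_fun (fun x => (uh x).2). Proof. by case: Luh => _ []. Qed.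

Let mono L (q : R) (h : plane R -> R) : L \in Th -> neighbour Th K L -> 0 < q -> mfun2 NK h ->
  (nLp (tri L) q h <= nLp NK q h)%E.
Proof.
move=> LTh nL q0 mh; have [mL _ _] := mesh_tri LTh; have [mN _ _] := NK_tools.
have sub : tri L `<=` NK by move=> x Lx; exists L.
by apply: nLp_le => //; [exact: mfun2S mh|exact: nearW].
Qed.

(** The common majorant of residual and jumps once they are multiplied by h_K; the exchange of h_K
    for h_K^(2/p') is left to the end. *)
Let Y := Ep + S + hK K * (ET + Eu).

Lemma patch_residual L e : L \in Th -> neighbour Th K L -> enorm e = 1 ->
  (nLp (tri L) 2 (dir_residual nu f uh Tk e) <=
    (residual_cst * (Ep / hK L + S / hK L + ET + Eu))%:E)%E.
Proof.
move=> LTh nL e1; have [mN mTk _] := NK_tools; have [g [b [c0 [hA hF]]]] := hS LTh nL.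
have mD1 : mfun2 NK (fun x => (u x - uh x).1) by apply: mfun2B; exact: borel_mfun2.
have mD2 : mfun2 NK (fun x => (u x - uh x).2) by apply: mfun2B; exact: borel_mfun2.
apply: tri_residual hA hF => //.
- apply: le_trans hET; apply: mono => //; first by have := r2; lra.
  by apply: mfun2B => //; exact: borel_mfun2.
- by apply: le_trans hEu; apply: mono => //; exact: mfun2_enorm.
- by apply: le_trans hEp; apply: mono => //; apply: mfun2B; exact: borel_mfun2.
Qed.

Lemma patch_jump i : internal Th K i ->
  hK K * enorm (jump Th ph (side K i)) <= jump_cst * Y.
Proof.
move=> iK; have [L [m [n [[LTh nL hKL n0 jE] [QD QK QL]]]]] :=
  mesh_side oD lD DM cTh sigma1 regTh KTh iK.
set s := hK K / _ in QD QK QL; have hp := h0 KTh; have hl := h0 LTh.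
have sp : 0 < s by rewrite divr_gt0.
have nK : neighbour Th K K by rewrite /neighbour eqxx.
have [mK mTkK _] := mesh_tri KTh; have [mL mTkL _] := mesh_tri LTh.
have [mN mTk ND] := NK_tools.
have QN : boxc m s `<=` NK.
  move=> x Qx; have [h|h] := leP 0 (dot n (x - m)); first by exists K => //; exact: QK.
  by exists L => //; apply: QL => //; exact: ltW.
have [e [psi [Fp [Fm [P1 P2]]]]] := transport m sp n0.
have e1 : enorm e = 1 by case: P1.
have hr := leeD (patch_residual KTh nK e1) (patch_residual LTh nL e1).
rewrite -EFinD in hr; set rr := (X in (_ <= X%:E)%E) in hr.
have mu1 := borel_mfun2 (D := NK) bu1; have mu2 := borel_mfun2 (D := NK) bu2.
have mT : mfun2 NK T by exact: borel_mfun2.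
have hW := nu_weight cnu nuL r2 p2 rp Mu0 mN mT mTk mu1 mu2 ET0 (nLpv_u_le mN ND) hET.
have hw := nLp_flux_error cnu nuN Lu Luh bT e1 mN mTk hW hEu.
have := jump_bound oD cnu nuN Lf Lu Luh Lpr bph bT mom sp Ct0 mK mL mN QD QN QK QL P1 P2 mTkK mTkL mTk
  (P0_valueP KTh) (P0_valueP LTh) hEp hw hr.
rewrite -jE -/Lw; set J := enorm _ => hJ.
have sE : hK K = kap * s by rewrite /s -/kap mulrC mulfVK// gt_eqF.
(* The residual on [L] comes with 1/h_L; multiplied by h_K this is at most 2 sigma. *)
have rrE : rr * hK K <= residual_cst * ((2 + 2 * sigma) * Y).
  have hh : hK K / hK L <= 2 * sigma by rewrite ler_pdivrMr.
  have -> : rr * hK K = residual_cst *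
      (Ep + S + hK K * (ET + Eu) + ((Ep + S) * (hK K / hK L) + hK K * (ET + Eu))).
    by rewrite /rr; field; rewrite !gt_eqF.
  apply: ler_wpM2l; first exact: residual_cst_ge0.
  have ES : 0 <= Ep + S by exact: addr_ge0.
  have EE : 0 <= hK K * (ET + Eu) by rewrite mulr_ge0 ?addr_ge0// ltW.
  have h1 := ler_wpM2l ES hh; have sg : 0 <= 2 * sigma by have := sigma1; lra.
  by have := mulr_ge0 sg EE; rewrite -/Y /Y; lra.
have YE : Ep <= Y.
  by rewrite /Y -addrA lerDl addr_ge0// mulr_ge0 ?addr_ge0// ltW.
have XE : hK K * (Lw * ET + N * Eu) <= (Lw + N) * Y.
  have a1 : hK K * ET <= Y.
    by rewrite /Y mulrDr; have := mulr_ge0 (ltW hp) Eu0; have := Ep0; have := S0; lra.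
  have a2 : hK K * Eu <= Y.
    by rewrite /Y mulrDr; have := mulr_ge0 (ltW hp) ET0; have := Ep0; have := S0; lra.
  by have := ler_wpM2l Lw0 a1; have := ler_wpM2l N0 a2; lra.
have k0 := kap0; have hJ' := ler_wpM2l (ltW k0) hJ.
have c2 : 0 <= 2 * Ct by exact: mulr_ge0.
have h1 := ler_wpM2l c2 rrE; have h2 := ler_wpM2l c2 XE.
have h3 := ler_wpM2l (mulr_ge0 c2 (ltW k0)) YE.
rewrite /jump_cst; move: hJ' h1 h2 h3; rewrite sE; lra.
Qed.

Let Y0 : 0 <= Y.
Proof.
by rewrite /Y !addr_ge0// mulr_ge0 ?addr_ge0// ltW// h0.
Qed.

(** The gradient of [ph] vanishes almost everywhere on [K], so the components of the residual are
    its values in the two coordinate directions; hence the factor 2. The norm is given as a real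
    number [q] for use inside the indicator. *)
Lemma patch_residual_norm :
  exists2 q : R, nLpv (tri K) 2 (residual nu f uh ph Tk K) = q%:E &
    0 <= q /\ hK K * q <= 2 * residual_cst * Y.
Proof.
have ndK := ndTh KTh; have hp := h0 KTh; have [mK mTk _] := mesh_tri KTh.
have nK : neighbour Th K K by rewrite /neighbour eqxx.
have oI : open (interior (tri K)) by exact: open_interior.
pose v x := f x - smul (nu (Tk x)) (uh x).
have gz : {ae leb, forall x, tri K x -> wgrad (interior (tri K)) ph x = 0}.
  have [c hc] := hQ KTh.
  have hci : {ae leb, forall x, interior (tri K) x -> ph x = c}.
    by apply: ae2W hc => x h /interior_subset /h.
  have [_ ae] := wgrad_ae_eq oI (is_wgrad_const_ae oI bph hci).
  by apply: ae2W (ae2_and ae (interior_tri_ae ndK)) => x [h1 h2] /h2 /h1 ->.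
have [_ [bg1 bg2] _ _] : is_wgrad (interior (tri K)) ph (wgrad (interior (tri K)) ph).
  have [c hc] := hQ KTh.
  have hci : {ae leb, forall x, interior (tri K) x -> ph x = c}.
    by apply: ae2W hc => x h /interior_subset /h.
  by have [] := wgrad_ae_eq oI (is_wgrad_const_ae oI bph hci).
have e10 : enorm ((1, 0) : plane R) = 1 by rewrite /enorm /dot /= mulr0 addr0 mulr1 sqrtr1.
have e01 : enorm ((0, 1) : plane R) = 1 by rewrite /enorm /dot /= mulr0 add0r mulr1 sqrtr1.
have d1 : (fun x => (v x).1) = dir_residual nu f uh Tk (1, 0).
  by apply/funext => x; rewrite /dir_residual /v /dot /= mulr0 addr0 mulr1.
have d2 : (fun x => (v x).2) = dir_residual nu f uh Tk (0, 1).
  by apply/funext => x; rewrite /dir_residual /v /dot /= mulr0 add0r mulr1.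
have mv1 : mfun2 (tri K) (fun x => (v x).1).
  by rewrite d1; apply: (mfun2_dir_residual cnu Lf Luh).
have mv2 : mfun2 (tri K) (fun x => (v x).2).
  by rewrite d2; apply: (mfun2_dir_residual cnu Lf Luh).
have hv : nLpv (tri K) 2 (residual nu f uh ph Tk K) = nLpv (tri K) 2 v.
  apply: nLp_ae_eq => //; last by apply: ae2W gz => x h Kx; rewrite /residual h// subr0.
    by apply: mfun2_enorm; apply: mfun2B => //; exact: borel_mfun2.
  exact: mfun2_enorm.
have := patch_residual KTh nK e10; have := patch_residual KTh nK e01; rewrite -d1 -d2.
set w := residual_cst * _ => w2 w1.
have vw : (nLpv (tri K) 2 v <= (w + w)%:E)%E.
  apply: (le_trans (nLpv_le (ler1n _ 2) mK mv1 mv2)); rewrite EFinD.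
  exact: leeD.
have vfin : nLpv (tri K) 2 v = (fine (nLpv (tri K) 2 v))%:E.
  by rewrite fineK// ge0_fin_numE ?nLp_ge0//; exact: le_lt_trans vw (ltry _).
exists (fine (nLpv (tri K) 2 v)); first by rewrite hv.
split; first by rewrite fine_ge0// nLp_ge0.
have qw : fine (nLpv (tri K) 2 v) <= w + w by rewrite -lee_fin -vfin.
apply: (le_trans (ler_wpM2l (ltW hp) qw)); rewrite le_eqVlt; apply/orP; left; apply/eqP.
by rewrite /w /Y; field; rewrite gt_eqF.
Qed.

(** The square root of a sum of squares is at most the sum: one residual term and at most three
    sides. *)
Lemma patch_indicator :
  (indicator Th nu f uh ph Tk K <= ((2 * residual_cst + 3 * jump_cst) * Y)%:E)%E.
Proof.
have hp := h0 KTh; have [q qE [q0 hq]] := patch_residual_norm.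
rewrite /indicator qE -EFin_expe -EFinM -EFinD poweR_EFin lee_fin.
pose J i := hK K * enorm (jump Th ph (side K i)).
have J0 i : 0 <= J i by rewrite mulr_ge0 ?enorm_ge0// ltW.
have SJ : \sum_(i < 3 | internal Th K i) J i <= 3 * (jump_cst * Y).
  have c0 : 0 <= jump_cst * Y by apply: mulr_ge0 => //; exact: jump_cst_ge0.
  rewrite big_mkcond (sum3 ord0).
  have b i : (if internal Th K i then J i else 0) <= jump_cst * Y.
    by case: ifP => // iK; exact: patch_jump.
  rewrite (_ : 3 * (jump_cst * Y) = jump_cst * Y + jump_cst * Y + jump_cst * Y); last by ring.
  by rewrite !lerD.
have SJ0 : 0 <= \sum_(i < 3 | internal Th K i) J i by exact: sumr_ge0.
have le2 : hK K ^+ 2 * q ^+ 2 + hK K * jump_sqnorm Th ph K <=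
    (hK K * q + \sum_(i < 3 | internal Th K i) J i) ^+ 2.
  have := jump_sqnorm_le DM cTh ph KTh; have := sqr_sum_le (index_enum _) (internal Th K) J0.
  move=> h1 h2; rewrite sqrrD -exprMn -addrA lerD2l.
  apply: (le_trans h2); apply: (le_trans h1); rewrite lerDr mulrn_wge0// mulr_ge0//.
  by rewrite mulr_ge0// ltW.
have b0 : 0 <= hK K * q + \sum_(i < 3 | internal Th K i) J i.
  by rewrite addr_ge0// mulr_ge0// ltW.
apply: (@le_trans _ _ (hK K * q + \sum_(i < 3 | internal Th K i) J i)); last by lra.
have js0 : 0 <= hK K ^+ 2 * q ^+ 2 + hK K * jump_sqnorm Th ph K.
  apply: addr_ge0; first by apply: mulr_ge0; exact: sqr_ge0.
  apply: mulr_ge0; first exact: ltW.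
  apply: sumr_ge0 => i _; apply: mulr_ge0; first exact: enorm_ge0.
  by apply: Rintegral_ge0 => t _; exact: sqr_ge0.
by rewrite powR12_sqrt// -[leRHS]ger0_norm// -sqrtr_sqr ler_sqrt ?sqr_ge0.
Qed.

End Patch.

End Assembly.

(** * Constants and the final absorption *)

Section Constants.
Variable R : realType.

(** Allows the shape-regularity constant to be enlarged to one that is at least 1. Without a
    supremum [sup] is 0. *)
Lemma indiam_ge0 (K : triangle R) : 0 <= indiam K.
Proof.
rewrite /indiam; set E := [set d | _]; have [hE|/sup_out ->//] := pselect (has_sup E).
have [d Ed] := hE.1; have [c [r [r0 dE _]]] := Ed.
apply: (@le_trans _ _ d); first by rewrite dE mulr_ge0.
exact: sup_upper_bound hE _ Ed.
Qed.

Lemma lipschitz_continuous1 (nu : R -> R) (CL : R) :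
  (forall s t, `|nu s - nu t| <= CL * `|s - t|) -> continuous nu.
Proof.
move=> nuL x; apply/cvgrPdist_le => e e0.
have c0 : 0 < `|CL| + 1 by rewrite ltr_wpDl.
near=> y; apply: (le_trans (nuL x y)).
apply: (@le_trans _ _ ((`|CL| + 1) * `|x - y|)).
  by rewrite ler_wpM2r// (le_trans (ler_norm CL))// lerDl.
rewrite -ler_pdivlMl// mulrC; near: y.
by apply: cvgr_dist_le => //; rewrite divr_gt0.
Unshelve. all: by end_near. Qed.

Lemma nuh_affine (nu : R -> R) (S : plane R -> R) (K : triangle R) :
  exists g (b : R), nuh nu S K = fun x => dot g x + b.
Proof.
rewrite /nuh; set a := _ * _; set g := smul _ _.
exists g, (a - dot g (barycenter K)); apply/funext => x.
by move: (barycenter K) => y; rewrite /dot /=; ring.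
Qed.

(** Since h = h^(1-q) h^q, the first factor can be replaced by its value at the upper bound; with q
    = 2/p' this turns the weight h_K into the stated power. *)
Lemma powR_interpolation (h H q : R) : 0 < h -> h <= H -> 0 <= q <= 1 ->
  h <= H `^ (1 - q) * h `^ q.
Proof.
move=> h0 hH /andP[q0 q1]; have {1}-> : h = h `^ (1 - q) * h `^ q.
  by rewrite -powRD ?subrK ?powRr1 ?(ltW h0)// (gt_eqF h0) implybT.
rewrite ler_wpM2r ?powR_ge0//; apply: ge0_ler_powR => //.
- by rewrite subr_ge0.
- by rewrite nnegrE ltW.
- by rewrite nnegrE (le_trans (ltW h0)).
Qed.

Lemma scaled_bound (C H a h x y w : R) : 0 <= C -> 0 <= H -> 0 <= a -> 0 <= x -> 0 <= y ->
  0 <= w -> h <= H * a -> C * (x + y + h * w) <= C * (1 + H) * (a * w + x + y).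
Proof.
move=> C0 H0 a0 x0 y0 w0 ha; rewrite -mulrA; apply: ler_wpM2l => //.
have := ler_wpM2r w0 ha; have := mulr_ge0 H0 x0; have := mulr_ge0 H0 y0.
by have := mulr_ge0 a0 w0; lra.
Qed.

End Constants.

Theorem theorem5p6 (R : realType)
  (Omega : set (plane R)) (z : plane R)
  (nu : R -> R) (CL num nup : R) (kappa : R)
  (f : plane R -> plane R)
  (mesh : nat -> seq (triangle R))
  (eps hs p p' : R) (Ce Ckap tCkap rho vrho : R) :
  let cC := (2 * Ce * Ckap)^-1 in
  let tcC := (2 * Ce * tCkap)^-1 in
  let r := sobolev_exp p in
  polygonal_domain Omega -> Omega z ->
  (forall s t, `|nu s - nu t| <= CL * `|s - t|) ->
  0 < num -> (forall s, num <= nu s <= nup) ->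
  mesh_family Omega mesh ->
  0 < eps -> 0 < hs ->
  (forall k, admissible hs k ->
     exists uh ph Th, discrete_solution Omega (mesh k) nu kappa f z uh ph Th) ->
  1 < p -> 2 - eps <= p < 2 -> p^-1 + p'^-1 = 1 ->
  best_embedding_constant Omega p Ce ->
  infsup_constant Omega p p' kappa (W1p0 Omega p) (W1p0 Omega p') Ckap ->
  (forall k, admissible hs k ->
     infsup_constant Omega p p' kappa
       (Vh Omega (mesh k)) (Vh Omega (mesh k)) tCkap) ->
  0 < kappa ->
  W2oo nu ->
  W1p Omega 2 (fun x => (f x).1) -> W1p Omega 2 (fun x => (f x).2) ->
  (nLpv Omega 2 f <= (num * Num.min cC tcC)%:E)%E ->
  0 < rho < 1 -> 0 < vrho < 1 ->
  exists2 C : R, 0 < C &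
  forall (u : plane R -> plane R) (pr T : plane R -> R),
  continuous_solution Omega p p' nu kappa f z u pr T ->
  forall k, admissible hs k ->
  forall (uh : plane R -> plane R) (ph Th : plane R -> R),
  discrete_solution Omega (mesh k) nu kappa f z uh ph Th ->
  let eT := fun x => T x - Th x in
  let eu := fun x => u x - uh x in
  let ep := fun x => pr x - ph x in
  let enu := fun K x => nuh nu T K x - nu (T x) in
  let ef := fun K x => f x - proj0 K f in
  (cC^-1%:E * nLpv Omega 2 eu <= rho%:E)%E ->
  Lpv Omega p' u ->
  (CL%:E * delta_norm Omega z p' * nLpv Omega p' u
     <= (vrho * (1 - rho) * num * cC ^+ 2)%:E)%E ->
  forall K, K \in mesh k ->
  let NK := patch_set (mesh k) K in
  (indicator (mesh k) nu f uh ph Th K <=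
   C%:E * ((hK K `^ (2 / p'))%:E *
             (nLpv NK 2 eu + nLp NK r eT + nLpv NK p (wgrad Omega eT))
           + nLp NK 2 ep
           + \sum_(K' <- mesh k | neighbour (mesh k) K K')
               (hK K')%:E *
                 (nLp (tri K') r (enu K')
                  + nLpv (tri K') 2 (ef K'))))%E.
Proof.
move=> cC tcC r polyD Dz nuL num0 nuB meshF _ _ _ p1 p2 pp' _ _ _ _ _ Wf1 Wf2 _ _ _.
have [oD _ [M0 DM] lD _] := polyD; have [cmesh _ [sigma0 reg]] := meshF.
have mD := open_measurable2 oD.
have pE : 1 < p < 2 by case/andP: p2 => _ ->; rewrite p1.
have [p3 p4] := andP pE; have pp0 : 0 < p by lra.
have p'i : p'^-1 = 1 - p^-1 by lra.
have pi : 2^-1 < p^-1 by rewrite ltf_pV2 ?posrE.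
have pi1 : p^-1 < 1 by rewrite invf_lt1.
have p'i0 : 0 < p'^-1 by lra.
have p'0 : 0 < p' by rewrite -invr_gt0.
have p'2 : 2 < p' by rewrite -ltf_pV2 ?posrE// p'i; lra.
(* Since 1/r = 1/p - 1/2, the condition r > 2 amounts to p > 1, just as p' > 2 amounts to p < 2. *)
have r2 : 2 < r by rewrite /r /sobolev_exp ltr_pdivlMr; lra.
have rp : r^-1 + p'^-1 = 2^-1.
  by rewrite p'i /r /sobolev_exp invf_div; field; lra.
have nuN t : `|nu t| <= nup.
  by have /andP[h1 h2] := nuB t; rewrite ger0_norm//; exact: le_trans (ltW num0) h1.
have N0 : 0 <= nup by exact: le_trans (nuN 0).
have cnu := lipschitz_continuous1 nuL.
have [Dl hDl] := dual_functions R.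
have [|Mf hMf] := @choice 'I_3 R (fun i m =>
    (forall t, `|Dl i t| <= m) /\ (forall t, `|derive1 (Dl i) t| <= m)).
  move=> i; have [s1 o1 _] := hDl i.
  have [a ha] := off1_bound (smooth1_continuous s1) o1.
  have [b hb] := off1_bound (smooth1_continuous (smooth1_derive s1)) (off1_derive o1).
  by exists (Num.max a b); split=> t; rewrite le_max ?ha ?hb ?orbT.
(* One bound for the three dual functions and their derivatives. *)
pose M : R := \sum_i `|Mf i|.
have MfM i : Mf i <= M.
  apply: (le_trans (ler_norm _)); rewrite /M (bigD1 i)//= lerDl; exact: sumr_ge0.
have sD i : smooth1 (Dl i) by case: (hDl i).
have oDl i : off1 (Dl i) by case: (hDl i).
have dD (i k : 'I_3) : moment (Dl i) k = (i == k)%:R by case: (hDl i) => _ _; exact.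
have bD i t : `|Dl i t| <= M by exact: le_trans ((hMf i).1 t) (MfM i).
have bD' i t : `|derive1 (Dl i) t| <= M by exact: le_trans ((hMf i).2 t) (MfM i).
have [Ct Ct0 trans] := transport_exists R.
have p'1 : 1 <= p' by lra.
have [d d0 hd] := delta_norm_gt0 p'1 oD Dz.
(* For CL > 0 the smallness assumption, with the dual norm bounded below by [d], gives this bound on
   [u], which is the same for all solutions. The maximum keeps it nonnegative in every case. *)
pose Mu : R := Num.max 0 (vrho * (1 - rho) * num * cC ^+ 2 / (CL * d)).
have Mu0 : 0 <= Mu by rewrite le_max lexx.
pose sigma : R := Num.max 1 sigma0.
have sigma1 : 1 <= sigma by rewrite le_max lexx.
have regk k K : K \in mesh k -> hK K <= sigma * indiam K.
  move=> /reg h; apply: (le_trans h); rewrite ler_wpM2r ?indiam_ge0// le_max lexx orbT//.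
pose C1 := residual_cst sigma nup CL Mu M; pose Cj := jump_cst sigma nup CL Mu M Ct.
have C10 : 0 <= C1 by exact: (residual_cst_ge0 sigma1 CL nuN Mu0).
have Cj0 : 0 <= Cj by exact: (jump_cst_ge0 sigma1 CL nuN Mu0 M Ct0).
(* The domain lies in the disk of radius [M0], so h_K <= 2 M0; [H] is the factor lost in passing
   from h_K to h_K^(2/p'). *)
pose H := (1 + 2 * `|M0|) `^ (1 - 2 / p').
have H0 : 0 <= H by exact: powR_ge0.
(* The summand 1 only ensures that the constant is positive. *)
exists ((2 * C1 + 3 * Cj) * (1 + H) + 1).
  by rewrite ltr_wpDl// mulr_ge0// addr_ge0// mulr_ge0.
move=> u pr T [Hu [Lpr _] W1T [mom _ _]] k adm uh ph Th [[Huh hX] [[Lph _] hQ] [_ hV _] _].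
move=> eT eu ep enu ef _ Lpu hdelta K KTh; cbv zeta.
have hp : 0 < hK K := mesh_hK_gt0 DM (cmesh k) KTh.
have Lf : Lpv Omega 2 f by split; [case: Wf1|case: Wf2].
have Lu : Lpv Omega 2 u by case: Hu.
have Luh : Lpv Omega 2 uh by case: Huh.
have bph : borel_fun ph by case: Lph.
have bT : borel_fun T by case: W1T => -[[bT _] _ _] _.
have uM : 0 < CL -> (nLpv Omega p' u <= Mu%:E)%E.
  move=> CL0; have hx : 0 < CL * d by exact: mulr_gt0.
  apply: (@le_trans _ _ (vrho * (1 - rho) * num * cC ^+ 2 / (CL * d))%:E); last first.
    by rewrite lee_fin le_max lexx orbT.
  rewrite EFinM lee_pdivlMr// muleC; apply: le_trans hdelta.
  rewrite EFinM; apply: lee_wpmul2r; first exact: nLp_ge0.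
  by apply: lee_wpmul2l => //; rewrite lee_fin ltW.
have a0 : 0 < hK K `^ (2 / p') by exact: powR_gt0.
have S0 : (0 <= \sum_(K' <- mesh k | neighbour (mesh k) K K')
    (hK K')%:E * (nLp (tri K') r (enu K') + nLpv (tri K') 2 (ef K')))%E.
  rewrite big_seq_cond; apply: sume_ge0 => L /andP[LTh _].
  by rewrite mule_ge0 ?adde_ge0 ?nLp_ge0// lee_fin ltW// (mesh_hK_gt0 DM (cmesh k)).
apply: ereal_bound => //; try exact: nLp_ge0.
  by rewrite ltr_wpDl// mulr_ge0// addr_ge0// mulr_ge0.
move=> Eu ET Ep S hEu hET hEp hS.
have Eu0 : 0 <= Eu by rewrite -lee_fin -hEu nLp_ge0.
have ET0 : 0 <= ET by rewrite -lee_fin -hET nLp_ge0.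
have Ep0 : 0 <= Ep by rewrite -lee_fin -hEp nLp_ge0.
have SS0 : 0 <= S by rewrite -lee_fin -hS.
(* A single term h_L (x + y) of the sum is at most the whole sum [S], so each of its two norms is at
   most S/h_L. The approximations are [nuh nu T L], affine by [nuh_affine], and [proj0 L f]. *)
have hSL L : L \in mesh k -> neighbour (mesh k) K L -> exists g (b : R) c0,
  (nLp (tri L) r (fun x => dot g x + b - nu (T x))%R <= (S / hK L)%:E)%E /\
  (nLpv (tri L) 2 (fun x => f x - c0)%R <= (S / hK L)%:E)%E.
  move=> LTh nL; have hl : 0 < hK L := mesh_hK_gt0 DM (cmesh k) LTh.
  have [g [b gb]] := nuh_affine nu T L; exists g, b, (proj0 L f).
  have uTh : uniq (mesh k) by case: (cmesh k).
  apply: mul_add_le => //; try exact: nLp_ge0.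
  rewrite -hS -big_filter (bigD1_seq L) ?filter_uniq ?mem_filter ?nL//=.
  rewrite /enu /ef gb leeDl// big_seq_cond; apply: sume_ge0 => L'.
  rewrite mem_filter => /andP[/andP[_ L'Th] _].
  by rewrite mule_ge0 ?adde_ge0 ?nLp_ge0// lee_fin ltW// (mesh_hK_gt0 DM (cmesh k)).
have := @patch_indicator R Omega (mesh k) M0 sigma oD lD DM (cmesh k) sigma1 (@regk k) nu nup CL Mu r p'
  cnu nuN nuL r2 p'2 rp Mu0 Dl M sD oDl dD bD bD' f u uh pr ph T Th Lf Lu Luh Lpr bph bT mom hX hQ hV uM
  Ct Ct0 trans K ET Eu Ep S KTh ET0 Eu0 Ep0 SS0.
rewrite -hET -hEu -hEp !lexx => /(_ isT isT isT hSL) /le_trans; apply; rewrite lee_fin.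
rewrite -/C1 -/Cj; set C5 := 2 * C1 + 3 * Cj.
have C50 : 0 <= C5 by rewrite addr_ge0// mulr_ge0.
set a := hK K `^ _ in a0 *.
have ha : hK K <= H * a.
  apply: powR_interpolation => //; last by rewrite ltW ?divr_gt0//= ler_pdivrMr// mul1r ltW.
  have ndK : Defs.nondegenerate K by case: (cmesh k) => _ h _ _; exact: h.
  apply: (le_trans (hK_le ndK (tri_bounded DM (cmesh k) KTh))).
  by rewrite -[leLHS]add0r; apply: lerD => //; rewrite ler_pM2l// ler_norm.
have EE : 0 <= ET + Eu by exact: addr_ge0.
apply: (@le_trans _ _ (C5 * (1 + H) * (a * (Eu + ET) + Ep + S))).
  by rewrite (addrC Eu); apply: scaled_bound => //; exact: ltW.
apply: ler_wpM2r; last by rewrite lerDl.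
by rewrite !addr_ge0// mulr_ge0 ?addr_ge0// ltW.
Qed.
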